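(* Let $\{x,a\}\subset\mathbb N_0$. Assume (E) holds. If $\mu>0$ and $\phi<\varphi$, then, for $a\le x$, $$\mathsf P_x[\zeta\wedge T_a^-]=\int_\varphi^1\left(v^x-v^a\,\frac{\int_0^\varphi\frac{\exp\left\{-\int_\phi^z\frac{\mu(1-\tilde r(w))}{\lambda(\tilde p(w)-w)}\mathrm dw\right\}}{\lambda(\tilde p(z)-z)}z^x\,\mathrm dz}{\int_0^\varphi\frac{\exp\left\{-\int_\phi^z\frac{\mu(1-\tilde r(w))}{\lambda(\tilde p(w)-w)}\mathrm dw\right\}}{\lambda(\tilde p(z)-z)}z^a\,\mathrm dz}\right)\frac{\exp\left(-\int_v^1\frac{\mu(1-\tilde r(w))}{\lambda(w-\tilde p(w))}\mathrm dw\right)}{\lambda(v-\tilde p(v))}\,\mathrm dv<\infty.$$ If $\mu=0$, then $$\mathsf P_x[\zeta\wedge T_0^-]=\int_0^1\frac{v^x-\varphi^x}{\lambda(v-\tilde p(v))}\,\mathrm dv<\infty,$$ in fact $$\mathsf P_x[\zeta;\zeta<\infty]=\int_\varphi^1\frac{v^x-\varphi^x}{\lambda(v-\tilde p(v))}\,\mathrm dv<\infty\quad\text{and}\quad \mathsf P_x[T_0^-;T_0^-<\infty]=\int_0^\varphi\frac{\varphi^x-v^x}{\lambda(\tilde p(v)-v)}\,\mathrm dv<\infty.$$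
   Context: Setting. $\mathbb N=\{1,2,\dots\}$, $\mathbb N_0=\mathbb N\cup\{0\}$. Fix $\lambda\in(0,\infty)$, $\mu\in[0,\infty)$, a probability distribution $p=(p_k)_{k\in\mathbb N_0}$ with $p_0>0$ and $p_1=0$, and a probability distribution $r=(r_k)_{k\in\{-1\}\cup\mathbb N}$ (put $r_0:=0$). Assume that $\mu r_k>0$ for some $k\in\mathbb N$ or $p_0<1$. Under probabilities $(\mathsf P_x)_{x\in\mathbb N_0}$, $X=(X_t)_{t\in[0,\infty)}$ is a minimal càdlàg continuous-time Markov chain with state space $\mathbb N_0$, started from $x$ under $\mathsf P_x$, with explosion time (lifetime) $\zeta$, $X$ being set equal to $\infty$ on $[\zeta,\infty)$, and with conservative generator matrix $(Q_{ij})$: $Q_{00}=0$ (state $0$ is absorbing) and, for $n\in\mathbb N$, $-Q_{nn}=\lambda n+\mu$, $Q_{n(n+m)}=p_{m+1}\lambda n+r_m\mu$ for $m\in\mathbb N\cup\{-1\}$. For $a\in\mathbb N_0$, $T_a^-:=\inf\{t\in[0,\zeta):X_t\le a\}$, $\inf\emptyset:=\infty$. We write $\mathsf P_x[F;A]=\mathsf E_{\mathsf P_x}[F\mathbf 1_A]$ and $\mathsf P_x[F]=\mathsf E_{\mathsf P_x}[F]$. Condition (E): $\mathsf P_x(\zeta<\infty)>0$ for some (equivalently, all) $x\in\mathbb N$. Generating functions and roots. For $z\in(0,1]$, $\tilde p(z):=\sum_{k=0}^\infty p_kz^k$ and $\tilde r(z):=\sum_{k=-1}^\infty r_kz^k$.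 $\varphi$ is the smallest root of $\tilde p(z)=z$ in $z\in(0,1]$. If $\mu r_{-1}>0$, $\phi$ is the smallest root of $\tilde r(z)=1$ in $z\in(0,1]$; if $\mu r_{-1}=0$, then $\phi:=0$. *)

(* Defs.v *)
From mathcomp Require Import all_boot all_order all_algebra.
From mathcomp Require Import all_classical all_reals all_analysis.
From mathcomp Require Import measurable_realfun.

Set Implicit Arguments.
Unset Strict Implicit.
Unset Printing Implicit Defensive.

Import Order.TTheory GRing.Theory Num.Theory.
Import numFieldNormedType.Exports.

Local Open Scope classical_set_scope.
Local Open Scope ring_scope.

Section MinimalChain.
Context {R : realType}.
Implicit Types (Q : nat -> nat -> R).

Definition exit_rate Q (i : nat) : R := - Q i i.

Definition jump_prob Q (i j : nat) : R :=
  if exit_rate Q i == 0 then (i == j)%:R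
  else if i == j then 0 else Q i j / exit_rate Q i.

Context {d : measure_display} {T : measurableType d}.

Definition jump_time (S : nat -> T -> \bar R) (n : nat) (w : T) : \bar R :=
  (\sum_(k < n) S k w)%E.

(* Minimal chain started from x with generator Q, by its jump chain Y and its
   holding times S: Y is Markov with transition matrix [jump_prob Q] and, given
   Y, the S k are independent and exponential with rate [exit_rate Q (Y k)].
   A holding time is +oo at an absorbing state, hence values in \bar R.
   X t w = None encodes X = infinity, from the explosion time
   sup_n (jump_time S n w) on.  Paths are indexed by R, and their values at
   negative times are irrelevant. *)
Definition minimal_chain Q (P : probability T R) (x : nat)
    (X : R -> T -> option nat) : Prop :=
  exists (Y : nat -> T -> nat) (S : nat -> T -> \bar R),
    [/\ forall n, measurable_fun [set: T] (Y n),
        forall n, measurable_fun [set: T] (S n) /\ (forall w, (0 < S n w)%E),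
        forall (n : nat) (i : nat -> nat) (t : nat -> R),
          (forall k, 0 <= t k) ->
          P [set w | forall k, (k <= n)%N ->
                       Y k w = i k /\ ((t k)%:E < S k w)%E]
          = ((i 0%N == x)%:R
             * \prod_(k < n) jump_prob Q (i k) (i k.+1)
             * \prod_(k < n.+1) expR (- (exit_rate Q (i k) * t k)))%:E,
        forall (t : R) (w : T) (n : nat), 0 <= t ->
          (jump_time S n w <= t%:E)%E -> (t%:E < jump_time S n.+1 w)%E ->
          X t w = Some (Y n w)
      & forall (t : R) (w : T), 0 <= t ->
          (forall n, (jump_time S n w <= t%:E)%E) -> X t w = None].

Definition lifetime (X : R -> T -> option nat) (w : T) : \bar R :=
  ereal_inf [set t%:E | t in [set t : R | 0 <= t /\ X t w = None]].

Definition hit_below (a : nat) (X : R -> T -> option nat) (w : T) : \bar R :=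
  ereal_inf [set t%:E | t in [set t : R | [/\ 0 <= t, (t%:E < lifetime X w)%E
    & exists2 n, X t w = Some n & (n <= a)%N]]].

End MinimalChain.

Section Model.
Context {R : realType}.
Variables (lambda mu : R) (p : nat -> R) (r : int -> R).

Definition parameters : Prop :=
  [/\ 0 < lambda /\ 0 <= mu,
      (forall k, 0 <= p k) /\ (series p @ \oo --> (1 : R)),
      0 < p 0%N /\ p 1%N = 0,
      [/\ forall k, 0 <= r k,
          forall k, k != -1 -> k <= 0 -> r k = 0
        & (fun n => r (-1) + series (fun k : nat => r k%:Z) n) @ \oo
            --> (1 : R)]
    & (exists k : nat, (0 < k)%N /\ 0 < mu * r k%:Z) \/ p 0%N < 1].

Definition generator (n m : nat) : R :=
  if n == 0%N then 0
  else if m == n then - (lambda * n%:R + mu)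
  else if (m.+1 < n)%N then 0
  else p (m.+1 - n)%N * lambda * n%:R + r (m%:Z - n%:Z) * mu.

Definition pgf (z : R) : R := limn (pseries p z).

Definition rgf (z : R) : R :=
  r (-1) / z + limn (pseries (fun k : nat => r k%:Z) z).

Definition is_least (A : set R) (z : R) : Prop := A z /\ lbound A z.

Definition branching_root (vphi : R) : Prop :=
  is_least [set z | 0 < z <= 1 /\ pgf z = z] vphi.

Definition migration_root (phi : R) : Prop :=
  if 0 < mu * r (-1) then is_least [set z | 0 < z <= 1 /\ rgf z = 1] phi
  else phi = 0.

(* Oriented integral from a to b, for either order of a and b. *)
Definition oint (f : R -> R) (a b : R) : R :=
  if a <= b then \int[lebesgue_measure]_(w in `]a, b[) f w
  else - \int[lebesgue_measure]_(w in `]b, a[) f w.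

Definition ointegrable (f : R -> R) (a b : R) : Prop :=
  lebesgue_measure.-integrable `]Num.min a b, Num.max a b[ (EFin \o f).

Definition lower_drift (w : R) : R :=
  mu * (1 - rgf w) / (lambda * (pgf w - w)).

Definition upper_drift (w : R) : R :=
  mu * (1 - rgf w) / (lambda * (w - pgf w)).

Definition lower_integrand (phi : R) (y : nat) (z : R) : R :=
  expR (- oint lower_drift phi z) / (lambda * (pgf z - z)) * z ^+ y.

Definition upper_density (v : R) : R :=
  expR (- oint upper_drift v 1) / (lambda * (v - pgf v)).

End Model.

(* Main.v *)
Require Import Defs.
From mathcomp Require Import all_boot all_order all_algebra.
From mathcomp Require Import all_classical all_reals all_analysis.
From mathcomp Require Import measurable_realfun.
From mathcomp Require Import ring lra.

(** Let [q n = lambda * n + mu] be the rate of leaving a state n > 0, J the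
    matrix of the jump chain and K the matrix J with the rows of the states at
    most a erased.  Pathwise, the minimum of the lifetime and of the hitting time
    of [0, a] is the time spent above a before the first visit to [0, a]
    ([min_exit_time]); its mean from x is therefore the Green sum
    G x = sum_k K^k (1/q) x ([mean_exit_time]).

    This sum is computed from explicit solutions of the equations u = w + J u.
    On the powers of v the generator gives
      q (n+1) v^(n+1) - sum_k jump_rate n k v^(n+k) = flux n v,
      flux n v = v^n (lambda (n+1) (v - pgf p v) + mu (v - pgf s v)),
    s being the law r moved to nat.  The density [upper_density] is made so that
    flux n times it is the derivative of v^(n+1) E v, where E is the
    exponential in its numerator.  E vanishes at vphi, because phi < vphi makes
    the drift behave as a positive multiple of 1 / (v - vphi), and E tends to 1 at
    1.  Hence the moments h of the density over ]vphi, 1[ satisfy h = 1/q + J h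
    ([upper_flux], [moment_row]).  In the same way the moments g of
    [lower_integrand] over ]0, vphi[ satisfy g = J g ([lower_flux]).  Downward
    jumps have size one, so cutting h and g off at a yields
      h' = 1/q + h a * b + K h'   and   g' = g a * b + K g',
    with the same b, the probability of jumping to a state at most a.
    Both h and g tend to 0 at infinity, so that K^k h' and K^k g' tend to 0
    ([iter_dominated_cvg0]) and both functions are Green sums
    ([killed_decomposition]):
      h x = G x + h a * B   and   g x = g a * B,   with B = sum_k K^k b x.
    Eliminating B gives G x = h x - h a * g x / g a, which is the formula.

    If mu = 0, the drift disappears and the kernel becomes
      theta n v = (v^n - vphi^n) / (lambda (v - pgf p v)).
    Its integrals over ]0, vphi[ and ]vphi, 1[ solve u = vphi^n / q + K u and
    u = (1 - vphi^n) / q + K u for a = 0, while vphi^n is the probability of ever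
    hitting 0 from n ([branching_hit_prob]).  Thus the integral over ]0, vphi[ is
    the part of G carried by the paths that hit 0 and the other one is the part
    of the paths that explode.

    That explosion is possible is used through [explosion_criterion]: if
    vphi = 1, or if 1 / (v - pgf p v) is not integrable at 1, then the Laplace
    transform of the explosion time vanishes, by a Lyapunov function argument.
    So vphi < 1, and the integrability at 1 holds on which the behaviour of E
    and of theta near 1 rests. *)

Import Order.TTheory GRing.Theory Num.Theory.
Import numFieldNormedType.Exports.
Local Open Scope classical_set_scope.
Local Open Scope ring_scope.
Set Implicit Arguments.
Unset Strict Implicit.
Unset Printing Implicit Defensive.

(** * Probability generating functions *)

Section PGF.
Variables (R : realType) (c : nat -> R).
Hypotheses (c_ge0 : forall k, 0 <= c k) (c_sum : series c @ \oo --> (1 : R)).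

Lemma pgf_cvg (z : R) : 0 <= z <= 1 -> pseries c z @ \oo --> pgf c z.
Proof.
move=> /andP[z0 z1]; apply: (@series_le_cvg _ _ c).
- by move=> n; rewrite mulr_ge0// exprn_ge0.
- exact: c_ge0.
- by move=> n; rewrite ler_piMr// exprn_ile1.
- by apply/cvg_ex; exists 1.
Qed.

Lemma nonneg_series_lim (u : nat -> R) (l : R) : (forall k, 0 <= u k) ->
  series u @ \oo --> l -> (\sum_(k <oo) (u k)%:E = l%:E)%E.
Proof.
move=> u0 ul; apply/cvg_lim => //.
rewrite (_ : (fun n => _) = (fun n => (series u n)%:E)); last first.
  by apply/funext => n; rewrite sumEFin.
exact: cvg_EFin (nearW _ _) ul.
Qed.

Lemma pgf_nneseries (z : R) : 0 <= z <= 1 ->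
  (\sum_(k <oo) (c k * z ^+ k)%:E = (pgf c z)%:E)%E.
Proof.
move=> z01; apply: nonneg_series_lim; last exact: pgf_cvg.
by move=> k; rewrite mulr_ge0// exprn_ge0//; case/andP: z01.
Qed.

Lemma pgf1 : pgf c 1 = 1.
Proof.
apply/cvg_lim => //; rewrite /pseries.
by under eq_fun do rewrite expr1n mulr1.
Qed.

Lemma pgf0 : pgf c 0 = c 0%N.
Proof.
apply/cvg_lim => //; rewrite -(cvg_shiftn 1)/=.
rewrite (_ : (fun n => _) = cst (c 0%N)); first exact: cvg_cst.
apply/funext => n; rewrite /pseries /series/= addn1 big_nat_recl//= expr0 mulr1.
by rewrite big1 ?addr0// => i _; rewrite expr0n mulr0.
Qed.

Lemma pgf_ge0 (z : R) : 0 <= z <= 1 -> 0 <= pgf c z.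
Proof.
move=> z01; rewrite -lee_fin -pgf_nneseries//; apply: nneseries_ge0 => n _ _.
by rewrite lee_fin mulr_ge0// exprn_ge0//; case/andP: z01.
Qed.

Lemma pgf_ge_c0 (z : R) : 0 <= z <= 1 -> c 0%N <= pgf c z.
Proof.
move=> z01; rewrite -lee_fin -pgf_nneseries//.
rewrite (le_trans _ (nneseries_lim_ge 1 _))//.
  by rewrite big_nat1 expr0 mulr1.
by move=> n _ _; rewrite lee_fin mulr_ge0// exprn_ge0//; case/andP: z01.
Qed.

Lemma pgf_le (x y : R) : 0 <= x -> x <= y -> y <= 1 -> pgf c x <= pgf c y.
Proof.
move=> x0 xy y1; have y0 := le_trans x0 xy; have x1 := le_trans xy y1.
rewrite -lee_fin -!pgf_nneseries ?x0 ?y0//.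
apply: lee_nneseries => [n _ _|n _]; rewrite lee_fin.
  by rewrite mulr_ge0// exprn_ge0.
by rewrite ler_wpM2l// lerXn2r.
Qed.

Lemma pgf_le1 (z : R) : 0 <= z <= 1 -> pgf c z <= 1.
Proof. by move=> /andP[z0 z1]; rewrite -pgf1 pgf_le. Qed.

Lemma expr_convex (x y z : R) k : 0 <= x -> x <= y -> y <= z ->
  (z - x) * y ^+ k <= (z - y) * x ^+ k + (y - x) * z ^+ k.
Proof.
move=> x0 xy yz; have y0 := le_trans x0 xy.
elim: k => [|k IH]; first by rewrite !expr0; lra.
have h : x ^+ k <= z ^+ k.
  by apply: lerXn2r; rewrite ?nnegrE//; [exact: le_trans y0 yz|exact: le_trans xy yz].
have h2 : 0 <= (y - x) * (z - y) * (z ^+ k - x ^+ k).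
  by rewrite !mulr_ge0// subr_ge0.
have := ler_wpM2l y0 IH.
rewrite !exprS; nra.
Qed.

(** The chord inequality for y^(k+2) on [x, 1] holds with a gap that does not
    depend on k, so that the gap survives summation against a law. *)
Lemma expr_strict_convex (x y : R) k : 0 <= x -> x <= y -> y <= 1 ->
  (1 - x) * y ^+ k.+2 + (1 - x) * (1 - y) * (y - x) <=
  (1 - y) * x ^+ k.+2 + (y - x).
Proof.
move=> x0 xy y1; have y0 := le_trans x0 xy; have x1 := le_trans xy y1.
elim: k => [|k IH]; first by rewrite !expr2; nra.
have h : x ^+ k.+2 <= x by rewrite exprS ler_piMr// exprn_ile1.
have h2 : 0 <= (y - x) * (1 - y) * (x - x ^+ k.+2).
  by rewrite !mulr_ge0// subr_ge0.
have h3 : 0 <= y * ((1 - x) * (1 - y) * (y - x)).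
  by rewrite !mulr_ge0// subr_ge0.
have := ler_wpM2l y0 IH.
rewrite (exprS x k.+2) (exprS y k.+2); nra.
Qed.

Lemma pgf_convex (x y z : R) : 0 <= x -> x <= y -> y <= z -> z <= 1 ->
  (z - x) * pgf c y <= (z - y) * pgf c x + (y - x) * pgf c z.
Proof.
move=> x0 xy yz z1; have y0 := le_trans x0 xy; have z0 := le_trans y0 yz.
have y1 := le_trans yz z1; have x1 := le_trans xy y1.
have cx : pseries c x @ \oo --> pgf c x by apply: pgf_cvg; rewrite x0.
have cy : pseries c y @ \oo --> pgf c y by apply: pgf_cvg; rewrite y0.
have cz : pseries c z @ \oo --> pgf c z by apply: pgf_cvg; rewrite z0.
apply: (@ler_cvg_to _ \oo _ _ (fun n => (z - x) * pseries c y n)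
  (fun n => (z - y) * pseries c x n + (y - x) * pseries c z n)).
- exact: cvgMl_tmp cy.
- by apply: cvgD; [exact: cvgMl_tmp cx|exact: cvgMl_tmp cz].
apply: nearW => n; rewrite /pseries /series /= !mulr_sumr -big_split/=.
apply: ler_sum => k _; have := ler_wpM2l (c_ge0 k) (expr_convex k x0 xy yz).
by lra.
Qed.

(** The terms of degree at least 2 all contribute the same gap, and they have
    total mass [1 - c 0] because [c 1 = 0]; the constant term is affine. *)
Lemma pgf_strict_convex (x y : R) : c 1%N = 0 -> 0 <= x -> x <= y -> y <= 1 ->
  (1 - x) * pgf c y + (1 - c 0%N) * ((1 - x) * (1 - y) * (y - x)) <=
  (1 - y) * pgf c x + (y - x).
Proof.
move=> c1 x0 xy y1; have y0 := le_trans x0 xy; have x1 := le_trans xy y1.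
have cx : pseries c x @ \oo --> pgf c x by apply: pgf_cvg; rewrite x0.
have cy : pseries c y @ \oo --> pgf c y by apply: pgf_cvg; rewrite y0.
rewrite -[y - x in leRHS]mulr1.
apply: (@ler_cvg_to _ \oo _ _ (fun n => (1 - x) * pseries c y n +
    (series c n - c 0%N) * ((1 - x) * (1 - y) * (y - x)))
  (fun n => (1 - y) * pseries c x n + (y - x) * series c n)).
- apply: cvgD; first exact: cvgMl_tmp cy.
  by apply: cvgMr_tmp; apply: cvgB => //; exact: cvg_cst.
- by apply: cvgD; [exact: cvgMl_tmp cx|exact: cvgMl_tmp c_sum].
near=> n; have n2 : (2 <= n)%N by near: n; exact: nbhs_infty_ge.
(* separate the terms of degree 0 and 1, which have no strict gap *)
rewrite -(subnKC n2); set m := (n - 2)%N.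
rewrite /pseries /series /= add2n !big_nat_recl//= c1.
rewrite !expr0 !mul0r !mulr1 !add0r.
set a := \sum_(0 <= i < m) _; set b := \sum_(0 <= i < m) _.
set e := \sum_(0 <= i < m) _.
suff : (1 - x) * a + b * ((1 - x) * (1 - y) * (y - x))
   <= (1 - y) * e + (y - x) * b by lra.
rewrite /a /b /e !mulr_sumr mulr_suml -!big_split/=; apply: ler_sum => k _.
have := ler_wpM2l (c_ge0 k.+2) (expr_strict_convex k x0 xy y1); lra.
Unshelve. all: by end_near. Qed.

End PGF.

(** * Fixed points of a generating function *)

Section PgfRoot.
Variables (R : realType) (c : nat -> R).
Hypotheses (c_ge0 : forall k, 0 <= c k) (c_sum : series c @ \oo --> (1 : R)).

(** By convexity the slope on [x, y] is at most the slope of the chord from y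
    to 1. *)
Lemma pgf_lipschitz (x y b : R) : 0 <= x -> x <= y -> y <= b -> b < 1 ->
  `|pgf c y - pgf c x| <= `|y - x| / (1 - b).
Proof.
move=> x0 xy yb b1; have y1 : y <= 1 by lra.
have := pgf_convex c_ge0 c_sum x0 xy y1 (lexx 1); rewrite (pgf1 c_sum) mulr1.
have := pgf_le c_ge0 c_sum x0 xy y1 => xyle.
have y01 : 0 <= y <= 1 by rewrite y1 andbT (le_trans x0).
have := pgf_ge0 c_ge0 c_sum y01; have := pgf_le1 c_ge0 c_sum y01 => h1 h0 h.
rewrite !ger0_norm ?subr_ge0// ler_pdivlMr ?subr_gt0//.
have : (pgf c y - pgf c x) * (1 - b) <= (pgf c y - pgf c x) * (1 - y).
  by rewrite ler_wpM2l ?subr_ge0//; lra.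
move/le_trans; apply; have := mulr_ge0 (_ : 0 <= y - x) h0; rewrite subr_ge0 => /(_ xy); nra.
Qed.

Lemma pgf_continuous (z : R) : 0 < z < 1 -> {for z, continuous (pgf c)}.
Proof.
move=> /andP[z0 z1]; apply/cvgrPdist_le => /= e e0.
pose b := (1 + z) / 2; have zb : z < b by rewrite /b; lra.
have b1 : b < 1 by rewrite /b; lra.
near=> t.
have t0 : 0 < t by near: t; exact: lt_nbhsr.
have tb : t < b by near: t; exact: lt_nbhsl.
apply: (@le_trans _ _ (`|z - t| / (1 - b))).
  by case: (leP t z) => tz; [|rewrite distrC (distrC z)]; apply: pgf_lipschitz => //; exact: ltW.
rewrite ler_pdivrMr ?subr_gt0//.
near: t; apply: cvgr_dist_le; first exact: cvg_id.
by rewrite mulr_gt0// subr_gt0.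
Unshelve. all: by end_near. Qed.

(** If [pgf c z < z], the intermediate value theorem gives a root strictly
    between 0 and z, since [pgf c] exceeds the identity near 0. *)
Lemma pgf_ge_of_least_root1 (z : R) : 0 < c 0%N ->
  is_least [set z | 0 < z <= 1 /\ pgf c z = z] 1 -> 0 < z < 1 -> z <= pgf c z.
Proof.
move=> c0 [_ lb] /andP[z0 z1]; rewrite leNgt; apply/negP => Gz.
(* e is positive and so small that pgf c e >= c 0 > e *)
pose e := Num.min (c 0%N) z / 2.
have e0 : 0 < e by rewrite divr_gt0// lt_min c0.
have ec : e < c 0%N.
  have : Num.min (c 0%N) z <= c 0%N by rewrite ge_min lexx.
  by rewrite /e; lra.
have ez : e < z.
  have : Num.min (c 0%N) z <= z by rewrite ge_min lexx orbT.
  by rewrite /e; lra.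
have e1 : 0 <= e <= 1 by apply/andP; split; lra.
have Ge : e < pgf c e by rewrite (lt_le_trans ec)// pgf_ge_c0.
have [||t] := @IVT _ (fun x => pgf c x - x) e z 0 (ltW ez).
- apply: continuous_in_subspaceT => x /[!inE]/= /[!in_itv]/= /andP[ex xz].
  apply: cvgB; last exact: cvg_id.
  by apply: pgf_continuous; apply/andP; split; lra.
- by rewrite ge_min le_max; apply/andP; split; apply/orP; [right|left]; lra.
rewrite in_itv/= => /andP[et tz] /eqP; rewrite subr_eq0 => /eqP root_t.
have t01 : 0 < t <= 1 by apply/andP; split; lra.
by have := lb t (conj t01 root_t); lra.
Qed.

Hypothesis c1 : c 1%N = 0.
Variable x0 : R.
Hypotheses (x0_01 : 0 <= x0 < 1) (Gx0 : pgf c x0 = x0).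

Lemma c0_lt1 : c 0%N < 1.
Proof.
have /andP[h0 h1] := x0_01.
by rewrite (le_lt_trans _ h1)// -[leRHS]Gx0 pgf_ge_c0// h0 ltW.
Qed.

(** The chord from x0 to the other fixed point 1 lies on the diagonal. *)
Lemma pgf_lt_above (y : R) : x0 < y < 1 -> pgf c y < y.
Proof.
move=> /andP[xy y1]; have /andP[h0 h1] := x0_01.
have := pgf_strict_convex c_ge0 c_sum c1 h0 (ltW xy) (ltW y1).
rewrite Gx0 => h.
have : 0 < (1 - c 0%N) * ((1 - x0) * (1 - y) * (y - x0)).
  by rewrite !mulr_gt0// ?subr_gt0// c0_lt1.
by move=> h2; rewrite -(@ltr_pM2l _ (1 - x0)) ?subr_gt0//; lra.
Qed.

Lemma pgf_gt_below (z : R) : 0 <= z < x0 -> z < pgf c z.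
Proof.
move=> /andP[z0 zx]; have /andP[h0 h1] := x0_01.
have := pgf_strict_convex c_ge0 c_sum c1 z0 (ltW zx) (ltW h1).
rewrite Gx0 => h.
have : 0 < (1 - c 0%N) * ((1 - z) * (1 - x0) * (x0 - z)).
  by rewrite !mulr_gt0// ?subr_gt0// ?c0_lt1//; lra.
by move=> h2; rewrite -(@ltr_pM2l _ (1 - x0)) ?subr_gt0//; lra.
Qed.

(** Together with the chord bounds below, this says that x0 is a simple zero of
    [v - pgf c v]: near x0 the inverse is comparable to [1 / (v - x0)], hence
    not integrable. *)
Lemma pgf_le_above (v : R) : x0 <= v <= 1 -> v - pgf c v <= v - x0.
Proof.
by move=> /andP[xv v1]; have /andP[h0 _] := x0_01; rewrite lerB// -[leLHS]Gx0 pgf_le.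
Qed.

Lemma pgf_le_below (z : R) : 0 <= z <= x0 -> pgf c z - z <= x0 - z.
Proof.
move=> /andP[z0 zx]; have /andP[h0 h1] := x0_01.
by rewrite lerB// -[leRHS]Gx0 pgf_le// ltW.
Qed.

(** The point b is arbitrary: its value is only used to give a positive slope
    that is uniform in v. *)
Lemma pgf_chord_above (b v : R) : x0 < b -> b < 1 -> x0 <= v <= b ->
  (b - pgf c b) / (b - x0) * (v - x0) <= v - pgf c v.
Proof.
move=> xb b1 /andP[xv vb]; have /andP[h0 h1] := x0_01.
have := pgf_convex c_ge0 c_sum h0 xv vb (ltW b1); rewrite Gx0 => h.
by rewrite mulrAC ler_pdivrMr ?subr_gt0//; lra.
Qed.

Lemma pgf_chord_below (b z : R) : x0 < b -> b < 1 -> 0 <= z <= x0 ->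
  (b - pgf c b) / (b - x0) * (x0 - z) <= pgf c z - z.
Proof.
move=> xb b1 /andP[z0 zx]; have /andP[h0 h1] := x0_01.
have := pgf_convex c_ge0 c_sum z0 zx (ltW xb) (ltW b1); rewrite Gx0 => h.
by rewrite mulrAC ler_pdivrMr ?subr_gt0//; lra.
Qed.

Lemma pgf_chord_one (b v : R) : x0 < b -> b < 1 -> b <= v <= 1 ->
  (b - pgf c b) / (1 - b) * (1 - v) <= v - pgf c v.
Proof.
move=> xb b1 /andP[bv v1]; have /andP[h0 h1] := x0_01.
have b0 : 0 <= b by lra.
have := pgf_convex c_ge0 c_sum b0 bv v1 (lexx _); rewrite (pgf1 c_sum) => h.
by rewrite mulrAC ler_pdivrMr ?subr_gt0//; lra.
Qed.

End PgfRoot.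

(** * Integrals over open intervals *)

Section OpenFTC.
Context {R : realType}.
Notation mu := (@lebesgue_measure R).
Implicit Types (f F : R -> R) (a b : R).

Lemma continuous_oo_measurable f a b :
  (forall x, a < x < b -> {for x, continuous f}) -> measurable_fun `]a, b[ f.
Proof.
move=> cf; apply: open_continuous_measurable_fun; first exact: interval_open.
by move=> x /[!inE]/= /[!in_itv]/=; exact: cf.
Qed.

Lemma continuous_oo_bounded_integrable f a b (M : R) :
  (forall x, a < x < b -> {for x, continuous f}) ->
  (forall x, a < x < b -> `|f x| <= M) ->
  mu.-integrable `]a, b[ (EFin \o f).
Proof.
move=> cf fM; apply: measurable_bounded_integrable => //.
- by rewrite /= lebesgue_measure_itv/=; case: ifP => // _; rewrite -EFinB ltry.
- exact: continuous_oo_measurable.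
- exists M; split; first exact: num_real.
  by move=> x Mx y /= /[!in_itv]/= /fM /le_trans; apply; exact: ltW.
Qed.

Lemma continuous_cc_integrable f a b :
  (forall x, a <= x <= b -> {for x, continuous f}) ->
  mu.-integrable `[a, b] (EFin \o f).
Proof.
move=> cf; apply: continuous_compact_integrable; first exact: segment_compact.
by apply: continuous_in_subspaceT => x /[!inE]/= /[!in_itv]/=; exact: cf.
Qed.

Lemma FTC_cc f F a b : a <= b ->
  (forall x, a <= x <= b -> is_derive x 1 F (f x)) ->
  (forall x, a <= x <= b -> {for x, continuous f}) ->
  (\int[mu]_(x in `[a, b]) (f x)%:E = (F b - F a)%:E)%E.
Proof.
rewrite le_eqVlt => /predU1P[<- _ _|ab dF cf].
  by rewrite set_itv1 integral_set1 subrr.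
have cF x : a <= x <= b -> {for x, continuous F}.
  by move=> /dF dFx; apply: differentiable_continuous; exact/derivable1_diffP.
rewrite (@continuous_FTC2 _ f F)//.
- by apply: continuous_in_subspaceT => x /[!inE]/= /[!in_itv]/=; exact: cf.
- split.
  + by move=> x /[!in_itv]/= /andP[ax xb]; have [] := dF x; rewrite ?(ltW ax) ?(ltW xb).
  + by apply: cvg_at_right_filter; apply: cF; rewrite lexx ltW.
  + by apply: cvg_at_left_filter; apply: cF; rewrite lexx ltW.
- move=> x /[!in_itv]/= /andP[ax xb]; rewrite derive1E.
  by have dFx := dF x; apply: derive_val; apply: dFx; rewrite (ltW ax) (ltW xb).
Qed.

(** Segments are used because the functions integrated below may be singular at
    both ends of the open interval. *)
Definition exhaust a b (n : nat) : set R :=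
  `[a + (b - a) / n.+2%:R, b - (b - a) / n.+2%:R]%classic.

Lemma exhaust_sub a b n x : a < b -> exhaust a b n x -> a < x < b.
Proof.
move=> ab; rewrite /exhaust/= in_itv/= => /andP[h1 h2].
have : 0 < (b - a) / n.+2%:R by rewrite divr_gt0// subr_gt0.
by move: h1 h2; set g := (b - a) / _ => *; apply/andP; split; lra.
Qed.

Lemma exhaust_nondecreasing a b : a < b -> nondecreasing_seq (exhaust a b).
Proof.
move=> ab m n mn; rewrite subsetEset => x; rewrite /exhaust/= !in_itv/=.
have : (b - a) / n.+2%:R <= (b - a) / m.+2%:R.
  by apply: ler_wpM2l; [rewrite subr_ge0 ltW|rewrite lef_pV2 ?posrE// ler_nat].
set g := (b - a) / n.+2%:R; set g' := (b - a) / m.+2%:R.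
by move=> h /andP[h1 h2]; apply/andP; split; lra.
Qed.

Lemma cvg_gap a b : (b - a) / n.+2%:R @[n --> \oo] --> 0.
Proof.
rewrite -[X in _ --> X](mulr0 (b - a)); apply: cvgMl_tmp.
have := @cvg_harmonic R; rewrite -(cvg_shiftn 1)/=; apply: cvg_trans.
by apply: near_eq_cvg; apply: nearW => n; rewrite /harmonic addn1.
Qed.

Lemma bigcup_exhaust a b : a < b -> \bigcup_n exhaust a b n = `]a, b[%classic.
Proof.
move=> ab; apply/seteqP; split=> [x [n _] /(exhaust_sub ab)|x].
  by rewrite /= in_itv.
rewrite /= in_itv/= => /andP[ax xb].
have m0 : 0 < Num.min (x - a) (b - x) by rewrite lt_min !subr_gt0 ax.
have /cvgrPdist_lt/(_ _ m0)[n _ /(_ n (leqnn n))] := cvg_gap a b.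
rewrite sub0r normrN gtr0_norm ?divr_gt0 ?subr_gt0// lt_min => /andP[h1 h2].
exists n => //; rewrite /exhaust/= in_itv/=; move: h1 h2.
by set g := (b - a) / _ => *; apply/andP; split; lra.
Qed.

Section Limits.
Variables (f F : R -> R) (a b A B : R).
Hypotheses (ab : a < b)
  (dF : forall x, a < x < b -> is_derive x 1 F (f x))
  (cf : forall x, a < x < b -> {for x, continuous f})
  (FA : F x @[x --> a^'+] --> A) (FB : F x @[x --> b^'-] --> B).

Lemma cvg_integral_exhaust :
  (\int[mu]_(x in exhaust a b n) (f x)%:E @[n --> \oo] --> (B - A)%:E)%E.
Proof.
have e0 n : 0 < (b - a) / n.+2%:R by rewrite divr_gt0// subr_gt0.
have -> : (fun n => \int[mu]_(x in exhaust a b n) (f x)%:E)%E =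
    fun n => (F (b - (b - a) / n.+2%:R) - F (a + (b - a) / n.+2%:R))%:E.
  apply/funext => n; apply: FTC_cc => [|x xab|x xab].
  - have : (b - a) / n.+2%:R <= (b - a) / 2.
      by apply: ler_wpM2l; [rewrite subr_ge0 ltW|rewrite lef_pV2 ?posrE// ler_nat].
    by set g := (b - a) / n.+2%:R => *; lra.
  - by apply: dF; apply: (@exhaust_sub a b n).
  - by apply: cf; apply: (@exhaust_sub a b n).
apply: cvg_EFin; first exact: nearW.
apply: cvgB.
- move/cvg_at_leftP : FB; apply; split.
    by move=> n; have := e0 n; set g := (b - a) / _ => *; lra.
  rewrite -[X in _ --> X](subr0 b); apply: cvgB; [exact: cvg_cst|exact: cvg_gap].
- move/cvg_at_rightP : FA; apply; split.
    by move=> n; have := e0 n; set g := (b - a) / _ => *; lra.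
  rewrite -[X in _ --> X](addr0 a); apply: cvgD; [exact: cvg_cst|exact: cvg_gap].
Qed.

Lemma FTC_oo_ge0 : (forall x, a < x < b -> 0 <= f x) ->
  (\int[mu]_(x in `]a, b[) (f x)%:E = (B - A)%:E)%E.
Proof.
move=> f0; apply: (cvg_unique _ _ cvg_integral_exhaust) => //.
rewrite -(bigcup_exhaust ab); apply: ge0_nondecreasing_set_cvg_integral.
- exact: exhaust_nondecreasing.
- by move=> n; exact: measurable_itv.
- move=> n; apply/measurable_EFinP.
  apply: (@measurable_funS _ _ _ _ `]a, b[%classic) => //.
    by move=> x /(exhaust_sub ab); rewrite /= in_itv.
  exact: continuous_oo_measurable.
- by move=> n x /(exhaust_sub ab) xab; rewrite lee_fin f0.
Qed.

Lemma FTC_oo_integrable : mu.-integrable `]a, b[ (EFin \o f) ->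
  (\int[mu]_(x in `]a, b[) (f x)%:E = (B - A)%:E)%E.
Proof.
move=> intf; apply: (cvg_unique _ _ cvg_integral_exhaust) => //.
set D := `]a, b[%classic; have mD : measurable D by exact: measurable_itv.
have mf : measurable_fun D (EFin \o f).
  by apply/measurable_EFinP; exact: continuous_oo_measurable.
pose f_ n := (EFin \o f) \_ (exhaust a b n).
have subD n : exhaust a b n `<=` D.
  by move=> x /(exhaust_sub ab); rewrite /D/= in_itv.
have [] := @dominated_convergence _ _ _ mu D mD f_ (EFin \o f) (abse \o EFin \o f).
- move=> n; apply/(measurable_restrict _ _ _) => //; first exact: measurable_itv.
  by apply: measurable_funS mf => // x [].
- exact: mf.
- apply: aeW => x Dx; apply: (@cvg_near_cst _ _ _ _ \oo).
  have [n _ nx] : (\bigcup_n exhaust a b n) x by rewrite bigcup_exhaust.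
  exists n => // m /= nm; apply: patchT; rewrite inE.
  by have := exhaust_nondecreasing ab nm; rewrite subsetEset; exact.
- exact: integrable_abse.
- apply: aeW => x n Dx; rewrite /f_ patchE; case: ifPn => // _.
  by rewrite abse0 abse_ge0.
move=> _ _; apply: cvg_trans; apply: near_eq_cvg; apply: nearW => n /=.
by rewrite /f_ -integral_mkcondr setIidr//; exact: subD.
Qed.

End Limits.

Lemma FTC_oo_ge0_integrable f F a b (A B : R) : a < b ->
  (forall x, a < x < b -> is_derive x 1 F (f x)) ->
  (forall x, a < x < b -> {for x, continuous f}) ->
  F x @[x --> a^'+] --> A -> F x @[x --> b^'-] --> B ->
  (forall x, a < x < b -> 0 <= f x) ->
  mu.-integrable `]a, b[ (EFin \o f).
Proof.
move=> ab dF cf FA FB f0; apply/integrableP; split.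
  by apply/measurable_EFinP; exact: continuous_oo_measurable.
under eq_integral => x /[!inE]/= /[!in_itv]/= /f0 fx do rewrite ger0_norm//.
by rewrite (FTC_oo_ge0 ab dF cf FA FB f0) ltry.
Qed.

Lemma oint_split f (c al x : R) : al < x ->
  ointegrable f c al -> ointegrable f c x -> mu.-integrable `]al, x[ (EFin \o f) ->
  oint f c x = oint f c al + \int[mu]_(t in `]al, x[) f t.
Proof.
rewrite /ointegrable /oint => alx ia ix iax.
have [cal|alc] := leP c al.
  have cx : c <= x by rewrite (le_trans cal)// ltW.
  rewrite cx; move: ix; rewrite (min_idPl cx) (max_idPr cx) => ix.
  rewrite -(@Rintegral_itvB _ _ (BRight c) (BLeft x) al ix) ?bnd_simp//.
  rewrite (@Rintegral_itv_bndo_bndc _ _ al)//; first by rewrite addrC subrK.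
  by move: ia; rewrite (min_idPl cal) (max_idPr cal).
move: ia; rewrite (min_idPr (ltW alc)) (max_idPl (ltW alc)) => ia.
have [cx|xc|cx] := ltgtP c x.
- rewrite -(@Rintegral_itvB _ _ (BRight al) (BLeft x) c iax) ?bnd_simp ?(ltW alc)//.
  by rewrite (@Rintegral_itv_bndo_bndc _ _ c)// addrC.
- rewrite -(@Rintegral_itvB _ _ (BRight al) (BLeft c) x ia) ?bnd_simp ?(ltW alx)//.
  by rewrite (@Rintegral_itv_bndo_bndc _ _ x)// opprB addrC.
- by rewrite -cx set_itvoo0 Rintegral_set0 addNr.
Qed.

(** The base point c may be an end of the interval, where f may be singular:
    only the part of the integral close to z varies with z. *)
Lemma oint_is_derive f (l u c z : R) : l < z < u ->
  (forall x, l < x < u -> {for x, continuous f}) ->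
  (forall x, l < x < u -> ointegrable f c x) ->
  is_derive z 1 (fun x => oint f c x) (f z).
Proof.
move=> /andP[lz zu] cf cint.
pose al := (l + z) / 2; pose be := (z + u) / 2.
have [lal alz] : l < al /\ al < z by rewrite /al; split; lra.
have [zbe beu] : z < be /\ be < u by rewrite /be; split; lra.
have ii : mu.-integrable `[al, be] (EFin \o f).
  by apply: continuous_cc_integrable => x /andP[? ?]; apply: cf; apply/andP; split; lra.
have cfz : {for z, continuous f} by apply: cf; rewrite lz.
have [dF dFE] := @continuous_FTC1_closed _ f al z be zbe ii alz cfz.
pose F x := oint f c al + \int[mu]_(t in `[al, x]) f t.
have dF' : is_derive z 1 F (f z).
  rewrite -[f z]add0r; apply: is_deriveD.
  by apply: DeriveDef => //; rewrite -derive1E.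
apply: near_eq_is_derive dF'.
near=> x.
have alx : al < x by near: x; exact: lt_nbhsr.
have xbe : x < be by near: x; exact: lt_nbhsl.
have iax : mu.-integrable `]al, x[ (EFin \o f).
  apply: integrableS ii => // t /=; rewrite !in_itv/= => /andP[? ?].
  by apply/andP; split; lra.
rewrite (@oint_split f c al x)//; last 2 first.
- by apply: cint; apply/andP; split; lra.
- by apply: cint; apply/andP; split; lra.
by rewrite /F; congr (_ + _); rewrite /Rintegral integral_itv_bndoo//; exact: measurable_int iax.
Unshelve. all: by end_near. Qed.

End OpenFTC.

(** * Exponentials of integrals with a pole *)

Section Vanish.
Context {R : realType}.
Implicit Types (f F : R -> R) (a b : R).

Lemma is_derive_continuous F (x d : R) : is_derive x 1 F d -> {for x, continuous F}.
Proof. by move=> dF; apply: differentiable_continuous; exact/derivable1_diffP. Qed.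

Lemma is_derive_ge0_le F f (x y : R) : x <= y ->
  (forall t, x <= t <= y -> is_derive t 1 F (f t)) ->
  (forall t, x <= t <= y -> 0 <= f t) -> F x <= F y.
Proof.
rewrite le_eqVlt => /predU1P[-> //|xy dF f0].
have [| |c] := @MVT_segment R F f x y (ltW xy).
- by move=> t /[!in_itv]/= /andP[xt ty]; apply: dF; rewrite (ltW xt) ltW.
- apply: continuous_in_subspaceT => t /[!inE]/= /[!in_itv]/= /dF.
  exact: is_derive_continuous.
rewrite in_itv/= => cxy E; rewrite -subr_ge0 E mulr_ge0 ?f0//.
by rewrite subr_ge0 ltW.
Qed.

(** By the hypothesis [F x + k * ln (b - x)] is nondecreasing, so that
    [expR (- F x)] is at most a multiple of the power [(b - x) ^ k]. *)
Lemma expRN_vanish_left F f a b (k : R) : a < b -> 0 < k ->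
  (forall x, a < x < b -> is_derive x 1 F (f x)) ->
  (forall x, a < x < b -> k / (b - x) <= f x) ->
  expR (- F x) @[x --> b^'-] --> 0.
Proof.
move=> ab k0 dF fk.
pose m := (a + b) / 2; have [am mb] : a < m /\ m < b by rewrite /m; split; lra.
(* G is nondecreasing near b, hence bounded below there *)
pose G x := F x + k * ln (b - x).
have Gm x : m <= x -> x < b -> G m <= G x.
  move=> mx xb.
  apply: (@is_derive_ge0_le G (fun t => f t + k * (- (b - t)^-1))) => // t /andP[mt tx].
    apply: is_deriveD; first by apply: dF; apply/andP; split; lra.
    have bt : 0 < b - t by lra.
    have d1 := is_derive1_ln bt.
    have d2 : is_derive t 1 (@ln R \o (fun t => b - t)) ((b - t)^-1 * (0 - 1)).
      by apply: is_derive1_comp.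
    rewrite sub0r mulrN1 in d2.
    exact: (is_deriveZ k d2).
  by rewrite mulrN subr_ge0; apply: fk; apply/andP; split; lra.
apply/cvgrPdist_le => /= e e0.
pose C := expR (- G m); have C0 : 0 < C by exact: expR_gt0.
near=> x.
have xb : x < b by near: x; exact: nbhs_left_lt.
have mx : m <= x by near: x; exact: nbhs_left_ge.
rewrite sub0r normrN gtr0_norm ?expR_gt0//.
have -> : - F x = - G x + k * ln (b - x) by rewrite /G; lra.
have xe : b - x < expR ((ln e + G m) / k).
  rewrite ltrBlDr -ltrBlDl; near: x; apply: nbhs_left_gt.
  by rewrite ltrBlDr ltrDl expR_gt0.
have bx : 0 < b - x by lra.
rewrite -[leRHS]lnK ?posrE// ler_expR.
have : k * ln (b - x) <= ln e + G m.
  rewrite mulrC -ler_pdivlMr// -ler_expR lnK ?posrE//; exact: ltW.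
by have := Gm _ mx xb; lra.
Unshelve. all: by end_near. Qed.

Lemma expRN_vanish_right F f a b (k : R) : a < b -> 0 < k ->
  (forall x, a < x < b -> is_derive x 1 F (f x)) ->
  (forall x, a < x < b -> f x <= - (k / (x - a))) ->
  expR (- F x) @[x --> a^'+] --> 0.
Proof.
move=> ab k0 dF fk; apply/cvg_at_rightNP.
apply: (@expRN_vanish_left (F \o -%R) (fun x => f (- x) * -1) (- b) (- a) k) => //.
- by rewrite ltrN2.
- move=> x /andP[bx xa].
  have dFx : is_derive (- x) 1 F (f (- x)) by apply: dF; apply/andP; split; lra.
  exact: (@is_derive1_comp _ F -%R x _ _ dFx (is_deriveNid x 1)).
- move=> x /andP[bx xa].
  have xab : a < - x < b by apply/andP; split; lra.
  by have := fk (- x) xab; rewrite (_ : - a - x = - x - a); [lra|ring].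
Qed.

Lemma oint_sym f a b : a != b -> oint f a b = - oint f b a.
Proof.
by rewrite /oint; case: ltgtP => // ab _; rewrite opprK.
Qed.

Lemma ointegrable_sym f a b : ointegrable f a b -> ointegrable f b a.
Proof. by rewrite /ointegrable minC maxC. Qed.

Lemma oint_is_derive_left f (l u c z : R) : l < z < u -> u <= c ->
  (forall x, l < x < u -> {for x, continuous f}) ->
  (forall x, l < x < u -> ointegrable f x c) ->
  is_derive z 1 (fun x => oint f x c) (- f z).
Proof.
move=> lzu uc cf cint.
have := oint_is_derive lzu cf (fun x h => ointegrable_sym (cint x h)).
move/is_deriveN; apply: near_eq_is_derive.
have /andP[_ zu] := lzu.
near=> x; have xu : x < u by near: x; exact: lt_nbhsl.
by rewrite [RHS]oint_sym// lt_eqF// (lt_le_trans xu).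
Unshelve. all: by end_near. Qed.

Lemma oint_cvg0_left f (b c : R) : b < c ->
  (@lebesgue_measure R).-integrable `]b, c[ (EFin \o f) ->
  oint f x c @[x --> c^'-] --> 0.
Proof.
move=> bc ibc.
have mf : measurable_fun `]b, c[ (EFin \o f) by exact: measurable_int ibc.
have icc : (@lebesgue_measure R).-integrable `[b, c] (EFin \o f).
  move/integrableP : ibc => [_ ioo]; apply/integrableP; split.
    exact/emeasurable_fun_itv_obnd_cbndP/emeasurable_fun_itv_bndo_bndcP.
  by rewrite integral_itv_bndoo//; exact: measurableT_comp.
have := parameterized_integral_cvg_at_left bc icc => cv.
have -> : 0 = parameterized_integral lebesgue_measure b c f -
  parameterized_integral lebesgue_measure b c f by rewrite subrr.
have cB : (parameterized_integral lebesgue_measure b c f -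
    parameterized_integral lebesgue_measure b x f) @[x --> c^'-] -->
  parameterized_integral lebesgue_measure b c f - parameterized_integral lebesgue_measure b c f.
  by apply: cvgB => //; exact: cvg_cst.
apply: cvg_trans cB; apply: near_eq_cvg; near=> x.
have xc : x < c by near: x; exact: nbhs_left_lt.
have bx : b < x by near: x; exact: nbhs_left_gt.
rewrite /oint (ltW xc) /parameterized_integral.
rewrite (@Rintegral_itvB _ _ (BLeft b) (BRight c)) ?bnd_simp ?(ltW bx) ?(ltW xc)//.
rewrite -Rintegral_itv_bndo_bndc//; apply: integrableS ibc => //.
by apply: subset_itvr; rewrite bnd_simp ltW.
Unshelve. all: by end_near. Qed.

End Vanish.

(** * The two generating functions of the model *)

Section ModelFacts.
Context {R : realType}.
Variables (lambda mu : R) (p : nat -> R) (r : int -> R).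
Hypothesis hpar : parameters lambda mu p r.

(** The law r moved to nat, so that [pgf] applies to it:
    [pgf shift_law z = z * rgf r z]. *)
Definition shift_law (k : nat) : R := r (k%:Z - 1).
Notation s := shift_law.

Lemma lambda_gt0 : 0 < lambda. Proof. by have [[? ?] _ _ _ _] := hpar. Qed.
Lemma mu_ge0 : 0 <= mu. Proof. by have [[? ?] _ _ _ _] := hpar. Qed.
Lemma p_ge0 k : 0 <= p k. Proof. by have [_ [? ?] _ _ _] := hpar. Qed.
Lemma p_sum : series p @ \oo --> (1 : R). Proof. by have [_ [? ?] _ _ _] := hpar. Qed.
Lemma p0_gt0 : 0 < p 0%N. Proof. by have [_ _ [? ?] _ _] := hpar. Qed.
Lemma p1_eq0 : p 1%N = 0. Proof. by have [_ _ [? ?] _ _] := hpar. Qed.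
Lemma s_ge0 k : 0 <= s k. Proof. by have [_ _ _ [h _ _] _] := hpar; exact: h. Qed.
Lemma s1_eq0 : s 1%N = 0. Proof. by have [_ _ _ [_ h _] _] := hpar; apply: h. Qed.

Lemma pseries_s (z : R) n :
  pseries s z n.+1 = r (-1) + z * pseries (fun k : nat => r k%:Z) z n.
Proof.
rewrite /pseries /series/= big_nat_recl//= expr0 mulr1 mulr_sumr; congr (_ + _).
apply: eq_bigr => i _; rewrite /shift_law exprS mulrCA; congr (_ * _).
by rewrite -addn1 PoszD addrK.
Qed.

Lemma s_sum : series s @ \oo --> (1 : R).
Proof.
have [_ _ _ [_ _ h] _] := hpar; rewrite -(cvg_shiftn 1)/=.
apply: cvg_trans h; apply: near_eq_cvg; apply: nearW => n /=.
have := pseries_s 1 n; rewrite mul1r /pseries.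
have e1 (c : nat -> R) : (fun i => c i * 1 ^+ i) = c.
  by apply/funext => i; rewrite expr1n mulr1.
by rewrite !e1 addn1 => ->.
Qed.

Lemma rgf_pgf (z : R) : 0 < z <= 1 -> rgf r z = pgf s z / z.
Proof.
move=> /andP[z0 z1]; have h := pgf_cvg s_ge0 s_sum (z := z).
have {h} h : pseries s z @ \oo --> pgf s z by apply: h; rewrite ltW.
move: h; rewrite -(cvg_shiftn 1)/= => h.
have zn0 : z != 0 by rewrite gt_eqF.
rewrite /rgf (_ : limn _ = (pgf s z - r (-1)) / z); first by field.
apply/cvg_lim => //.
have : ((pseries s z (n + 1)%N - r (-1)) / z) @[n --> \oo] --> (pgf s z - r (-1)) / z.
  by apply: cvgMr_tmp; apply: cvgB => //; exact: cvg_cst.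
apply: cvg_trans; apply: near_eq_cvg; apply: nearW => n /=.
by rewrite addn1 pseries_s; field.
Qed.

Lemma rgf_continuous (z : R) : 0 < z < 1 -> {for z, continuous (rgf r)}.
Proof.
move=> /andP[z0 z1].
have h : {for z, continuous (fun w => pgf s w / w)}.
  apply: cvgM; first by apply: (pgf_continuous s_ge0 s_sum); rewrite z0.
  by apply: cvgV; [rewrite gt_eqF|exact: cvg_id].
rewrite /prop_for /continuous_at (rgf_pgf (z := z)) ?z0 ?ltW//.
apply: cvg_trans h; apply: near_eq_cvg; near=> w.
rewrite rgf_pgf//; apply/andP; split.
- by near: w; exact: lt_nbhsr.
- by apply: ltW; near: w; exact: lt_nbhsl.
Unshelve. all: by end_near. Qed.

Lemma rgf_ge0 (z : R) : 0 < z <= 1 -> 0 <= rgf r z.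
Proof.
move=> z01; have /andP[z0 z1] := z01; rewrite rgf_pgf// divr_ge0//; last exact: ltW.
by apply: (pgf_ge0 s_ge0 s_sum); rewrite ltW.
Qed.

Lemma rgf_le_inv (z : R) : 0 < z <= 1 -> rgf r z <= z^-1.
Proof.
move=> z01; have /andP[z0 z1] := z01; rewrite rgf_pgf// -[leRHS]mul1r ler_wpM2r//.
  by rewrite invr_ge0 ltW.
by apply: (pgf_le1 s_ge0 s_sum); rewrite ltW.
Qed.

(** When [r (-1) = 0] the convention [phi = 0] agrees with the general case,
    since then [s 0 = 0] and 0 is a fixed point of [pgf s]. *)
Lemma migration_root_fixpoint (phi : R) : 0 < mu -> migration_root mu r phi ->
  phi < 1 -> 0 <= phi < 1 /\ pgf s phi = phi.
Proof.
move=> mu0; rewrite /migration_root pmulr_rgt0//; case: ifPn => [r0|].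
  move=> [[/andP[h0 h1] +] _] p1; rewrite p1 ltW// rgf_pgf ?h0// => E; split => //.
  by rewrite -[RHS]mul1r -E divfK// gt_eqF.
rewrite -leNgt => r0 -> _; rewrite lexx ltr01; split => //.
rewrite (pgf0 s) /shift_law; apply/eqP; rewrite sub0r eq_le r0.
exact: (s_ge0 0).
Qed.

Section Root.
Variable phi : R.
Hypotheses (mu0 : 0 < mu) (phi01 : 0 <= phi < 1) (sphi : pgf s phi = phi).

Lemma rgf_lt1 (v : R) : phi < v < 1 -> rgf r v < 1.
Proof.
move=> /andP[pv v1]; have /andP[h0 h1] := phi01.
have v0 : 0 < v by lra.
rewrite rgf_pgf ?v0 ?ltW// ltr_pdivrMr// mul1r.
by apply: (pgf_lt_above s_ge0 s_sum s1_eq0 phi01 sphi); rewrite pv.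
Qed.

Lemma rgf_gt1 (v : R) : 0 < v < phi -> 1 < rgf r v.
Proof.
move=> /andP[v0 vp]; have /andP[h0 h1] := phi01.
rewrite rgf_pgf ?v0 ?(ltW (lt_trans vp h1))// ltr_pdivlMr// mul1r.
by apply: (pgf_gt_below s_ge0 s_sum s1_eq0 phi01 sphi); rewrite ltW.
Qed.

Lemma rgf_gap (a b : R) : phi < a -> a <= b -> b < 1 ->
  exists2 k, 0 < k & forall v, a <= v <= b -> k <= 1 - rgf r v.
Proof.
move=> pa ab b1; have /andP[h0 h1] := phi01.
have [| c] := @EVT_max _ (rgf r) a b ab.
  apply: continuous_in_subspaceT => x /[!inE]/= /[!in_itv]/= /andP[ax xb].
  by apply: rgf_continuous; apply/andP; split; lra.
rewrite in_itv/= => /andP[ac cb] cmax.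
exists (1 - rgf r c).
  by rewrite subr_gt0; apply: rgf_lt1; apply/andP; split; lra.
by move=> v vab; rewrite lerB// cmax// in_itv.
Qed.

End Root.
End ModelFacts.

(** * The density above the root *)

Section Glue.
Context {R : realType}.
Notation leb := (@lebesgue_measure R).

Lemma integrable_oo_glue (f : R -> R) (a b c : R) : a < b -> b < c ->
  leb.-integrable `]a, b[ (EFin \o f) -> leb.-integrable `]b, c[ (EFin \o f) ->
  leb.-integrable `]a, c[ (EFin \o f).
Proof.
move=> ab bc /integrableP[mab iab] /integrableP[mbc ibc].
have mab' : measurable_fun `]a, b] (EFin \o f).
  exact/emeasurable_fun_itv_bndo_bndcP.
have E : `]a, c[%classic = `]a, b]%classic `|` `]b, c[%classic.
  by rewrite -itv_bndbnd_setU// ?bnd_simp ltW.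
have mU : measurable_fun (`]a, b]%classic `|` `]b, c[%classic) (EFin \o f).
  by apply/measurable_funU; [exact: measurable_itv|exact: measurable_itv|split].
apply/integrableP; split; first by rewrite E.
rewrite E ge0_integral_setU//=.
- rewrite lte_add_pinfty//.
  rewrite -(@integral_itv_bndo_bndc _ _ _ (fun x => (`|f x|)%:E))//.
  by apply/measurable_EFinP; apply: measurableT_comp => //; exact/measurable_EFinP.
- by apply/measurable_EFinP; apply: measurableT_comp => //; exact/measurable_EFinP.
- apply/disj_setPS => y [/=]; rewrite 2!in_itv/= => /andP[_ yx] /andP[].
  by rewrite ltNge yx.
Qed.

Lemma le_oo_integrable (f g : R -> R) (a b : R) :
  (forall x, a < x < b -> {for x, continuous f}) ->
  (forall x, a < x < b -> `|f x| <= g x) ->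
  leb.-integrable `]a, b[ (EFin \o g) -> leb.-integrable `]a, b[ (EFin \o f).
Proof.
move=> cf fg; apply: le_integrable => //.
  by apply/measurable_EFinP; exact: continuous_oo_measurable.
move=> x /= /[!in_itv]/= xab.
by rewrite lee_fin (le_trans (fg _ xab))// ler_norm.
Qed.

Lemma integrable_scale (f : R -> R) (k a b : R) :
  leb.-integrable `]a, b[ (EFin \o f) ->
  leb.-integrable `]a, b[ (EFin \o (fun x => k * f x)).
Proof. by move=> intf; apply: (@integrableZl _ _ _ leb _ _ k _ intf). Qed.

Lemma is_derive_exprn n (x : R) :
  is_derive x 1 (fun v : R => v ^+ n.+1) (n.+1%:R * x ^+ n).
Proof.
apply: DeriveDef; first exact: exprn_derivable.
by rewrite exp_derive /= /GRing.scale/= mulr1.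
Qed.

End Glue.

Section Upper.
Context {R : realType}.
Variables (lambda mu : R) (p : nat -> R) (r : int -> R) (phi vphi : R).
Notation s := (shift_law r).
Notation leb := (@lebesgue_measure R).
Hypotheses (hpar : parameters lambda mu p r) (mu0 : 0 < mu)
  (phi01 : 0 <= phi < 1) (sphi : pgf s phi = phi)
  (vphi01 : 0 <= vphi < 1) (pvphi : pgf p vphi = vphi) (phi_vphi : phi < vphi).
Hypothesis integrable_speed : forall c, vphi < c < 1 ->
  leb.-integrable `]c, 1[ (EFin \o (fun v => (v - pgf p v)^-1)).

Let l0 : 0 < lambda. Proof. exact: lambda_gt0 hpar. Qed.
Let pge0 := p_ge0 hpar.
Let psum := p_sum hpar.
Let p1 := p1_eq0 hpar.
Let sge0 := s_ge0 hpar.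
Let ssum := s_sum hpar.

Lemma speed_gt0 v : vphi < v < 1 -> 0 < v - pgf p v.
Proof. by move=> v1; rewrite subr_gt0; exact: (pgf_lt_above pge0 psum p1 vphi01 pvphi v1). Qed.

Lemma speed_continuous v : 0 < v < 1 -> {for v, continuous (fun v => v - pgf p v)}.
Proof. by move=> v01; apply: cvgB; [exact: cvg_id|exact: (pgf_continuous pge0 psum v01)]. Qed.

Let vphi_lt0 v : vphi < v < 1 -> 0 < v < 1.
Proof. by move=> /andP[h v1]; rewrite v1 andbT; case/andP: vphi01 => h0 _; lra. Qed.

Lemma upper_drift_continuous v : vphi < v < 1 ->
  {for v, continuous (upper_drift lambda mu p r)}.
Proof.
move=> v1; have v01 := vphi_lt0 v1; have sp := speed_gt0 v1.
apply: cvgM.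
  apply: cvgM; first exact: cvg_cst.
  by apply: cvgB; [exact: cvg_cst|exact: (rgf_continuous hpar v01)].
apply: cvgV; first by rewrite mulf_neq0// gt_eqF.
by apply: cvgM; [exact: cvg_cst|exact: speed_continuous v01].
Qed.

Lemma rgf01 v : vphi < v < 1 -> 0 <= 1 - rgf r v <= 1.
Proof.
move=> v1; have /andP[v0 vl1] := vphi_lt0 v1; apply/andP; split.
  rewrite subr_ge0 ltW//; apply: (rgf_lt1 hpar phi01 sphi).
  by case/andP: v1 => h ->; rewrite andbT; exact: lt_trans phi_vphi h.
by rewrite lerBlDr lerDl; apply: (rgf_ge0 hpar); rewrite v0 ltW.
Qed.

Lemma upper_drift_ge0 v : vphi < v < 1 -> 0 <= upper_drift lambda mu p r v.
Proof.
move=> v1; have /andP[h0 _] := rgf01 v1; have sp := speed_gt0 v1.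
by rewrite /upper_drift divr_ge0// mulr_ge0// ltW.
Qed.

Lemma upper_drift_integrable v : vphi < v < 1 ->
  leb.-integrable `]v, 1[ (EFin \o upper_drift lambda mu p r).
Proof.
move=> v1; have /andP[h1 h2] := v1.
apply: (@le_oo_integrable _ _ (fun w => mu / lambda * (w - pgf p w)^-1)).
- by move=> x /andP[vx x1]; apply: upper_drift_continuous; rewrite x1 andbT; lra.
- move=> x /andP[vx x1]; have xv : vphi < x < 1 by apply/andP; split; lra.
  rewrite ger0_norm ?upper_drift_ge0//.
  have /andP[k0 k1] := rgf01 xv; have sp := speed_gt0 xv.
  rewrite /upper_drift invfM mulrA; apply: ler_wpM2r; first by rewrite invr_ge0 ltW.
  apply: ler_wpM2r; first by rewrite invr_ge0 ltW.
  by rewrite ler_piMr// ltW.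
- exact/integrable_scale/integrable_speed.
Qed.

Lemma upper_drift_ointegrable v : vphi < v < 1 ->
  ointegrable (upper_drift lambda mu p r) v 1.
Proof.
move=> v1; have /andP[_ /ltW h] := v1.
by rewrite /ointegrable (min_idPl h) (max_idPr h); exact: upper_drift_integrable.
Qed.

Definition upper_exp v := expR (- oint (upper_drift lambda mu p r) v 1).
Notation E := upper_exp.
Notation D := (upper_drift lambda mu p r).
Notation rho := (upper_density lambda mu p r).

Lemma upper_oint_derive v : vphi < v < 1 ->
  is_derive v 1 (fun v => oint D v 1) (- D v).
Proof.
move=> v1; apply: (@oint_is_derive_left _ D vphi 1 1) => //.
- exact: upper_drift_continuous.
- exact: upper_drift_ointegrable.
Qed.

Lemma upper_exp_derive v : vphi < v < 1 -> is_derive v 1 E (D v * E v).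
Proof.
move=> v1; have := is_deriveN (upper_oint_derive v1); rewrite opprK => dF.
have := @is_derive1_comp _ expR (fun v => - oint D v 1) v _ _ (is_derive_expR _) dF.
by rewrite mulrC.
Qed.

Lemma upper_exp_cvg1 : E v @[v --> (1 : R)^'-] --> (1 : R).
Proof.
have /andP[_ v1] := vphi01.
have O0 : - oint D v 1 @[v --> (1 : R)^'-] --> (- 0 : R).
  apply: cvgN; apply: (@oint_cvg0_left _ _ ((vphi + 1) / 2)); first by lra.
  by apply: upper_drift_integrable; apply/andP; split; lra.
rewrite -[X in _ --> X](@expR0 R) -[X in _ --> expR X]oppr0.
by apply: continuous_cvg O0; exact: continuous_expR.
Qed.

Let b := (vphi + 1) / 2.
Let vb : vphi < b. Proof. by rewrite /b; case/andP: vphi01 => *; lra. Qed.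
Let b1 : b < 1. Proof. by rewrite /b; case/andP: vphi01 => *; lra. Qed.

(** Since [phi < vphi], the factor [1 - rgf r] is bounded below near vphi, while
    [v - pgf p v <= v - vphi]: the drift has a pole that is not integrable. *)
Lemma upper_exp_cvg0 : E v @[v --> vphi^'+] --> (0 : R).
Proof.
have vb' := vb; have b1' := b1.
have [k k0 kgap] := rgf_gap hpar phi01 sphi phi_vphi (ltW vb) b1.
apply: (@expRN_vanish_right _ _ (fun v => - D v) vphi b (mu * k / lambda)) => //.
- by rewrite divr_gt0// mulr_gt0.
- by move=> x /andP[vx xb]; apply: upper_oint_derive; apply/andP; split; lra.
move=> x /andP[vx xb]; have xv : vphi < x < 1 by apply/andP; split; lra.
have sp := speed_gt0 xv.
rewrite lerN2 /upper_drift invfM mulrA.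
apply: ler_pM.
- by rewrite divr_ge0 ?mulr_ge0// ltW.
- by rewrite invr_ge0 subr_ge0 ltW.
- apply: ler_wpM2r; first by rewrite invr_ge0 ltW.
  apply: ler_wpM2l; first exact: ltW.
  by apply: kgap; apply/andP; split; lra.
- rewrite lef_pV2 ?posrE ?subr_gt0//; last by rewrite -subr_gt0.
  by apply: (pgf_le_above pge0 psum vphi01 pvphi); apply/andP; split; lra.
Qed.

Lemma upper_density_ge0 v : vphi < v < 1 -> 0 <= rho v.
Proof.
move=> v1; have sp := speed_gt0 v1.
by rewrite /upper_density divr_ge0 ?expR_ge0// mulr_ge0// ltW.
Qed.

Lemma upper_exp_continuous v : vphi < v < 1 -> {for v, continuous E}.
Proof. by move/upper_exp_derive/is_derive_continuous. Qed.

Lemma upper_density_continuous v : vphi < v < 1 -> {for v, continuous rho}.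
Proof.
move=> v1; have sp := speed_gt0 v1; have v01 := vphi_lt0 v1.
apply: cvgM; first exact: upper_exp_continuous.
apply: cvgV; first by rewrite mulf_neq0// gt_eqF.
by apply: cvgM; [exact: cvg_cst|exact: speed_continuous v01].
Qed.

Lemma upper_exp_le1 v : vphi < v < 1 -> E v <= 1.
Proof.
move=> v1; rewrite /upper_exp -[leRHS]expR0 ler_expR oppr_le0 /oint.
have /andP[_ /ltW h] := v1; rewrite h; apply: Rintegral_ge0 => //= x.
rewrite in_itv/= => /andP[vx x1]; apply: upper_drift_ge0.
by rewrite x1 andbT; case/andP: v1 => *; lra.
Qed.

(** Near vphi the density is at most a multiple of the derivative [D * E] of E,
    whose integral is finite by the fundamental theorem; near 1 it is at most
    the inverse of [lambda * (v - pgf p v)]. *)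
Lemma upper_density_integrable : leb.-integrable `]vphi, 1[ (EFin \o rho).
Proof.
have vb' := vb; have b1' := b1.
have [k k0 kgap] := rgf_gap hpar phi01 sphi phi_vphi (ltW vb) b1.
have bb : vphi < b < 1 by rewrite vb.
apply: (@integrable_oo_glue _ _ _ b) => //.
- apply: (@le_oo_integrable _ _ (fun v => (mu * k)^-1 * (D v * E v))).
  + by move=> x /andP[vx xb]; apply: upper_density_continuous; apply/andP; split; lra.
  + move=> x /andP[vx xb]; have xv : vphi < x < 1 by apply/andP; split; lra.
    rewrite ger0_norm ?upper_density_ge0//.
    have sp := speed_gt0 xv.
    rewrite ler_pdivlMl ?mulr_gt0// /upper_density -/(E x) /upper_drift.
    rewrite [leRHS](_ : _ = mu * (1 - rgf r x) * (E x / (lambda * (x - pgf p x)))); last by ring.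
    apply: ler_wpM2r; first by rewrite divr_ge0 ?expR_ge0// mulr_ge0// ltW.
    by apply: ler_wpM2l; [exact: ltW|apply: kgap; rewrite !ltW].
  + have Ei : leb.-integrable `]vphi, b[ (EFin \o (fun v => D v * E v)).
      apply: (@FTC_oo_ge0_integrable _ _ E vphi b 0 (E b)) => //.
      * by move=> x /andP[vx xb]; apply: upper_exp_derive; apply/andP; split; lra.
      * move=> x /andP[vx xb]; have xv : vphi < x < 1 by apply/andP; split; lra.
        by apply: cvgM; [exact: upper_drift_continuous|exact: upper_exp_continuous].
      * exact: upper_exp_cvg0.
      * by apply: cvg_at_left_filter; exact: upper_exp_continuous.
      * move=> x /andP[vx xb]; rewrite mulr_ge0 ?expR_ge0//.
        by apply: upper_drift_ge0; apply/andP; split; lra.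
    exact: integrable_scale.
- apply: (@le_oo_integrable _ _ (fun w => lambda^-1 * (w - pgf p w)^-1)).
  + by move=> x /andP[bx x1]; apply: upper_density_continuous; apply/andP; split; lra.
  + move=> x /andP[bx x1]; have xv : vphi < x < 1 by apply/andP; split; lra.
    rewrite ger0_norm ?upper_density_ge0// /upper_density invfM ler_piMl//.
      by rewrite mulr_ge0// invr_ge0 ltW// speed_gt0.
    exact: upper_exp_le1.
  + exact/integrable_scale/integrable_speed.
Qed.

(** This is the value of [q n.+1 * v ^+ n.+1 - \sum_k jump_rate n k * v ^+ (n + k)],
    that is, minus the generator on the powers of v. *)
Definition flux (n : nat) (v : R) :=
  v ^+ n * (lambda * n.+1%:R * (v - pgf p v) + mu * (v - pgf s v)).

(** The integrand is the derivative of [v ^+ n.+1 * E v], which goes from 0 at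
    vphi to 1 at 1. *)
Lemma upper_flux (n : nat) :
  (\int[leb]_(v in `]vphi, 1%R[) (flux n v * rho v)%:E = 1)%E.
Proof.
have -> : (1 = (1 ^+ n.+1 * 1 - vphi ^+ n.+1 * 0)%:E :> \bar R)%E.
  by rewrite mulr0 subr0 expr1n mulr1.
have fE v : vphi < v < 1 ->
    v ^+ n.+1 * (D v * E v) + E v * (n.+1%:R * v ^+ n) = flux n v * rho v.
  move=> v1; have sp := speed_gt0 v1; have /andP[v0 vl] := vphi_lt0 v1.
  rewrite /flux /upper_density -/(E v) /upper_drift (rgf_pgf hpar) ?v0 ?ltW//.
  by rewrite exprS; field; rewrite !gt_eqF.
have /andP[_ vl] := vphi01.
apply: (@FTC_oo_ge0 _ _ (fun v => v ^+ n.+1 * E v)) => //.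
- move=> v v1; rewrite -fE//.
  have -> : (fun v => v ^+ n.+1 * E v) = (fun v => v ^+ n.+1) * E by [].
  exact: (is_deriveM (is_derive_exprn n v) (upper_exp_derive v1)).
- move=> v v1; have v01 := vphi_lt0 v1.
  apply: cvgM; last exact: upper_density_continuous.
  apply: cvgM; first exact: exprn_continuous.
  apply: cvgD.
    by apply: cvgM; [exact: cvg_cst|exact: speed_continuous].
  apply: cvgM; first exact: cvg_cst.
  by apply: cvgB; [exact: cvg_id|exact: (pgf_continuous sge0 ssum v01)].
- apply: cvgM; last exact: upper_exp_cvg0.
  by apply: cvg_at_right_filter; exact: exprn_continuous.
- apply: cvgM; last exact: upper_exp_cvg1.
  by apply: cvg_at_left_filter; exact: exprn_continuous.
- move=> v v1; rewrite -fE//; have /andP[v0 _] := vphi_lt0 v1.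
  have E0 : 0 <= E v by exact: expR_ge0.
  have D0 := upper_drift_ge0 v1; have v0' := ltW v0.
  have X0 k : 0 <= v ^+ k by exact: exprn_ge0.
  apply: addr_ge0; first by apply: mulr_ge0 => //; exact: mulr_ge0.
  by apply: mulr_ge0 => //; apply: mulr_ge0.
Qed.

End Upper.

(** * The density below the root *)

Section Lower.
Context {R : realType}.
Variables (lambda mu : R) (p : nat -> R) (r : int -> R) (phi vphi : R).
Notation s := (shift_law r).
Notation leb := (@lebesgue_measure R).
Hypotheses (hpar : parameters lambda mu p r) (mu0 : 0 < mu)
  (phi01 : 0 <= phi < 1) (sphi : pgf s phi = phi)
  (vphi01 : 0 <= vphi < 1) (pvphi : pgf p vphi = vphi) (phi_vphi : phi < vphi).

Let l0 : 0 < lambda. Proof. exact: lambda_gt0 hpar. Qed.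
Let pge0 := p_ge0 hpar.
Let psum := p_sum hpar.
Let p1 := p1_eq0 hpar.
Let sge0 := s_ge0 hpar.
Let ssum := s_sum hpar.

Notation D := (lower_drift lambda mu p r).
Notation rho := (lower_integrand lambda mu p r phi).
Definition lower_exp z := expR (- oint D phi z).
Notation E := lower_exp.

Let lt01 z : 0 < z < vphi -> 0 < z < 1.
Proof. by move=> /andP[-> /= h]; case/andP: vphi01 => _; exact: lt_trans. Qed.

Lemma drop_gt0 z : 0 <= z < vphi -> 0 < pgf p z - z.
Proof. by move=> zv; rewrite subr_gt0; exact: (pgf_gt_below pge0 psum p1 vphi01 pvphi zv). Qed.

Let drop_gt0' z : 0 < z < vphi -> 0 < pgf p z - z.
Proof. by move=> /andP[z0 zv]; apply: drop_gt0; rewrite ltW. Qed.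

Lemma drop_continuous z : 0 < z < 1 -> {for z, continuous (fun z => pgf p z - z)}.
Proof. by move=> z01; apply: cvgB; [exact: (pgf_continuous pge0 psum z01)|exact: cvg_id]. Qed.

Lemma lower_drift_continuous z : 0 < z < vphi -> {for z, continuous D}.
Proof.
move=> zv; have sp := drop_gt0' zv; have z1 := lt01 zv.
apply: cvgM.
  apply: cvgM; first exact: cvg_cst.
  by apply: cvgB; [exact: cvg_cst|exact: (rgf_continuous hpar z1)].
apply: cvgV; first by rewrite mulf_neq0// gt_eqF.
by apply: cvgM; [exact: cvg_cst|exact: drop_continuous z1].
Qed.

Lemma lower_drift_ge0 z : phi < z < vphi -> 0 <= D z.
Proof.
move=> /andP[pz zv]; have /andP[h0 _] := phi01; have zv' : 0 < z < vphi by apply/andP; split; lra.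
have sp := drop_gt0' zv'; have /andP[z0 z1] := lt01 zv'.
rewrite /lower_drift divr_ge0 ?mulr_ge0// ?ltW// subr_gt0.
by apply: (rgf_lt1 hpar phi01 sphi); rewrite pz.
Qed.

Lemma lower_drift_le0 z : 0 < z < phi -> D z <= 0.
Proof.
move=> /andP[z0 zp]; have zv : 0 < z < vphi by rewrite z0 (lt_trans zp phi_vphi).
have sp := drop_gt0' zv.
rewrite /lower_drift ler_pdivrMr ?mulr_gt0// mul0r pmulr_rle0// subr_le0 ltW//.
by apply: (rgf_gt1 hpar phi01 sphi); rewrite z0.
Qed.

(** On the segment between phi and z, [rgf r] is below 1 on the right of phi and
    at most [1 / z] on its left, and vphi stays away. *)
Lemma lower_drift_ointegrable z : 0 < z < vphi -> ointegrable D phi z.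
Proof.
move=> /andP[z0 zv]; have /andP[h0 h1] := phi01; have /andP[v0 v1] := vphi01.
rewrite /ointegrable; set a := Num.min phi z; set b := Num.max phi z.
have a0 : 0 <= a by rewrite le_min h0 ltW.
have bv : b < vphi by rewrite gt_max phi_vphi.
pose c := (vphi + 1) / 2.
have [vc c1] : vphi < c /\ c < 1 by rewrite /c; split; lra.
pose dl := (c - pgf p c) / (c - vphi).
have dl0 : 0 < dl.
  rewrite divr_gt0 ?subr_gt0//; apply: (pgf_lt_above pge0 psum p1 vphi01 pvphi).
  by rewrite vc.
pose M := mu * (1 + z^-1) / (lambda * (dl * (vphi - b))).
have M0 : 0 < dl * (vphi - b) by rewrite mulr_gt0// subr_gt0.
apply: (@continuous_oo_bounded_integrable _ _ _ _ M).
  by move=> x /andP[ax xb]; apply: lower_drift_continuous; apply/andP; split; lra.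
move=> x /andP[ax xb].
have xv : 0 < x < vphi by apply/andP; split; lra.
have /andP[x0 x1] := lt01 xv; have sp := drop_gt0' xv.
have z'0 : 0 < z^-1 by rewrite invr_gt0.
have B : `|1 - rgf r x| <= 1 + z^-1.
  have g0 : 0 <= rgf r x by apply: (rgf_ge0 hpar); rewrite x0 ltW.
  have [px|xp|px] := ltgtP phi x.
  - have : rgf r x < 1 by apply: (rgf_lt1 hpar phi01 sphi); rewrite px.
    by move=> h; rewrite ger0_norm; lra.
  - have zx : z < x by move: ax; rewrite /a gt_min => /orP[]; [rewrite ltNge ltW|].
    have : rgf r x <= x^-1 by apply: (rgf_le_inv hpar); rewrite x0 ltW.
    have : x^-1 <= z^-1 by rewrite lef_pV2 ?posrE// ltW.
    by move=> ? ?; rewrite ler_norml; apply/andP; split; lra.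
  - by move: ax xb; rewrite /a /b gt_min lt_max -px !ltxx /= => zx xz; lra.
rewrite /lower_drift normrM normrM (ger0_norm (ltW mu0)) normfV.
rewrite (ger0_norm (_ : 0 <= lambda * _)); last by rewrite mulr_ge0// ltW.
apply: ler_pM => //.
- by rewrite mulr_ge0// ltW.
- by rewrite invr_ge0 mulr_ge0// ltW.
- by apply: ler_wpM2l => //; exact: ltW.
- rewrite lef_pV2 ?posrE; [|by rewrite mulr_gt0|by rewrite mulr_gt0].
  apply: ler_wpM2l; first exact: ltW.
  apply: (@le_trans _ _ (dl * (vphi - x))).
    by apply: ler_wpM2l; [exact: ltW|lra].
  by apply: (pgf_chord_below pge0 psum vphi01 pvphi vc c1); rewrite !ltW//; lra.
Qed.

Lemma lower_oint_derive z : 0 < z < vphi -> is_derive z 1 (fun z => oint D phi z) (D z).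
Proof.
move=> zv; apply: (@oint_is_derive _ D 0 vphi) => //.
- exact: lower_drift_continuous.
- exact: lower_drift_ointegrable.
Qed.

Lemma lower_exp_derive z : 0 < z < vphi -> is_derive z 1 E (- (D z * E z)).
Proof.
move=> zv; have dF := is_deriveN (lower_oint_derive zv).
have := @is_derive1_comp _ expR (fun z => - oint D phi z) z _ _ (is_derive_expR _) dF.
by rewrite mulrN mulrC.
Qed.

(** The drift has the sign of [z - phi], so its oriented integral from phi is
    nonnegative on both sides of phi. *)
Lemma lower_exp_le1 z : 0 < z < vphi -> E z <= 1.
Proof.
move=> /andP[z0 zv]; rewrite /lower_exp -[leRHS]expR0 ler_expR oppr_le0 /oint.
case: (leP phi z) => pz.
- apply: Rintegral_ge0 => //= x; rewrite in_itv/= => /andP[px xz].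
  by apply: lower_drift_ge0; apply/andP; split; lra.
- have ii : leb.-integrable `]z, phi[ (EFin \o D).
    have /lower_drift_ointegrable : 0 < z < vphi by rewrite z0.
    by rewrite /ointegrable (min_idPr (ltW pz)) (max_idPl (ltW pz)).
  rewrite -mulN1r -RintegralZl//; apply: Rintegral_ge0 => //= x.
  rewrite in_itv/= => /andP[zx xp]; rewrite mulN1r oppr_ge0.
  by apply: lower_drift_le0; apply/andP; split; lra.
Qed.

Let b := (phi + vphi) / 2.
Let pb : phi < b. Proof. by have := phi_vphi; rewrite /b; lra. Qed.
Let bv : b < vphi. Proof. by have := phi_vphi; rewrite /b; lra. Qed.
Let b0 : 0 < b. Proof. by have := phi_vphi; rewrite /b; case/andP: phi01 => *; lra. Qed.

Lemma lower_gap : exists2 k, 0 < k & forall v, b <= v < vphi -> k <= 1 - rgf r v.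
Proof.
have /andP[_ v1] := vphi01.
have [k k0 kgap] := rgf_gap hpar phi01 sphi pb (ltW bv) v1.
by exists k => // v /andP[bx xv]; apply: kgap; rewrite bx ltW.
Qed.

(** As on the other side of vphi, the drift has a pole that is not integrable,
    because [phi < vphi]. *)
Lemma lower_exp_cvg0 : E z @[z --> vphi^'-] --> (0 : R).
Proof.
have b0' := b0; have bv' := bv; have pb' := pb.
have [k k0 kgap] := lower_gap.
apply: (@expRN_vanish_left _ _ D b vphi (mu * k / lambda)) => //.
- by rewrite divr_gt0// mulr_gt0.
- by move=> x /andP[bx xv]; apply: lower_oint_derive; apply/andP; split => //; lra.
move=> x /andP[bx xv]; have xv' : 0 < x < vphi by apply/andP; split => //; lra.
have sp := drop_gt0' xv'.
rewrite /lower_drift invfM mulrA; apply: ler_pM.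
- by rewrite divr_ge0 ?mulr_ge0// ltW.
- by rewrite invr_ge0 subr_ge0 ltW.
- apply: ler_wpM2r; first by rewrite invr_ge0 ltW.
  by apply: ler_wpM2l; [exact: ltW|apply: kgap; rewrite xv ltW].
- rewrite lef_pV2 ?posrE ?subr_gt0//; last by rewrite -subr_gt0.
  by apply: (pgf_le_below pge0 psum vphi01 pvphi); apply/andP; split; lra.
Qed.

Lemma lower_exp_continuous z : 0 < z < vphi -> {for z, continuous E}.
Proof. by move/lower_exp_derive/is_derive_continuous. Qed.

Lemma lower_integrandE n z : rho n z = z ^+ n * rho 0%N z.
Proof. by rewrite /lower_integrand expr0 mulr1 mulrC. Qed.

Lemma lower_density_gt0 z : 0 < z < vphi -> 0 < rho 0%N z.
Proof.
move=> zv; have sp := drop_gt0' zv.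
by rewrite /lower_integrand expr0 mulr1 divr_gt0 ?expR_gt0// mulr_gt0.
Qed.

Lemma lower_density_continuous z : 0 < z < vphi -> {for z, continuous (rho 0%N)}.
Proof.
move=> zv; have sp := drop_gt0' zv; have z1 := lt01 zv.
apply: cvgM; last by apply: cvg_trans (@exprn_continuous _ 0 z).
apply: cvgM; first exact: lower_exp_continuous.
apply: cvgV; first by rewrite mulf_neq0// gt_eqF.
by apply: cvgM; [exact: cvg_cst|exact: drop_continuous z1].
Qed.

(** Away from vphi the denominator is bounded below and [E <= 1]; near vphi the
    density is at most a multiple of the derivative of [- E]. *)
Lemma lower_density_integrable : leb.-integrable `]0, vphi[ (EFin \o rho 0%N).
Proof.
have b0' := b0; have bv' := bv; have pb' := pb.
have /andP[v0 v1] := vphi01.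
have [k k0 kgap] := lower_gap.
apply: (@integrable_oo_glue _ _ _ b) => //.
- pose c := (vphi + 1) / 2.
  have [vc c1] : vphi < c /\ c < 1 by rewrite /c; split; lra.
  pose dl := (c - pgf p c) / (c - vphi).
  have dl0 : 0 < dl.
    rewrite divr_gt0 ?subr_gt0//; apply: (pgf_lt_above pge0 psum p1 vphi01 pvphi).
    by rewrite vc.
  apply: (@continuous_oo_bounded_integrable _ _ _ _ (lambda * (dl * (vphi - b)))^-1).
    by move=> x /andP[x0 xb]; apply: lower_density_continuous; apply/andP; split; lra.
  move=> x /andP[x0 xb].
  have xv : 0 < x < vphi by apply/andP; split; lra.
  have sp := drop_gt0' xv.
  rewrite gtr0_norm ?lower_density_gt0// /lower_integrand expr0 mulr1 -/(E x).
  rewrite -[leRHS]mul1r; apply: ler_pM; rewrite ?expR_ge0 ?lower_exp_le1//.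
    by rewrite invr_ge0 mulr_ge0// ltW.
  have q1 : 0 < lambda * (dl * (vphi - b)) by apply: mulr_gt0 => //; apply: mulr_gt0 => //; lra.
  have q2 : 0 < lambda * (pgf p x - x) by rewrite mulr_gt0.
  rewrite lef_pV2 ?posrE//.
  apply: ler_wpM2l; first exact: ltW.
  apply: (@le_trans _ _ (dl * (vphi - x))).
    by apply: ler_wpM2l; [exact: ltW|lra].
  by apply: (pgf_chord_below pge0 psum vphi01 pvphi vc c1); rewrite !ltW//; lra.
- apply: (@le_oo_integrable _ _ (fun z => (mu * k)^-1 * (D z * E z))).
  + by move=> x /andP[bx xv]; apply: lower_density_continuous; apply/andP; split; lra.
  + move=> x /andP[bx xv]; have xv' : 0 < x < vphi by apply/andP; split; lra.
    have sp := drop_gt0' xv'.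
    rewrite gtr0_norm ?lower_density_gt0//.
    rewrite ler_pdivlMl ?mulr_gt0// /lower_integrand expr0 mulr1 -/(E x) /lower_drift.
    rewrite [leRHS](_ : _ = mu * (1 - rgf r x) * (E x / (lambda * (pgf p x - x)))); last by ring.
    apply: ler_wpM2r; first by rewrite divr_ge0 ?expR_ge0// mulr_ge0// ltW.
    by apply: ler_wpM2l; [exact: ltW|apply: kgap; rewrite xv ltW].
  + apply: integrable_scale.
    apply: (@FTC_oo_ge0_integrable _ _ (fun z => - E z) b vphi (- E b) (- 0)) => //.
    * move=> x /andP[bx xv]; have xv' : 0 < x < vphi by apply/andP; split; lra.
      by have := is_deriveN (lower_exp_derive xv'); rewrite opprK.
    * move=> x /andP[bx xv]; have xv' : 0 < x < vphi by apply/andP; split; lra.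
      by apply: cvgM; [exact: lower_drift_continuous|exact: lower_exp_continuous].
    * apply: cvgN; apply: cvg_at_right_filter; apply: lower_exp_continuous.
      by rewrite b0.
    * by apply: cvgN; exact: lower_exp_cvg0.
    * move=> x /andP[bx xv]; rewrite mulr_ge0 ?expR_ge0//.
      by apply: lower_drift_ge0; apply/andP; split; lra.
Qed.

Lemma flux_continuous n z : 0 < z < 1 -> {for z, continuous (flux lambda mu p r n)}.
Proof.
move=> z1; apply: cvgM; first exact: exprn_continuous.
apply: cvgD; (apply: cvgM; first exact: cvg_cst).
  by apply: cvgB; [exact: cvg_id|exact: (pgf_continuous pge0 psum z1)].
by apply: cvgB; [exact: cvg_id|exact: (pgf_continuous sge0 ssum z1)].
Qed.

Lemma flux_bound n z : 0 < z < 1 ->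
  `|flux lambda mu p r n z| <= lambda * n.+1%:R + mu.
Proof.
move=> /andP[z0 z1]; have z01 : 0 <= z <= 1 by rewrite !ltW.
have B c : (forall k, 0 <= c k) -> series c @ \oo --> (1 : R) -> `|z - pgf c z| <= 1.
  move=> c0 c1; have := pgf_ge0 c0 c1 z01; have := pgf_le1 c0 c1 z01 => h1 h2.
  by rewrite ler_norml; apply/andP; split; lra.
rewrite /flux normrM -[leRHS]mul1r; apply: ler_pM => //.
  by rewrite ger0_norm ?exprn_ge0 ?exprn_ile1// ltW.
apply: (le_trans (ler_normD _ _)); apply: lerD.
  by rewrite normrM ger0_norm ?ler_piMr ?B// mulr_ge0// ltW.
by rewrite normrM ger0_norm ?ler_piMr ?B ?(mu_ge0 hpar).
Qed.

(** The integrand is the derivative of [- (z ^+ n.+1 * E z)], which vanishes at 0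
    because of the power and at vphi because of E. *)
Lemma lower_flux n :
  leb.-integrable `]0, vphi[ (EFin \o (fun z => flux lambda mu p r n z * rho 0%N z)) /\
  (\int[leb]_(z in `]0%R, vphi[) (flux lambda mu p r n z * rho 0%N z)%:E = 0)%E.
Proof.
have pv := phi_vphi.
have /andP[h0 h1] := phi01; have v0 : 0 < vphi by lra.
have ii : leb.-integrable `]0, vphi[ (EFin \o (fun z => flux lambda mu p r n z * rho 0%N z)).
  apply: (@le_oo_integrable _ _ (fun z => (lambda * n.+1%:R + mu) * rho 0%N z)).
  - move=> x xv; apply: cvgM; last exact: lower_density_continuous.
    exact: flux_continuous (lt01 xv).
  - move=> x xv; rewrite normrM; apply: ler_pM => //; first exact: flux_bound (lt01 xv).
    by rewrite gtr0_norm ?lower_density_gt0.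
  - exact/integrable_scale/lower_density_integrable.
split => //.
have -> : (0 = (- (vphi ^+ n.+1 * 0) - - 0)%:E :> \bar R)%E.
  by rewrite mulr0 oppr0 subr0.
apply: (@FTC_oo_integrable _ _ (fun z => - (z ^+ n.+1 * E z))) => //.
- move=> z zv.
  have -> : flux lambda mu p r n z * rho 0%N z =
      - (z ^+ n.+1 * (- (D z * E z)) + E z * (n.+1%:R * z ^+ n)).
    have sp := drop_gt0' zv; have /andP[z0 z1] := lt01 zv.
    rewrite /flux /lower_integrand -/(E z) /lower_drift (rgf_pgf hpar) ?z0 ?ltW//.
    by rewrite exprS; field; rewrite !gt_eqF.
  apply: is_deriveN.
  exact: (is_deriveM (is_derive_exprn n z) (lower_exp_derive zv)).
- move=> x xv; apply: cvgM; last exact: lower_density_continuous.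
  exact: flux_continuous (lt01 xv).
- apply: cvgN.
  apply: (@squeeze_cvgr _ _ _ _ (cst 0) (fun z => z ^+ n.+1)).
  + near=> z; have z0 : 0 < z by near: z; exact: nbhs_right_gt.
    have zv : z < vphi by near: z; exact: nbhs_right_lt.
    rewrite /cst mulr_ge0 ?expR_ge0 ?exprn_ge0 ?(ltW z0)//=.
    by rewrite ler_piMr ?exprn_ge0 ?(ltW z0)// lower_exp_le1// z0.
  + exact: cvg_cst.
  + have := @exprn_continuous R n.+1 0; rewrite /continuous_at expr0n/= => h.
    by apply: cvg_at_right_filter.
- apply: cvgN; apply: cvgM; last exact: lower_exp_cvg0.
  by apply: cvg_at_left_filter; exact: exprn_continuous.
Unshelve. all: by end_near. Qed.

Lemma lower_integral_gt0 n : (0 < \int[leb]_(z in `]0%R, vphi[) (rho n z)%:E)%E.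
Proof.
have b0' := b0; have bv' := bv; have pb' := pb.
(* the integrand has a positive minimum on the segment [b, c] *)
have cb : b <= (b + vphi) / 2 by lra.
set c := (b + vphi) / 2 in cb.
have bc : b < c by rewrite /c; lra.
have cv : c < vphi by rewrite /c; lra.
have cr z : 0 < z < vphi -> {for z, continuous (rho n)}.
  move=> zv; rewrite (_ : rho n = fun z => z ^+ n * rho 0%N z).
    by apply: cvgM; [exact: exprn_continuous|exact: lower_density_continuous].
  by apply/funext => y; rewrite lower_integrandE.
have rp z : 0 < z < vphi -> 0 < rho n z.
  move=> zv; rewrite lower_integrandE mulr_gt0 ?lower_density_gt0// exprn_gt0//.
  by case/andP: zv.
have [| m] := @EVT_min _ (rho n) b c (ltW bc).
  apply: continuous_in_subspaceT => x /[!inE]/= /[!in_itv]/= /andP[ax xb].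
  by apply: cr; apply/andP; split => //; lra.
rewrite in_itv/= => /andP[bm mc] mmin.
have rm : 0 < rho n m by apply: rp; apply/andP; split; lra.
apply: (@lt_le_trans _ _ (\int[leb]_(z in `[b, c]) (rho n m)%:E)%E).
  rewrite integral_cst//= lebesgue_measure_itv/= lte_fin bc -EFinB -EFinM lte_fin.
  by rewrite mulr_gt0// subr_gt0.
apply: (@le_trans _ _ (\int[leb]_(z in `[b, c]) (rho n z)%:E)%E).
  apply: ge0_le_integral => //=.
  - by move=> x _; rewrite lee_fin ltW.
  - apply/measurable_EFinP; apply: (@measurable_funS _ _ _ _ `]0, vphi[%classic) => //.
      by move=> x /=; rewrite !in_itv/= => /andP[? ?]; apply/andP; split; lra.
    exact: continuous_oo_measurable.
apply: (@ge0_subset_integral _ _ _ leb) => //=.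
- by apply/measurable_EFinP; exact: continuous_oo_measurable.
- by move=> x; rewrite in_itv/= => xv; rewrite lee_fin ltW// rp.
- by move=> x /=; rewrite !in_itv/= => /andP[? ?]; apply/andP; split; lra.
Qed.

End Lower.

(** * Green functions of nonnegative kernels *)

Section Operators.
Context {R : realType}.
Implicit Types (M K : nat -> nat -> R) (f g u w : nat -> \bar R).
Local Open Scope ereal_scope.

Definition kop M f (i : nat) : \bar R := \sum_(j <oo) (M i j)%:E * f j.

Section OneKernel.
Variable M : nat -> nat -> R.
Hypothesis M_ge0 : forall i j, (0 <= M i j)%R.
Notation K := (kop M).

Let Mf0 f : (forall i, 0 <= f i) -> forall i j, 0 <= (M i j)%:E * f j.
Proof. by move=> f0 i j; rewrite mule_ge0// lee_fin. Qed.

Lemma kop_ge0 f : (forall i, 0 <= f i) -> forall i, 0 <= K f i.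
Proof. by move=> f0 i; apply: nneseries_ge0 => n _ _; exact: Mf0. Qed.

Lemma kop_le f g : (forall i, 0 <= f i) -> (forall i, f i <= g i) ->
  forall i, K f i <= K g i.
Proof.
move=> f0 fg i; apply: lee_nneseries => [n _ _|n _]; first exact: Mf0.
by rewrite lee_wpmul2l// lee_fin.
Qed.

Lemma eq_kop f g : f =1 g -> K f =1 K g.
Proof. by move=> fg i; apply: eq_eseriesr => j _; rewrite fg. Qed.

Lemma kopD f g : (forall i, 0 <= f i) -> (forall i, 0 <= g i) ->
  forall i, K (fun j => f j + g j) i = K f i + K g i.
Proof.
move=> f0 g0 i; rewrite /kop -nneseriesD//; last 2 first.
  by move=> n _ _; exact: Mf0.
  by move=> n _ _; exact: Mf0.
by apply: eq_eseriesr => j _; rewrite ge0_muleDr.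
Qed.

Lemma kopZ (c : R) f : (forall i, 0 <= f i) ->
  forall i, K (fun j => c%:E * f j) i = c%:E * K f i.
Proof.
move=> f0 i; rewrite /kop -nneseriesZl//; last by move=> n _; exact: Mf0.
by apply: eq_eseriesr => j _; rewrite muleCA.
Qed.

Lemma kop_series (f : nat -> nat -> \bar R) : (forall m i, 0 <= f m i) ->
  forall i, K (fun j => \sum_(m <oo) f m j) i = \sum_(m <oo) K (f m) i.
Proof.
move=> f0 i; rewrite /kop nneseries_interchange; last first.
  by move=> m j; exact: Mf0.
by apply: eq_eseriesr => j _; rewrite nneseriesZl.
Qed.

Lemma iter_kop_ge0 m f : (forall i, 0 <= f i) -> forall i, 0 <= iter m K f i.
Proof. by move=> f0; elim: m => // m IH i; exact: kop_ge0. Qed.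

Lemma iter_kop_le m f g : (forall i, 0 <= f i) -> (forall i, f i <= g i) ->
  forall i, iter m K f i <= iter m K g i.
Proof.
move=> f0 fg; elim: m => // m IH i /=; apply: kop_le => //.
by move=> j; exact: iter_kop_ge0.
Qed.

Lemma eq_iter_kop m f g : f =1 g -> iter m K f =1 iter m K g.
Proof. by move=> fg; elim: m => // m IH; exact: eq_kop. Qed.

Lemma iter_kopD m f g : (forall i, 0 <= f i) -> (forall i, 0 <= g i) ->
  forall i, iter m K (fun j => f j + g j) i = iter m K f i + iter m K g i.
Proof.
move=> f0 g0; elim: m => // m IH i /=; rewrite (eq_kop IH) kopD//.
  by move=> j; exact: iter_kop_ge0.
by move=> j; exact: iter_kop_ge0.
Qed.

Lemma iter_kopZ m (c : R) f : (forall i, 0 <= f i) ->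
  forall i, iter m K (fun j => c%:E * f j) i = c%:E * iter m K f i.
Proof.
move=> f0; elim: m => // m IH i /=; rewrite (eq_kop IH) kopZ//.
by move=> j; exact: iter_kop_ge0.
Qed.

Lemma iter_kop_series m (f : nat -> nat -> \bar R) : (forall k i, 0 <= f k i) ->
  forall i, iter m K (fun j => \sum_(k <oo) f k j) i = \sum_(k <oo) iter m K (f k) i.
Proof.
move=> f0; elim: m => // m IH i /=; rewrite (eq_kop IH) kop_series//.
by move=> k j; exact: iter_kop_ge0.
Qed.

Lemma green_partial u w : (forall i, 0 <= u i) -> (forall i, 0 <= w i) ->
  (forall i, u i = w i + K u i) ->
  forall m i, u i = \sum_(0 <= k < m) iter k K w i + iter m K u i.
Proof.
move=> u0 w0 E; elim=> [|m IH] i; first by rewrite big_nil add0e.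
rewrite big_nat_recr//= -addeA -iterS iterSr -iter_kopD//; last exact: kop_ge0.
by rewrite -(eq_iter_kop m E).
Qed.

Lemma green_sum_le u w : (forall i, 0 <= u i) -> (forall i, 0 <= w i) ->
  (forall i, u i = w i + K u i) -> forall i, \sum_(k <oo) iter k K w i <= u i.
Proof.
move=> u0 w0 E i; apply: lime_le.
  by apply: is_cvg_nneseries => n _ _; exact: iter_kop_ge0.
apply: nearW => m; rewrite [leRHS](green_partial u0 w0 E m).
by rewrite leeDl// iter_kop_ge0.
Qed.

Hypothesis substochastic : forall i, K (cst 1) i <= 1.

Lemma iter_substochastic m i : iter m K (cst 1) i <= 1.
Proof.
elim: m i => [|m IH] i //=; apply: le_trans (substochastic i).
by apply: kop_le => // j; exact: iter_kop_ge0.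
Qed.

Variables (omega : nat -> \bar R) (x : nat).
Hypotheses (omega_ge0 : forall i, 0 <= omega i)
  (omega_sum : \sum_(k <oo) iter k K omega x < +oo).

Lemma iter_omega_cvg0 : iter k K omega x @[k --> \oo] --> 0.
Proof.
pose a k := iter k K omega x.
have a0 k : 0 <= a k by exact: iter_kop_ge0.
have afin k : a k \is a fin_num.
  rewrite ge0_fin_numE//; apply: le_lt_trans omega_sum.
  have := @nneseries_lim_ge _ a xpredT 0 k.+1 (fun n _ _ => a0 n).
  by apply: le_trans; rewrite big_nat_recr//= leeDr// sume_ge0.
have : series (fine \o a) n @[n --> \oo] --> fine (\sum_(k <oo) a k).
  have h : cvgn (series (fine \o a)).
    apply: nnseries_is_cvg => [k|]; first exact: fine_ge0.
    apply: le_lt_trans omega_sum; rewrite le_eqVlt; apply/orP; left; apply/eqP.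
    by apply: eq_eseriesr => k _ /=; rewrite fineK.
  suff <- : limn (series (fine \o a)) = fine (\sum_(k <oo) a k) by [].
  apply/esym; rewrite (_ : \sum_(k <oo) a k = (limn (series (fine \o a)))%:E)//.
  apply/cvg_lim => //; rewrite (_ : (fun n => _) = EFin \o series (fine \o a)).
    exact: cvg_EFin (nearW _ _) h.
  by apply/funext => n /=; rewrite /series/= -sumEFin; apply: eq_bigr => k _; rewrite fineK.
move=> /cvgP/cvg_series_cvg_0 h; apply/fine_cvgP; split; last exact: h.
exact: nearW.
Qed.

(** The function u is arbitrarily small up to a multiple of omega; for omega the
    mean holding times this holds for every function that tends to 0. *)
Definition dominated u := forall e : R, (0 < e)%R ->
  exists2 C : R, (0 <= C)%R & forall i, u i <= e%:E + C%:E * omega i.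

(** Iterating K does not increase the constant part e, and [K^k omega] tends to 0
    as the general term of a convergent series. *)
Lemma iter_dominated_cvg0 u : (forall i, 0 <= u i) -> dominated u ->
  iter k K u x @[k --> \oo] --> 0.
Proof.
move=> u0 du.
have H (e : R) : (0 < e)%R -> \forall k \near \oo, iter k K u x <= e%:E.
  move=> e0; have e20 : (0 < e / 2)%R by rewrite divr_gt0.
  have [C C0 uC] := du _ e20.
  have e4 : (0 < e / 2 / (C + 1))%R by rewrite divr_gt0// ltr_pwDr.
  have /fine_cvgP[fn /cvgrPdist_le/(_ _ e4) h] := iter_omega_cvg0.
  near=> k.
  have hk : (`|0 - fine (iter k K omega x)| <= e / 2 / (C + 1))%R by near: k.
  have fk : iter k K omega x \is a fin_num by near: k.
  apply: (@le_trans _ _ (iter k K (fun i => (e / 2)%:E * cst 1 i + C%:E * omega i) x)).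
    by apply: iter_kop_le => // i; rewrite /cst mule1.
  rewrite iter_kopD; last 2 first.
    by move=> i; rewrite mule_ge0// lee_fin ltW.
    by move=> i; rewrite mule_ge0.
  rewrite !iter_kopZ// -(fineK fk) -EFinM.
  apply: (@le_trans _ _ ((e / 2)%:E + (e / 2)%:E)); last by rewrite -EFinD -splitr.
  apply: leeD.
    by rewrite -[leRHS]mule1 lee_wpmul2l ?iter_substochastic// lee_fin ltW.
  rewrite lee_fin; move: hk; rewrite sub0r normrN ger0_norm; last first.
    by rewrite fine_ge0// iter_kop_ge0.
  move=> hk; apply: le_trans (ler_wpM2l C0 hk) _.
  rewrite mulrCA ler_piMr ?(ltW e20)// ler_pdivrMr ?mul1r ?lerDl//.
  by rewrite ltr_pwDr.
apply/fine_cvgP; split.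
  apply: filterS (H _ ltr01) => k hk.
  by rewrite ge0_fin_numE ?iter_kop_ge0// (le_lt_trans hk)// ltry.
apply/cvgrPdist_le => e e0; apply: filterS (H _ e0) => k hk.
have fk : iter k K u x \is a fin_num.
  by rewrite ge0_fin_numE ?iter_kop_ge0// (le_lt_trans hk)// ltry.
rewrite sub0r normrN ger0_norm; last by rewrite fine_ge0// iter_kop_ge0.
by rewrite -lee_fin fineK.
Unshelve. all: by end_near. Qed.

(** The Green sum is the smallest nonnegative solution of [u = w + K u]; the
    remainder [K^k u] vanishes in the limit for a dominated solution. *)
Lemma green u w : (forall i, 0 <= u i) -> (forall i, 0 <= w i) ->
  (forall i, u i = w i + K u i) -> dominated u ->
  \sum_(k <oo) iter k K w x = u x.
Proof.
move=> u0 w0 E du.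
have c0 := iter_dominated_cvg0 u0 du.
have cS : \sum_(0 <= k < m) iter k K w x @[m --> \oo] --> \sum_(k <oo) iter k K w x.
  by apply: is_cvg_nneseries => n _ _; exact: iter_kop_ge0.
have dd : (\sum_(k <oo) iter k K w x) +? 0 by rewrite fin_num_adde_defl.
have h : \sum_(0 <= k < m) iter k K w x + iter m K u x @[m --> \oo] -->
    \sum_(k <oo) iter k K w x + 0 by exact: cvgeD.
rewrite adde0 in h; rewrite -(cvg_lim _ h)//.
apply: lim_near_cst => //; apply: nearW => m.
by rewrite -(green_partial u0 w0 E).
Qed.

End OneKernel.
End Operators.

(** * The layer-cake formula *)

Section LayerCake.
Context {R : realType}.
Notation leb := (@lebesgue_measure R).
Local Open Scope ereal_scope.

Lemma integral_expRN (a : R) : (0 < a)%R ->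
  \int[leb]_(u in `[0%R, +oo[) (expR (- (a * u)))%:E = (a^-1)%:E.
Proof.
move=> a0.
have : \int[leb]_(u in `[0%R, +oo[) (a%:E * (expR (- (a * u)))%:E) = 1.
  rewrite -(integral_exponential_pdf a0) integral_mkcond; apply: eq_integral => u _.
  rewrite /exponential_pdf /= !patchE; case: ifP => // _.
  by rewrite -EFinM mulNr.
rewrite ge0_integralZl//=; last 2 first.
- apply/measurable_EFinP; apply: measurable_funTS; apply: continuous_measurable_fun => x.
  apply: continuous_comp; last exact: continuous_expR.
  by apply: cvgN; apply: cvgMl_tmp; exact: cvg_id.
- by rewrite lee_fin ltW.
set I := integral _ _ _ => E.
have Ifin : I \is a fin_num.
  rewrite fin_numElt; apply/andP; split.
    by apply: (@lt_le_trans _ _ 0) => //; apply: integral_ge0 => u _; rewrite lee_fin expR_ge0.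
  rewrite ltey; apply/eqP => Iy; move: E; rewrite Iy gt0_muley//.
move: E; rewrite -(fineK Ifin) -EFinM => -[E]; congr EFin.
by rewrite -[RHS]mulr1 -E mulKf// gt_eqF.
Qed.

(** [e^(-s)], with value 0 at [s = +oo]: an absorbing state is held forever. *)
Definition laplace (s : \bar R) : R := if s is r%:E then expR (- r) else 0.

Lemma layer_id (s : \bar R) : 0 <= s ->
  \int[leb]_(u in `[0%R, +oo[ `&` [set u | u%:E < s]) 1%:E = s.
Proof.
case: s => [r| |//] s0.
- have -> : `[0%R, +oo[%classic `&` [set u | u%:E < r%:E] = `[0%R, r[%classic.
    by apply/seteqP; split => u /=; rewrite !in_itv/= lte_fin andbT => /andP.
  rewrite integral_cst//= lebesgue_measure_itv/= mul1e; case: ifPn.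
    by rewrite oppr0 adde0.
  by rewrite -leNgt lee_fin => r0; congr EFin; apply/eqP; rewrite eq_le -!lee_fin s0.
- have -> : `[0%R, +oo[%classic `&` [set u : R | u%:E < +oo] = `[0%R, +oo[%classic :> set R.
    by apply/seteqP; split => u /=; [by case|move=> ?; split => //; rewrite ltry].
  by rewrite integral_cst//= mul1e lebesgue_measure_itv/= ?ltry.
Qed.

Lemma layer_laplace (s : \bar R) : 0 <= s ->
  \int[leb]_(u in `[0%R, +oo[ `&` [set u | u%:E < s]) (expR (- u))%:E =
  1 - (laplace s)%:E.
Proof.
case: s => [r| |//] s0.
- have -> : `[0%R, +oo[%classic `&` [set u | u%:E < r%:E] = `[0%R, r[%classic.
    by apply/seteqP; split => u /=; rewrite !in_itv/= lte_fin andbT => /andP.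
  rewrite integral_itv_bndo_bndc; last first.
    apply/measurable_EFinP; apply: measurable_funTS; apply: continuous_measurable_fun => x.
    by apply: continuous_comp; [exact: opp_continuous|exact: continuous_expR].
  have dF (x : R) : (0 <= x <= r)%R -> is_derive x 1%R (fun u => - expR (- u))%R (expR (- x)).
    move=> _.
    have := is_deriveN
      (@is_derive1_comp _ expR -%R x _ _ (is_derive_expR _) (is_deriveNid x 1%R)).
    by rewrite mulrN1 opprK.
  have cF (x : R) : (0 <= x <= r)%R -> {for x, continuous (fun u => expR (- u))%R}.
    by move=> _; apply: continuous_comp; [exact: opp_continuous|exact: continuous_expR].
  rewrite lee_fin in s0; rewrite (FTC_cc s0 dF cF).
  by rewrite oppr0 expR0 opprK addrC /laplace EFinB.
- have -> : `[0%R, +oo[%classic `&` [set u : R | u%:E < +oo] = `[0%R, +oo[%classic :> set R.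
    by apply/seteqP; split => u /=; [by case|move=> ?; split => //; rewrite ltry].
  have := @integral_expRN 1 ltr01; rewrite invr1 /laplace sube0 => <-.
  by apply: eq_integral => u _; rewrite mul1r.
Qed.

Context d (T : measurableType d) (P : probability T R).

(** Tonelli on [T * R].  The weight Phi will be the indicator of an event on the
    jump chain, possibly times a function of other holding times, so that the
    joint law of the chain is only used through tails of S under Phi. *)
Lemma layer_cake (Phi S : T -> \bar R) (g : R -> R) :
  measurable_fun setT Phi -> (forall w, 0 <= Phi w) ->
  measurable_fun setT S ->
  measurable_fun setT g -> (forall u, 0 <= g u)%R ->
  \int[P]_w (Phi w * \int[leb]_(u in `[0%R, +oo[ `&` [set u | u%:E < S w]) (g u)%:E)
  = \int[leb]_(u in `[0%R, +oo[) ((g u)%:E * \int[P]_(w in [set w | u%:E < S w]) Phi w).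
Proof.
move=> mPhi Phi0 mS mg g0.
pose g' := EFin \o (g \_ (`[0%R, +oo[%classic : set R)).
have mg' : measurable_fun setT g'.
  apply/measurable_EFinP.
  apply: (@measurable_restrictT _ _ _ R (`[0%R, +oo[%classic : set R) g (measurable_itv _)).1.
  exact: measurable_funTS.
have g'0 u : 0 <= g' u.
  by rewrite lee_fin /= patchE; case: ifP.
pose ind (z : T * R) : R := (((z.2)%:E < S z.1)%E : bool)%:R.
have mind : measurable_fun setT (EFin \o ind).
  apply/measurable_EFinP.
  rewrite (_ : ind = fun z : T * R => if (z.2)%:E < S z.1 then 1%R else 0%R).
    apply: measurable_fun_ifT => //; apply: measurable_fun_lte.
      by apply/measurable_EFinP; exact: measurable_snd.
    by apply: measurableT_comp => //; exact: measurable_fst.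
  by apply/funext => z; rewrite /ind; case: ifP.
pose F (z : T * R) : \bar R := Phi z.1 * (g' z.2 * (ind z)%:E).
have mF : measurable_fun setT F.
  apply: emeasurable_funM; first by apply: measurableT_comp => //; exact: measurable_fst.
  by apply: emeasurable_funM => //; apply: measurableT_comp => //; exact: measurable_snd.
have F0 z : 0 <= F z by rewrite !mule_ge0// lee_fin ler0n.
transitivity (\int[P]_w \int[leb]_u F (w, u)).
  apply: eq_integral => w _; rewrite /F/= ge0_integralZl//=; last 2 first.
  - apply: emeasurable_funM => //.
    exact: (measurableT_comp mind (measurable_pair1 w)).
  - by move=> u _; rewrite mule_ge0// lee_fin ler0n.
  congr (_ * _); rewrite integral_mkcond; apply: eq_integral => u _.
  rewrite /g' /ind /= !patchE in_setI.
  case: (u \in `[0%R, +oo[%classic) => /=; last by rewrite mul0e.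
  have [us|us] := boolP (u%:E < S w); first by rewrite mem_set// mule1.
  by rewrite memNset ?mule0//; exact/negP.
rewrite fubini_tonelli//.
rewrite [RHS]integral_mkcond; apply: eq_integral => u _; rewrite /F/=.
transitivity (\int[P]_w (g' u * (Phi w * (ind (w, u))%:E))).
  by apply: eq_integral => w _; rewrite muleCA.
rewrite ge0_integralZl//=; last 2 first.
- apply: emeasurable_funM => //.
  exact: (measurableT_comp mind (measurable_pair2 u)).
- by move=> w _; rewrite mule_ge0// lee_fin ler0n.
rewrite /g' /= !patchE; case: ifP => _; last by rewrite mul0e.
congr (_ * _); rewrite [RHS]integral_mkcond; apply: eq_integral => w _.
rewrite /ind /= patchE.
have [us|us] := boolP (u%:E < S w); first by rewrite mem_set// mule1.
by rewrite memNset ?mule0//; exact/negP.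
Qed.

End LayerCake.

(** * Exponential tails under a weight *)

Section TailLaw.
Context {R : realType}.
Context d (T : measurableType d) (P : probability T R).
Local Open Scope ereal_scope.
Variables (Phi S : T -> \bar R) (c q : R).
Hypotheses (mPhi : measurable_fun setT Phi) (Phi0 : forall w, 0 <= Phi w)
  (mS : measurable_fun setT S) (S0 : forall w, 0 < S w)
  (tail : forall u, (0 <= u)%R ->
     \int[P]_(w in [set w | u%:E < S w]) Phi w = (c * expR (- (q * u)))%:E).

Let S0' w : 0 <= S w. Proof. exact: ltW. Qed.

Lemma tail_total : \int[P]_w Phi w = c%:E.
Proof.
rewrite (_ : [set: T] = [set w | 0%:E < S w]); last first.
  by apply/seteqP; split => w //= _; exact: S0.
by rewrite tail// mulr0 oppr0 expR0 mulr1.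
Qed.

Let c0 : (0 <= c)%R.
Proof. by rewrite -lee_fin -tail_total; apply: integral_ge0 => w _. Qed.

Lemma mexpRN (a : R) : measurable_fun setT (fun u : R => expR (- (a * u)))%R.
Proof.
apply: continuous_measurable_fun => x; apply: continuous_comp; last exact: continuous_expR.
by apply: cvgN; apply: cvgMl_tmp; exact: cvg_id.
Qed.

Lemma tail_mean : (0 < q)%R -> \int[P]_w (Phi w * S w) = (c / q)%:E.
Proof.
move=> q0.
transitivity (\int[P]_w (Phi w *
    \int[lebesgue_measure]_(u in `[0%R, +oo[ `&` [set u | u%:E < S w]) (cst 1%R u)%:E)).
  by apply: eq_integral => w _; rewrite layer_id.
rewrite layer_cake//.
transitivity (\int[lebesgue_measure]_(u in `[0%R, +oo[) (c%:E * (expR (- (q * u)))%:E)).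
  apply: eq_integral => u; rewrite inE/= in_itv/= andbT => u0.
  by rewrite mul1e tail// EFinM.
rewrite ge0_integralZl//=; last by apply/measurable_EFinP; apply: measurable_funTS; exact: mexpRN.
by rewrite integral_expRN// -EFinM.
Qed.

Lemma laplace_ge0 (s : \bar R) : (0 <= laplace s)%R.
Proof. by case: s => [r| |] //=; exact: expR_ge0. Qed.

Lemma laplace_le1 (s : \bar R) : 0 <= s -> (laplace s <= 1)%R.
Proof. by case: s => [r| |] //= r0; rewrite expR_le1 oppr_le0 -lee_fin. Qed.

Lemma measurable_laplace : measurable_fun setT (fun w => laplace (S w)).
Proof.
rewrite (_ : (fun w => _) = (fun w => if S w == +oo then 0%R else expR (- fine (S w))%R)).
  apply: measurable_fun_ifT => //.
  - rewrite (_ : (fun w => S w == +oo) = (fun w => +oo <= S w)).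
      by apply: measurable_fun_lee.
    by apply/funext => w; rewrite leye_eq.
  - apply: measurableT_comp => //; apply: measurableT_comp => //.
    exact: measurableT_comp.
by apply/funext => w; have := S0' w; case: (S w).
Qed.

(** [1 - laplace S] is the integral of [e^(-u)] over [u < S], so the layer cake
    yields it from the tail; the case [q = 0] of an infinite S is included. *)
Lemma tail_laplace : (0 <= q)%R ->
  \int[P]_w (Phi w * (laplace (S w))%:E) = (c * (q / (q + 1)))%:E.
Proof.
move=> q0.
have mL : measurable_fun setT (fun w => (laplace (S w))%:E).
  by apply: measurableT_comp => //; exact: measurable_laplace.
have E : \int[P]_w (Phi w * (1 - (laplace (S w))%:E)) = (c / (q + 1))%:E.
  transitivity (\int[P]_w (Phi w *
    \int[lebesgue_measure]_(u in `[0%R, +oo[ `&` [set u | u%:E < S w]) (expR (- u))%:E)).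
    by apply: eq_integral => w _; rewrite layer_laplace.
  rewrite layer_cake//; last first.
    by have := mexpRN 1; under eq_fun do rewrite mul1r.
  transitivity (\int[lebesgue_measure]_(u in `[0%R, +oo[) (c%:E * (expR (- ((q + 1) * u)))%:E)).
    apply: eq_integral => u; rewrite inE/= in_itv/= andbT => u0.
    rewrite tail// -!EFinM; congr EFin.
    by rewrite mulrCA -expRD; congr (_ * expR _)%R; ring.
  rewrite ge0_integralZl//=; last by apply/measurable_EFinP; apply: measurable_funTS; exact: mexpRN.
  by rewrite integral_expRN ?ltr_wpDl// -EFinM.
have := tail_total.
have l1 w : 0 <= 1 - (laplace (S w))%:E.
  by rewrite -EFinB lee_fin subr_ge0 laplace_le1.
rewrite (_ : \int[P]_w Phi w = \int[P]_w (Phi w * (laplace (S w))%:E) +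
    \int[P]_w (Phi w * (1 - (laplace (S w))%:E))); last first.
  rewrite -ge0_integralD//.
  - apply: eq_integral => w _; rewrite -ge0_muleDr ?l1 ?lee_fin ?laplace_ge0//.
    by rewrite -EFinB -EFinD addrC subrK mule1.
  - by move=> w _; rewrite mule_ge0// lee_fin laplace_ge0.
  - exact: emeasurable_funM.
  - by move=> w _; rewrite mule_ge0.
  - by apply: emeasurable_funM => //; exact: emeasurable_funB.
rewrite E => h.
set I := integral _ _ _ in h *.
have -> : I = c%:E - (c / (q + 1))%:E by rewrite -h addeK.
rewrite -EFinB; congr EFin; field.
by rewrite gt_eqF// ltr_wpDl.
Qed.

End TailLaw.

(** * Sums over paths of the jump chain *)

Section PathSum.
Context {R : realType} {d} {T : measurableType d} (P : probability T R).
Local Open Scope ereal_scope.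
Variables (x : nat) (Y : nat -> T -> nat).
Hypothesis mY : forall n, measurable_fun [set: T] (Y n).

Definition prefix n (i : nat -> nat) : set T :=
  [set w | forall k, (k <= n)%N -> Y k w = i k].

Definition upd {A : Type} (f : nat -> A) n x := fun k => if k == n then x else f k.

(** The sum over the paths of length len started at time n, with a matrix that
    may depend on the step, written as a composition of operators. *)
Fixpoint pathsum (M : nat -> nat -> nat -> R) (n len : nat) (g : nat -> \bar R) :=
  if len is l.+1 then kop (M n) (pathsum M n.+1 l g) else g.

Lemma measurable_Y n (A : set nat) : measurable [set w | A (Y n w)].
Proof. by rewrite -[X in measurable X]setTI; apply: mY. Qed.

Lemma measurable_prefix n i : measurable (prefix n i).
Proof.
rewrite (_ : prefix n i = \bigcap_(k in `I_n.+1) [set w | [set i k] (Y k w)]).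
  apply: bigcap_measurable => [|k _]; first by exists 0%N.
  exact: measurable_Y.
by apply/seteqP; split => w h k /=; [move=> kn; apply: h|move=> kn; apply: h].
Qed.

Lemma prefix_split n i : prefix n i = \bigcup_j prefix n.+1 (upd i n.+1 j).
Proof.
apply/seteqP; split => [w h|w [j _ h] k kn].
  exists (Y n.+1 w) => // k kn; rewrite /upd; case: eqP => [->//|/eqP kn'].
  by apply: h; rewrite -ltnS ltn_neqAle kn'.
by have := h k (leqW kn); rewrite /upd ltn_eqF.
Qed.

Lemma trivIset_prefix n i : trivIset setT (fun j => prefix n (upd i n j)).
Proof.
apply/trivIsetP => j k _ _ jk; apply/seteqP; split => // w [hj hk].
have := hj n (leqnn n); have := hk n (leqnn n).
by rewrite /upd eqxx => -> kj; move: jk; rewrite kj eqxx.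
Qed.

Lemma prefix0_cover : [set: T] = \bigcup_j prefix 0%N (upd (fun=> 0%N) 0%N j).
Proof.
apply/seteqP; split => // w _; exists (Y 0%N w) => // k.
by rewrite leqn0 => /eqP ->; rewrite /upd eqxx.
Qed.

Variables (M : nat -> nat -> nat -> R) (N : nat) (g : nat -> \bar R) (Z : T -> \bar R).
Hypotheses (M_ge0 : forall n i j, (0 <= M n i j)%R) (g_ge0 : forall i, 0 <= g i)
  (mZ : measurable_fun setT Z) (Z_ge0 : forall w, 0 <= Z w)
  (Z_path : forall i, \int[P]_(w in prefix N i) Z w =
    ((i 0%N == x)%:R * \prod_(k < N) M k (i k) (i k.+1))%:E * g (i N)).

Lemma pathsum_ge0 n l i : 0 <= pathsum M n l g i.
Proof. by elim: l n i => [|l IH] n i //=; exact: kop_ge0. Qed.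

(** Backward induction from N: a cylinder is the disjoint union of its
    refinements by the next state. *)
Lemma integral_prefix l n i : (n + l)%N = N ->
  \int[P]_(w in prefix n i) Z w =
    ((i 0%N == x)%:R * \prod_(k < n) M k (i k) (i k.+1))%:E * pathsum M n l g (i n).
Proof.
elim: l n i => [|l IH] n i nl; first by rewrite -[n]addn0 nl Z_path.
rewrite prefix_split ge0_integral_bigcup//; last 3 first.
- by move=> j; exact: measurable_prefix.
- exact: measurable_funTS.
- exact: trivIset_prefix.
rewrite /= /kop -nneseriesZl; last first.
  by move=> j _; rewrite mule_ge0 ?lee_fin ?pathsum_ge0.
apply: eq_eseriesr => j _; rewrite IH; last by rewrite addSnnS.
rewrite big_ord_recr/= muleA -EFinM mulrA.
have un : upd i n.+1 j n = i n by rewrite /upd ltn_eqF.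
have uS : upd i n.+1 j n.+1 = j by rewrite /upd eqxx.
rewrite un uS.
congr ((_ * _ * _)%:E * _).
apply: eq_bigr => k _.
by rewrite /upd !ltn_eqF// ltnS// ltnW.
Qed.

Lemma integral_pathsum : \int[P]_w Z w = pathsum M 0 N g x.
Proof.
rewrite prefix0_cover ge0_integral_bigcup//; last 3 first.
- by move=> j; exact: measurable_prefix.
- exact: measurable_funTS.
- exact: trivIset_prefix.
rewrite (@nneseriesD1 _ _ x xpredT)//; last by move=> k _; apply: integral_ge0 => w _.
rewrite eseries0 ?adde0; last first.
  move=> k _ kx; rewrite (@integral_prefix N)// big_ord0 mulr1 /upd eqxx.
  by rewrite (negbTE kx) mul0e.
by rewrite (@integral_prefix N)// big_ord0 mulr1 /upd eqxx eqxx mul1e.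
Qed.

End PathSum.

Lemma pathsum_iter {R : realType} (M : nat -> nat -> nat -> R) (K : nat -> nat -> R)
  n l g : (forall k, (n <= k < n + l)%N -> M k = K) ->
  pathsum M n l g = iter l (kop K) g.
Proof.
elim: l n => [|l IH] n h //=.
rewrite h ?leqnn ?addnS ?ltnS ?leq_addr// IH// => k /andP[nk kl].
by apply: h; rewrite (ltnW nk) addnS -addSn.
Qed.

Lemma pathsum_cat {R : realType} (M : nat -> nat -> nat -> R) n l l' g :
  pathsum M n (l + l') g = pathsum M n l (pathsum M (n + l) l' g).
Proof.
elim: l n => [|l IH] n; first by rewrite addn0.
by rewrite addSn /= IH addSnnS.
Qed.

Section ChainLaw.
Context {R : realType} {d} {T : measurableType d} (P : probability T R).
Local Open Scope ereal_scope.
Variables (Q : nat -> nat -> R) (x : nat) (Y : nat -> T -> nat) (S : nat -> T -> \bar R).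
Notation q := (exit_rate Q).
Notation J := (jump_prob Q).
Hypotheses (q_ge0 : forall i, (0 <= q i)%R) (J_ge0 : forall i j, (0 <= J i j)%R).
Hypotheses (mY : forall n, measurable_fun [set: T] (Y n))
  (mS : forall n, measurable_fun [set: T] (S n)) (S0 : forall n w, 0 < S n w)
  (law : forall (n : nat) (i : nat -> nat) (t : nat -> R),
     (forall k, 0 <= t k)%R ->
     P [set w | forall k, (k <= n)%N -> Y k w = i k /\ (t k)%:E < S k w]
     = ((i 0%N == x)%:R * \prod_(k < n) J (i k) (i k.+1)
        * \prod_(k < n.+1) expR (- (q (i k) * t k)))%:E).
Notation prefix := (prefix Y).

Definition weight n (i : nat -> nat) : R := ((i 0%N == x)%:R * \prod_(k < n) J (i k) (i k.+1))%R.

Definition timed n (i : nat -> nat) (t : nat -> R) : set T :=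
  [set w | forall k, (k <= n)%N -> Y k w = i k /\ (t k)%:E < S k w].

Lemma timed0 n i : timed n i (fun=> 0%R) = prefix n i.
Proof.
by apply/seteqP; split => w h k kn; [have [] := h k kn|split; [exact: h|exact: S0]].
Qed.

Lemma measurable_exceed k (u : R) : measurable [set w | u%:E < S k w].
Proof.
rewrite -[X in measurable X]setTI; apply: measurable_lte => //.
Qed.

Lemma measurable_timed n i t : measurable (timed n i t).
Proof.
rewrite (_ : timed n i t = \bigcap_(k in `I_n.+1)
    ([set w | [set i k] (Y k w)] `&` [set w | (t k)%:E < S k w])).
  apply: bigcap_measurable => [|k _]; first by exists 0%N.
  apply: measurableI; first exact: measurable_Y.
  exact: measurable_exceed.
by apply/seteqP; split => w h k /= kn; have := h k kn.
Qed.

Lemma timed_upd n i t j u : (j <= n)%N -> t j = 0%R -> (0 <= u)%R ->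
  timed n i t `&` [set w | u%:E < S j w] = timed n i (upd t j u).
Proof.
move=> jn tj u0; apply/seteqP; split => w.
  move=> [h hu] k kn; have [? ?] := h k kn; rewrite /upd.
  by case: eqP => [kj|_]; split => //; rewrite kj.
move=> h; split.
  move=> k kn; have := h k kn; rewrite /upd; case: eqP => [kj|//] [? _].
  by split => //; rewrite kj tj.
by have := h j jn; rewrite /upd eqxx => -[].
Qed.

Lemma prod_upd n (i : nat -> nat) t j u : (j <= n)%N -> t j = 0%R ->
  (\prod_(k < n.+1) expR (- (q (i k) * upd t j u k)) =
   \prod_(k < n.+1) expR (- (q (i k) * t k)) * expR (- (q (i j) * u)))%R.
Proof.
move=> jn tj; have jn' : (j < n.+1)%N by [].
rewrite (bigD1 (Ordinal jn'))//= [in RHS](bigD1 (Ordinal jn'))//=.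
rewrite /upd eqxx tj mulr0 oppr0 expR0 mul1r mulrC; congr (_ * _)%R.
apply: eq_bigr => k kj; suff -> : (nat_of_ord k == j) = false by [].
by apply/negbTE; apply: contra kj => /eqP kj; apply/eqP/val_inj.
Qed.

Lemma ind_mul_integral (A B : set T) (f : T -> \bar R) : measurable A -> measurable B ->
  (forall w, 0 <= f w) ->
  \int[P]_(w in B) ((\1_A w)%:E * f w) = \int[P]_(w in A `&` B) f w.
Proof.
move=> mA mB f0; rewrite setIC integral_mkcondr; apply: eq_integral => w _.
by rewrite indicE patchE; case: (w \in A); rewrite ?mul1e ?mul0e.
Qed.

Lemma prefix_tail n i j u : (j <= n)%N -> (0 <= u)%R ->
  \int[P]_(w in [set w | u%:E < S j w]) (\1_(prefix n i) w)%:E =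
  (weight n i * expR (- (q (i j) * u)))%:E.
Proof.
move=> jn u0.
have mB := measurable_exceed j u.
rewrite -[LHS](_ : \int[P]_(w in [set w | u%:E < S j w]) ((\1_(prefix n i) w)%:E * 1) = _).
  rewrite ind_mul_integral//; last exact: measurable_prefix.
  rewrite -timed0 timed_upd// integral_cst//; last exact: measurable_timed.
  rewrite mul1e; apply: etrans (law n i _) _ => [k|]; first by rewrite /upd; case: eqP.
  rewrite prod_upd// [X in (_ * (X * _))%R]big1 ?mul1r//.
  by move=> k _; rewrite mulr0 oppr0 expR0.
by apply: eq_integral => w _; rewrite mule1.
Qed.

Lemma prefix_mean n i j : (j <= n)%N -> (0 < q (i j))%R ->
  \int[P]_(w in prefix n i) S j w = (weight n i / q (i j))%:E.
Proof.
move=> jn q0.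
rewrite -(@tail_mean _ _ _ P (fun w => (\1_(prefix n i) w)%:E) (S j) _ (q (i j)))//.
- rewrite ind_mul_integral ?setIT//; first exact: measurable_prefix.
  by move=> w; exact: ltW.
- by apply/measurable_EFinP; apply: measurable_indic; exact: measurable_prefix.
- by move=> u u0; exact: prefix_tail.
Qed.

Lemma prefix_laplace n i j : (j <= n)%N ->
  \int[P]_(w in prefix n i) (laplace (S j w))%:E =
  (weight n i * (q (i j) / (q (i j) + 1)))%:E.
Proof.
move=> jn.
rewrite -(@tail_laplace _ _ _ P (fun w => (\1_(prefix n i) w)%:E) (S j) _ (q (i j)))//.
- rewrite ind_mul_integral ?setIT//; first exact: measurable_prefix.
  by move=> w; rewrite lee_fin laplace_ge0.
- by apply/measurable_EFinP; apply: measurable_indic; exact: measurable_prefix.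
- by move=> u u0; exact: prefix_tail.
Qed.

Definition discount j (w : T) : R := (\prod_(k < j) laplace (S k w))%R.

Lemma discount_ge0 j w : (0 <= discount j w)%R.
Proof. by apply: prodr_ge0 => k _; exact: laplace_ge0. Qed.

Lemma measurable_discount j : measurable_fun setT (discount j).
Proof.
elim: j => [|j IH].
  by rewrite /discount (_ : (fun w => _) = cst 1%R)//; apply/funext => w; rewrite big_ord0.
rewrite (_ : discount j.+1 = discount j \* (fun w => laplace (S j w)))%R.
  by apply: measurable_funM => //; exact: measurable_laplace.
by apply/funext => w; rewrite /discount big_ord_recr.
Qed.

(** Induction on the number of Laplace factors: [tail_laplace] trades the last
    factor for a tail of the same holding time, that is, for a positive value of
    the corresponding coordinate of t. *)
Lemma timed_discount n i j t : (j <= n.+1)%N -> (forall k, 0 <= t k)%R ->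
  (forall k, (k < j)%N -> t k = 0%R) ->
  \int[P]_(w in timed n i t) (discount j w)%:E =
  (weight n i * \prod_(k < j) (q (i k) / (q (i k) + 1))
    * \prod_(k < n.+1) expR (- (q (i k) * t k)))%:E.
Proof.
elim: j t => [|j IH] t jn t0 tj.
  rewrite (eq_integral (cst 1)); last by move=> w _; rewrite /discount big_ord0.
  rewrite integral_cst; last exact: measurable_timed.
  by rewrite mul1e; apply: etrans (law n i t0) _; rewrite big_ord0 mulr1.
have tjj : t j = 0%R by exact: tj.
have mt := measurable_timed n i t.
pose Phi w := (\1_(timed n i t) w)%:E * (discount j w)%:E.
transitivity (\int[P]_w (Phi w * (laplace (S j w))%:E)).
  rewrite /Phi; under [RHS]eq_integral do rewrite -muleA.
  rewrite ind_mul_integral// ?setIT//; last first.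
    by move=> w; rewrite -EFinM lee_fin mulr_ge0 ?discount_ge0 ?laplace_ge0.
  by apply: eq_integral => w _; rewrite /discount big_ord_recr.
rewrite (@tail_laplace _ _ _ P Phi (S j)
  (weight n i * \prod_(k < j) (q (i k) / (q (i k) + 1))
    * \prod_(k < n.+1) expR (- (q (i k) * t k)))%R (q (i j)))//.
- by rewrite [in RHS]big_ord_recr/=; congr EFin; ring.
- by apply: emeasurable_funM; apply/measurable_EFinP;
    [exact: measurable_indic|exact: measurable_discount].
- by move=> w; rewrite /Phi -EFinM lee_fin mulr_ge0// discount_ge0.
move=> u u0; rewrite ind_mul_integral//; last first.
- by move=> w; rewrite lee_fin discount_ge0.
- exact: measurable_exceed.
rewrite timed_upd// IH.
- by rewrite prod_upd// mulrA.
- exact: ltnW.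
- by move=> k; rewrite /upd; case: eqP.
- move=> k kj; rewrite /upd ltn_eqF//; apply: tj; exact: ltnW.
Qed.

Lemma prefix_discount n i j : (j <= n.+1)%N ->
  \int[P]_(w in prefix n i) (discount j w)%:E =
  (weight n i * \prod_(k < j) (q (i k) / (q (i k) + 1)))%:E.
Proof.
move=> jn; rewrite -timed0 timed_discount// [X in (_ * X)%R]big1 ?mulr1//.
by move=> k _; rewrite mulr0 oppr0 expR0.
Qed.

End ChainLaw.

(** * Expectations along the chain *)

Section Functionals.
Context {R : realType} {d} {T : measurableType d} (P : probability T R).
Local Open Scope ereal_scope.
Variables (Q : nat -> nat -> R) (x : nat) (Y : nat -> T -> nat) (S : nat -> T -> \bar R).
Notation q := (exit_rate Q).
Notation J := (jump_prob Q).
Hypotheses (q_ge0 : forall i, (0 <= q i)%R) (J_ge0 : forall i j, (0 <= J i j)%R).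
Hypotheses (mY : forall n, measurable_fun [set: T] (Y n))
  (mS : forall n, measurable_fun [set: T] (S n)) (S0 : forall n w, 0 < S n w)
  (law : forall (n : nat) (i : nat -> nat) (t : nat -> R),
     (forall k, 0 <= t k)%R ->
     P [set w | forall k, (k <= n)%N -> Y k w = i k /\ (t k)%:E < S k w]
     = ((i 0%N == x)%:R * \prod_(k < n) J (i k) (i k.+1)
        * \prod_(k < n.+1) expR (- (q (i k) * t k)))%:E).
Notation prefix := (prefix Y).
Variable a : nat.
Hypothesis q_gt0 : forall i, (a < i)%N -> (0 < q i)%R.

Definition kill (i j : nat) : R := if (a < i)%N then J i j else 0%R.
(** The mean holding time above a. *)
Definition hold (i : nat) : \bar R := if (a < i)%N then (q i)^-1%:E else 0.
Definition alive k : set T := [set w | forall l, (l <= k)%N -> (a < Y l w)%N].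

Lemma kill_ge0 i j : (0 <= kill i j)%R.
Proof. by rewrite /kill; case: ifP. Qed.

Lemma hold_ge0 i : 0 <= hold i.
Proof. by rewrite /hold; case: ifP => // ai; rewrite lee_fin invr_ge0. Qed.

Lemma measurable_alive k : measurable (alive k).
Proof.
rewrite (_ : alive k = \bigcap_(l in `I_k.+1) [set w | [set n | (a < n)%N] (Y l w)]).
  apply: bigcap_measurable => [|l _]; first by exists 0%N.
  exact: measurable_Y.
by apply/seteqP; split => w h l /=; [move=> kn; apply: h|move=> kn; apply: h].
Qed.

Lemma prod_if (b : nat -> bool) n (f : nat -> R) :
  (\prod_(k < n) (if b k then f k else 0) =
   (if all b (iota 0 n) then \prod_(k < n) f k else 0))%R.
Proof.
elim: n => [|n IH]; first by rewrite !big_ord0.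
have -> : all b (iota 0 n.+1) = all b (iota 0 n) && b n.
  by rewrite -addn1 iotaD all_cat /= add0n andbT.
rewrite big_ord_recr IH [in RHS]big_ord_recr/=.
by case: (all b (iota 0 n)); case: (b n); rewrite ?mul0r ?mulr0.
Qed.

Lemma all_iotaP (b : nat -> bool) n :
  all b (iota 0 n) = true <-> (forall k, (k < n)%N -> b k).
Proof.
split=> [/allP h k kn|h]; first by apply: h; rewrite mem_iota.
by apply/allP => k; rewrite mem_iota => /andP[_]; exact: h.
Qed.

(** The chain is alive at step k when k killed jumps have been made, and then the
    mean holding time is the inverse of the rate. *)
Lemma integral_alive k :
  \int[P]_(w in alive k) S k w = iter k (kop kill) hold x.
Proof.
have mA := measurable_alive k.
transitivity (\int[P]_w ((\1_(alive k) w)%:E * S k w)).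
  by rewrite ind_mul_integral ?setIT// => w; exact: ltW.
rewrite -(@pathsum_iter _ (fun=> kill) kill 0%N)//.
apply: integral_pathsum => //.
- by move=> ? ? ?; exact: kill_ge0.
- exact: hold_ge0.
- by apply: emeasurable_funM => //; apply/measurable_EFinP; exact: measurable_indic.
- by move=> w; rewrite mule_ge0 ?lee_fin// ltW.
move=> i; rewrite ind_mul_integral//; [|exact: measurable_prefix|by move=> w; exact: ltW].
rewrite /kill (prod_if (fun l => (a < i l)%N) _ (fun l => J (i l) (i l.+1))).
have [h|h] := boolP (all (fun k => (a < i k)%N) (iota 0 k)); last first.
  rewrite mulr0 mul0e (_ : _ `&` _ = set0) ?integral_set0//.
  apply/seteqP; split => // w [hw pw]; move: h; apply/negP; rewrite negbK.
  by apply/all_iotaP => l lk; rewrite -(pw l (ltnW lk)); apply: hw; exact: ltnW.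
rewrite /hold; case: ifPn => ai; last first.
  rewrite mule0 (_ : _ `&` _ = set0) ?integral_set0//.
  apply/seteqP; split => // w [hw pw]; move: ai; apply/negP; rewrite negbK.
  by rewrite -(pw k (leqnn k)); apply: hw.
rewrite (_ : _ `&` _ = prefix k i); last first.
  apply/seteqP; split => [w []//|w pw]; split => // l lk; rewrite pw//.
  move: lk; rewrite leq_eqVlt => /orP[/eqP ->//|lk].
  by move/all_iotaP: h; apply.
by rewrite (prefix_mean mY mS S0 law)//; exact: q_gt0.
Qed.

(** The holding time of step k only changes the weight of the k-th jump by the
    factor [1 / q]; after it come [m + 1] killed jumps that end at or below a. *)
Lemma integral_alive_hit k m :
  \int[P]_(w in alive (k + m) `&` [set w | (Y (k + m).+1 w <= a)%N]) S k w =
  iter k (kop kill) (fun i => hold i *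
    iter m.+1 (kop kill) (fun j => (j <= a)%N%:R%:E) i) x.
Proof.
have mA := measurable_alive (k + m).
have mB : measurable [set w | (Y (k + m).+1 w <= a)%N].
  exact: (measurable_Y mY (k + m).+1 [set n | (n <= a)%N]).
set A := _ `&` _; have mAB : measurable A by exact: measurableI.
(* the k-th jump carries the mean of the k-th holding time *)
pose M l i j : R := if l == k then (kill i j / q i)%R else kill i j.
pose g (j : nat) : \bar R := (j <= a)%N%:R%:E.
have g0 j : 0 <= g j by rewrite lee_fin ler0n.
have M0 l i j : (0 <= M l i j)%R.
  by rewrite /M; case: eqP => _; rewrite ?divr_ge0 ?kill_ge0.
transitivity (\int[P]_w ((\1_A w)%:E * S k w)).
  by rewrite ind_mul_integral ?setIT// => w; exact: ltW.
transitivity (pathsum M 0%N (k + m.+1) g x); last first.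
  rewrite pathsum_cat (@pathsum_iter _ M kill); last first.
    move=> l /andP[_]; rewrite add0n => lk.
    by apply/funext => i; apply/funext => j; rewrite /M ltn_eqF.
  apply: eq_iter_kop => i; rewrite add0n /= (@pathsum_iter _ M kill k.+1); last first.
    move=> l /andP[kl _].
    by apply/funext => ?; apply/funext => ?; rewrite /M gtn_eqF.
  rewrite {1}/kop /hold; case: ifPn => ai; last first.
    rewrite mul0e eseries0// => j _ _.
    by rewrite /M eqxx /kill (negbTE ai) mul0r mul0e.
  rewrite /kop -nneseriesZl; last first.
    by move=> j _; rewrite mule_ge0 ?lee_fin ?kill_ge0 ?iter_kop_ge0//; exact: kill_ge0.
  apply: eq_eseriesr => j _; rewrite muleA -EFinM /M eqxx; congr (_%:E * _).
  by rewrite mulrC.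
apply: integral_pathsum => //.
- by apply: emeasurable_funM => //; apply/measurable_EFinP; exact: measurable_indic.
- by move=> w; rewrite mule_ge0 ?lee_fin// ltW.
move=> i; rewrite ind_mul_integral//; [|exact: measurable_prefix|by move=> w; exact: ltW].
have kn : (k < k + m.+1)%N by rewrite -addSnnS leq_addr.
have -> : (\prod_(l < k + m.+1) M l (i l) (i l.+1) =
    (\prod_(l < k + m.+1) kill (i l) (i l.+1)) / q (i k))%R.
  rewrite (bigD1 (Ordinal kn))//= [X in _ = (X / _)%R](bigD1 (Ordinal kn))//=.
  rewrite {1}/M eqxx mulrAC; congr (_ * _ / _)%R; apply: eq_bigr => l lk.
  rewrite /M; suff -> : (nat_of_ord l == k) = false by [].
  by apply/negbTE; apply: contra lk => /eqP lk; apply/eqP/val_inj.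
rewrite /kill (prod_if (fun l => (a < i l)%N) _ (fun l => J (i l) (i l.+1))) addnS.
have [h|h] := boolP (all (fun k => (a < i k)%N) (iota 0 (k + m).+1)); last first.
  rewrite mul0r mulr0 mul0e (_ : _ `&` _ = set0) ?integral_set0//.
  apply/seteqP; split => // w [[hw _] pw]; move: h; apply/negP; rewrite negbK.
  by apply/all_iotaP => l lk; rewrite -(pw l (ltnW lk)); apply: hw; rewrite -ltnS.
rewrite /g; have [ia|ia] := boolP (i (k + m).+1 <= a)%N; last first.
  rewrite mule0 (_ : _ `&` _ = set0) ?integral_set0//.
  apply/seteqP; split => // w [[_ hw] pw]; move: ia; apply/negP; rewrite negbK.
  by rewrite -(pw _ (leqnn _)).
rewrite mule1 (_ : _ `&` _ = prefix (k + m).+1 i); last first.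
  apply/seteqP; split => [w []//|w pw]; split => //; split.
    move=> l lk; rewrite pw ?(leq_trans lk)//.
    by move/all_iotaP: h; apply.
  by rewrite /= pw.
rewrite (prefix_mean mY mS S0 law).
- by rewrite mulrA.
- by rewrite (leq_trans (leq_addr m k)).
- by apply: q_gt0; move/all_iotaP: h; apply; rewrite ltnS leq_addr.
Qed.

(** For an exponential time of rate q, [q / (q + 1)] is the mean of [e^(-S)]. *)
Definition discounted i j : R := (J i j * (q i / (q i + 1)))%R.

Lemma discounted_ge0 i j : (0 <= discounted i j)%R.
Proof. by rewrite mulr_ge0// divr_ge0// addr_ge0. Qed.

Lemma integral_discount N :
  \int[P]_w (discount S N w)%:E = iter N (kop discounted) (cst 1) x.
Proof.
rewrite -(@pathsum_iter _ (fun=> discounted) discounted 0%N)//.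
apply: integral_pathsum => //.
- by move=> ? ? ?; exact: discounted_ge0.
- by apply/measurable_EFinP; exact: measurable_discount.
- by move=> w; rewrite lee_fin discount_ge0.
move=> i; rewrite (prefix_discount q_ge0 mY mS S0 law)// mule1 /weight -mulrA.
by rewrite -big_split.
Qed.

Lemma integral_laplace_absorbed n i : q i = 0%R ->
  \int[P]_(w in [set w | Y n w = i]) (laplace (S n w))%:E = 0.
Proof.
move=> qi.
have mB : measurable [set w | Y n w = i] := measurable_Y mY n [set i].
transitivity (\int[P]_w ((\1_[set w | Y n w = i] w)%:E * (laplace (S n w))%:E)).
  by rewrite ind_mul_integral ?setIT// => w; rewrite lee_fin laplace_ge0.
have -> : 0 = pathsum (fun=> J) 0%N n (cst 0) x.
  rewrite (@pathsum_iter _ (fun=> J) J 0%N)//.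
  have -> // : iter n (kop J) (cst 0) = cst 0.
  elim: n {mB} => //= n ->; apply/funext => k; rewrite /kop eseries0// => j _ _.
  by rewrite mule0.
apply: integral_pathsum => //.
- apply: emeasurable_funM; apply/measurable_EFinP; first exact: measurable_indic.
  exact: measurable_laplace.
- by move=> w; rewrite -EFinM lee_fin mulr_ge0// laplace_ge0.
move=> j; rewrite mule0 ind_mul_integral//; last 2 first.
- exact: measurable_prefix.
- by move=> w; rewrite lee_fin laplace_ge0.
have [jn|jn] := eqVneq (j n) i; last first.
  rewrite (_ : _ `&` _ = set0) ?integral_set0//.
  apply/seteqP; split => // w [hw pw]; move: jn; apply/negP; rewrite negbK.
  by rewrite -(pw n (leqnn n)); apply/eqP.
rewrite (_ : _ `&` _ = prefix n j); last first.
  by apply/seteqP; split => [w []//|w pw]; split => //=; rewrite pw.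
by rewrite (prefix_laplace q_ge0 mY mS S0 law)// jn qi mul0r mulr0.
Qed.

End Functionals.

(** * Pathwise description of the lifetime and of the hitting times *)

Section Paths.
Context {R : realType} {d} {T : measurableType d}.
Local Open Scope ereal_scope.
Variables (X : R -> T -> option nat) (Y : nat -> T -> nat) (S : nat -> T -> \bar R).
Hypotheses (S0 : forall n w, 0 < S n w)
  (Xjump : forall (t : R) (w : T) (n : nat), (0 <= t)%R ->
     jump_time S n w <= t%:E -> t%:E < jump_time S n.+1 w -> X t w = Some (Y n w))
  (Xend : forall (t : R) (w : T), (0 <= t)%R ->
     (forall n, jump_time S n w <= t%:E) -> X t w = None).

Lemma jump_timeS n w : jump_time S n.+1 w = jump_time S n w + S n w.
Proof. by rewrite /jump_time big_ord_recr. Qed.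

Lemma jump_time_le m n w : (m <= n)%N -> jump_time S m w <= jump_time S n w.
Proof.
move=> /subnK <-; elim: (n - m)%N => //= k IH.
by rewrite addSn jump_timeS (le_trans IH)// leeDl// ltW.
Qed.

Definition total_time w : \bar R := \sum_(k <oo) S k w.

Lemma jump_time_total n w : jump_time S n w <= total_time w.
Proof.
rewrite /jump_time -(big_mkord xpredT (fun k => S k w)).
by apply: nneseries_lim_ge => k _ _; exact: ltW.
Qed.

Lemma total_time_gt0 w : 0 < total_time w.
Proof.
apply: lt_le_trans (jump_time_total 1 w); rewrite /jump_time big_ord1; exact: S0.
Qed.

Lemma find_jump (t : R) w : (0 <= t)%R -> t%:E < total_time w ->
  exists2 n, jump_time S n w <= t%:E & t%:E < jump_time S n.+1 w.
Proof.
move=> t0 tz.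
have ex : exists n, t%:E < jump_time S n w.
  apply/not_existsP => h; move: tz; rewrite ltNge => /negP; apply.
  apply: lime_le.
    by apply: is_cvg_nneseries => k _ _; exact: ltW.
  apply: nearW => n; rewrite big_mkord leNgt; apply/negP; exact: h.
case: (ex_minnP ex) => -[|n] h hmin.
  by move: h; rewrite /jump_time big_ord0 lte_fin ltNge t0.
by exists n => //; rewrite leNgt; apply/negP => /hmin; rewrite ltnn.
Qed.

Lemma lifetimeE w : lifetime X w = total_time w.
Proof.
apply/eqP; rewrite eq_le; apply/andP; split; last first.
  apply: le_ereal_inf_tmp => _ [t [t0 Xt] <-]; rewrite leNgt; apply/negP => tz.
  by have [n h1 h2] := find_jump t0 tz; rewrite (Xjump t0 h1 h2) in Xt.
have z0 := total_time_gt0 w.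
have [zy|zy] := eqVneq (total_time w) +oo; first by rewrite zy leey.
have zf : total_time w \is a fin_num by rewrite ge0_fin_numE 1?ltW// lt_neqAle zy leey.
apply: ereal_inf_lbound; exists (fine (total_time w)); last by rewrite fineK.
have f0 : (0 <= fine (total_time w))%R by rewrite fine_ge0// ltW.
split => //; apply: Xend => // n; rewrite fineK//; exact: jump_time_total.
Qed.

Variable a : nat.
Notation alive := (alive Y a).

Definition exit_time w : \bar R := \sum_(k <oo) (\1_(alive k) w)%:E * S k w.

Definition hits : set T := [set w | exists n, (Y n w <= a)%N].

Lemma alive_before w n : (Y n w <= a)%N -> (forall m, (Y m w <= a)%N -> (n <= m)%N) ->
  forall k, alive k w <-> (k < n)%N.
Proof.
move=> hn hmin k; split=> [h|kn l lk].
  rewrite ltnNge; apply/negP => nk; have := h n nk; by rewrite ltnNge hn.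
rewrite ltnNge; apply/negP => /hmin; rewrite leqNgt => /negP; apply.
exact: leq_ltn_trans lk kn.
Qed.

(** Before the first visit n the indicators are all 1, and from n on all 0. *)
Lemma exit_time_hit w n : (Y n w <= a)%N -> (forall m, (Y m w <= a)%N -> (n <= m)%N) ->
  exit_time w = jump_time S n w.
Proof.
move=> hn hmin; have al := alive_before hn hmin.
rewrite /exit_time (@nneseries_split _ _ 0%N n); last first.
  by move=> k _; rewrite mule_ge0 ?lee_fin// ltW.
rewrite add0n [X in _ + X]eseries0 ?adde0; last first.
  move=> k nk _; rewrite indicE memNset ?mul0e// => /al; by rewrite ltnNge nk.
rewrite big_mkord /jump_time; apply: eq_bigr => k _.
by rewrite indicE mem_set ?mul1e//; apply/al.
Qed.

Lemma exit_time_never w : ~ hits w -> exit_time w = total_time w.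
Proof.
move=> h; apply: eq_eseriesr => k _; rewrite indicE mem_set ?mul1e//.
by move=> l _; rewrite ltnNge; apply/negP => ?; apply: h; exists l.
Qed.

Lemma hit_below_hits w : hits w -> hit_below a X w = exit_time w.
Proof.
move=> ex; case: (ex_minnP ex) => n hn hmin.
rewrite (exit_time_hit hn hmin); apply/eqP; rewrite eq_le; apply/andP; split; last first.
  apply: le_ereal_inf_tmp => _ [t [t0 tz [m Xt ma]] <-].
  move: tz; rewrite lifetimeE => tz; have [l h1 h2] := find_jump t0 tz.
  rewrite (Xjump t0 h1 h2) in Xt; case: Xt ma => <- /hmin nl.
  exact: le_trans (jump_time_le w nl) h1.
have j0 : 0 <= jump_time S n w by apply: sume_ge0 => k _; exact: ltW.
have [zy|zy] := eqVneq (jump_time S n w) +oo; first by rewrite zy leey.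
have zf : jump_time S n w \is a fin_num by rewrite ge0_fin_numE// lt_neqAle zy leey.
apply: ereal_inf_lbound; exists (fine (jump_time S n w)); last by rewrite fineK.
have f0 : (0 <= fine (jump_time S n w))%R by rewrite fine_ge0.
have lt : jump_time S n w < jump_time S n.+1 w by rewrite jump_timeS lteDl.
split => //; first by rewrite lifetimeE fineK// (lt_le_trans lt)// jump_time_total.
by exists (Y n w) => //; apply: Xjump; rewrite ?fineK.
Qed.

Lemma hit_below_never w : ~ hits w -> hit_below a X w = +oo.
Proof.
move=> h; rewrite /hit_below (_ : [set _ | _ in _] = set0) ?ereal_inf0//.
apply/seteqP; split => // y [t [t0 tz [m Xt ma]] ty] /=.
move: tz; rewrite lifetimeE => tz; have [l h1 h2] := find_jump t0 tz.
rewrite (Xjump t0 h1 h2) in Xt; case: Xt ma => <- la.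
by apply: h; exists l.
Qed.

Lemma exit_time_le w : exit_time w <= total_time w.
Proof.
apply: lee_nneseries => [k _ _|k _]; first by rewrite mule_ge0 ?lee_fin// ltW.
rewrite -[leRHS]mul1e; apply: lee_wpmul2r; [exact: ltW|by rewrite lee_fin indicE lern1 leq_b1].
Qed.

(** The hitting time is smaller than the lifetime on the paths that hit, since
    holding times are positive, and it is infinite on the others, where the
    whole lifetime is spent above a. *)
Lemma min_exit_time w : Order.min (lifetime X w) (hit_below a X w) = exit_time w.
Proof.
have [h|h] := pselect (hits w).
  by rewrite hit_below_hits// lifetimeE min_r// exit_time_le.
by rewrite hit_below_never// exit_time_never// lifetimeE min_l// leey.
Qed.

End Paths.

(** * Mean exit time, mean hitting time and mean lifetime *)

Section Expectations.
Context {R : realType} {d} {T : measurableType d} (P : probability T R).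
Local Open Scope ereal_scope.
Variables (Q : nat -> nat -> R) (x : nat) (X : R -> T -> option nat).
Variables (Y : nat -> T -> nat) (S : nat -> T -> \bar R).
Notation q := (exit_rate Q).
Notation J := (jump_prob Q).
Hypotheses (q_ge0 : forall i, (0 <= q i)%R) (J_ge0 : forall i j, (0 <= J i j)%R).
Hypotheses (mY : forall n, measurable_fun [set: T] (Y n))
  (mS : forall n, measurable_fun [set: T] (S n)) (S0 : forall n w, 0 < S n w)
  (law : forall (n : nat) (i : nat -> nat) (t : nat -> R),
     (forall k, 0 <= t k)%R ->
     P [set w | forall k, (k <= n)%N -> Y k w = i k /\ (t k)%:E < S k w]
     = ((i 0%N == x)%:R * \prod_(k < n) J (i k) (i k.+1)
        * \prod_(k < n.+1) expR (- (q (i k) * t k)))%:E)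
  (Xjump : forall (t : R) (w : T) (n : nat), (0 <= t)%R ->
     jump_time S n w <= t%:E -> t%:E < jump_time S n.+1 w -> X t w = Some (Y n w))
  (Xend : forall (t : R) (w : T), (0 <= t)%R ->
     (forall n, jump_time S n w <= t%:E) -> X t w = None).

Let S0' n w : 0 <= S n w. Proof. exact: ltW. Qed.

Lemma measurable_total_time : measurable_fun setT (total_time S).
Proof. by apply: ge0_emeasurable_sum => // k w _ _; exact: S0'. Qed.

(** On the event that the lifetime is at most n, the discount is at least
    [e^(-n)] at every step, so the probability of the event is at most [e^n]
    times the means of the discounts, which tend to 0. *)
Lemma never_explodes :
  iter N (kop (discounted Q)) (cst 1) x @[N --> \oo] --> 0 ->
  P [set w | lifetime X w < +oo] = 0.
Proof.
move=> cv.
have lE w : lifetime X w = total_time S w by exact: (lifetimeE S0 Xjump Xend).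
have mB (r : R) : measurable [set w | total_time S w <= r%:E].
  by rewrite -[X in measurable X]setTI; apply: measurable_lee => //; exact: measurable_total_time.
have Bn (n : nat) : P [set w | total_time S w <= n%:R%:E] = 0.
  have bound N : (expR (- n%:R))%:E * P [set w | total_time S w <= n%:R%:E] <=
      iter N (kop (discounted Q)) (cst 1) x.
    rewrite -(integral_discount q_ge0 J_ge0 mY mS S0 law).
    rewrite -integral_cst//.
    apply: (@le_trans _ _ (\int[P]_(w in [set w | total_time S w <= n%:R%:E])
        (discount S N w)%:E)).
      apply: ge0_le_integral => //.
      - by move=> w _; rewrite lee_fin expR_ge0.
      - by apply: measurable_funTS; apply/measurable_EFinP; exact: measurable_discount.
      move=> w /= wn; rewrite lee_fin.
      have jN : jump_time S N w <= n%:R%:E by exact: le_trans (jump_time_total S0 N w) wn.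
      have fS k : (k < N)%N -> S k w \is a fin_num.
        move=> kN; rewrite ge0_fin_numE//.
        apply: (@le_lt_trans _ _ (jump_time S N w)); last exact: le_lt_trans jN (ltry _).
        rewrite (le_trans _ (jump_time_le S0 w kN))// jump_timeS leeDr//.
        by apply: sume_ge0.
      have -> : discount S N w = expR (- fine (jump_time S N w)).
        rewrite /discount /jump_time.
        elim: N fS {jN} => [|N IH] fS; first by rewrite !big_ord0 oppr0 expR0.
        rewrite !big_ord_recr/= IH; last by move=> k kN; apply: fS; exact: ltnW.
        rewrite fineD ?fS//; last first.
          by apply/sum_fin_numP => k _ _; apply: fS; exact: ltnW (ltn_ord k).
        by rewrite opprD expRD; congr (_ * _)%R; rewrite -[in LHS](fineK (fS N (ltnSn N))).
      by rewrite ler_expR lerN2 -lee_fin fineK// ge0_fin_numE ?(le_lt_trans jN) ?ltry// sume_ge0.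
    apply: ge0_subset_integral => //.
    - by apply/measurable_EFinP; exact: measurable_discount.
    - by move=> w _; rewrite lee_fin discount_ge0.
  have : (expR (- n%:R))%:E * P [set w | total_time S w <= n%:R%:E] <= 0.
    by apply: cvge_ge cv; exact: nearW.
  by rewrite pmule_rle0 ?lte_fin ?expR_gt0// measure_le0 => /eqP.
apply/eqP; rewrite -measure_le0.
rewrite (_ : [set w | _] = \bigcup_n [set w | total_time S w <= n%:R%:E]); last first.
  apply/seteqP; split => [w /=|w [n _ /= h]]; rewrite lE; last exact: le_lt_trans h (ltry _).
  move=> wf; have w0 := total_time_gt0 S0 w.
  have wfin : total_time S w \is a fin_num by rewrite ge0_fin_numE ?ltW.
  exists (Num.truncn (fine (total_time S w))).+1 => //=.
  by rewrite -[leLHS]fineK// lee_fin ltW// truncnS_gt.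
set B := fun n : nat => [set w | total_time S w <= n%:R%:E].
apply: (@le_trans _ _ (\sum_(n <oo) P (B n))).
  apply: measure_sigma_subadditive => //; first by move=> n; exact: mB.
  by apply: bigcupT_measurable => n; exact: mB.
by rewrite eseries0// => k _ _; exact: Bn.
Qed.

Variable a : nat.
Hypothesis q_gt0 : forall i, (a < i)%N -> (0 < q i)%R.
Notation K := (kop (kill Q a)).
Notation w0 := (hold Q a).
Notation F := (exit_time Y S a).
Notation H := (hits Y a).

Lemma measurable_term k : measurable_fun setT (fun w => (\1_(alive Y a k) w)%:E * S k w).
Proof.
apply: emeasurable_funM => //; apply/measurable_EFinP; apply: measurable_indic.
exact: measurable_alive.
Qed.

Let term_ge0 k w : 0 <= (\1_(alive Y a k) w)%:E * S k w.
Proof. by rewrite mule_ge0// lee_fin. Qed.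

Lemma measurable_exit_time : measurable_fun setT F.
Proof. apply: ge0_emeasurable_sum => // k _; exact: measurable_term. Qed.

Lemma exit_time_ge0 w : 0 <= F w.
Proof. exact: nneseries_ge0. Qed.

Lemma measurable_hits : measurable H.
Proof.
rewrite (_ : H = \bigcup_n [set w | [set m | (m <= a)%N] (Y n w)]).
  by apply: bigcupT_measurable => n; exact: measurable_Y.
by apply/seteqP; split => [w [n h]|w [n _ h]]; exists n.
Qed.

Lemma mean_exit_time : \int[P]_w F w = \sum_(k <oo) iter k K w0 x.
Proof.
rewrite integral_nneseries//; last by move=> n; exact: measurable_term.
apply: eq_eseriesr => k _; rewrite -(integral_alive q_ge0 J_ge0 mY mS S0 law q_gt0).
by rewrite ind_mul_integral ?setIT//; exact: measurable_alive.
Qed.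

Lemma alive_hits k : alive Y a k `&` H =
  \bigcup_m (alive Y a (k + m) `&` [set w | (Y (k + m).+1 w <= a)%N]).
Proof.
apply/seteqP; split => [w [ak ex]|w [m _ [am hm]]]; last first.
  by split; [move=> l lk; apply: am; rewrite (leq_trans lk) ?leq_addr|exists (k + m).+1].
case: (ex_minnP ex) => n hn hmin.
have kn : (k < n)%N by apply/(alive_before hn hmin).
exists (n - k.+1)%N => //.
have -> : (k + (n - k.+1))%N = n.-1.
  by rewrite -[in RHS](subnKC kn) addSn.
split; first by apply/(alive_before hn hmin); rewrite prednK// (leq_trans _ kn).
by rewrite /= prednK// (leq_trans _ kn).
Qed.

(** A path that is alive at step k and hits later does so at exactly one step
    [k + m + 1]; the Markov property at step k separates the two sums. *)
Lemma mean_exit_time_hits : \int[P]_(w in H) F w =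
  \sum_(k <oo) iter k K (fun i => w0 i *
     \sum_(m <oo) iter m.+1 K (fun j => (j <= a)%N%:R%:E) i) x.
Proof.
have mH := measurable_hits.
rewrite integral_nneseries//; last first.
  by move=> n; apply: measurable_funTS; exact: measurable_term.
apply: eq_eseriesr => k _.
have g0 j : 0 <= (j <= a)%N%:R%:E :> \bar R by rewrite lee_fin ler0n.
transitivity (\sum_(m <oo) iter k K (fun i => w0 i *
     iter m.+1 K (fun j => (j <= a)%N%:R%:E) i) x); last first.
  rewrite -iter_kop_series//; last first.
  - move=> m i; rewrite mule_ge0 ?hold_ge0//.
    by apply: iter_kop_ge0 => // *; exact: kill_ge0.
  - by move=> *; exact: kill_ge0.
  apply: eq_iter_kop => i; rewrite /hold; case: ifP => _.
    rewrite nneseriesZl// => m _.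
    by apply: iter_kop_ge0 => // *; exact: kill_ge0.
  by rewrite mul0e eseries0// => m _ _; rewrite mul0e.
have mA := measurable_alive mY a k.
rewrite ind_mul_integral// alive_hits ge0_integral_bigcup//.
- by apply: eq_eseriesr => m _; rewrite (integral_alive_hit q_ge0 J_ge0 mY mS S0 law q_gt0).
- move=> m; apply: measurableI; first exact: measurable_alive.
  exact: (measurable_Y mY (k + m).+1 [set n | (n <= a)%N]).
- exact: measurable_funTS.
- apply/trivIsetP => m m' _ _ mm'; apply/seteqP; split => // w [[am hm] [am' hm']].
  have [lt|lt|E] := ltngtP m m'; last by rewrite E eqxx in mm'.
    by have := am' (k + m).+1; rewrite ltn_add2l lt => /(_ isT); rewrite ltnNge hm.
  by have := am (k + m').+1; rewrite ltn_add2l lt => /(_ isT); rewrite ltnNge hm'.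
Qed.

Lemma mean_exit_time_split : \int[P]_w F w = \int[P]_(w in H) F w + \int[P]_(w in ~` H) F w.
Proof.
have mH := measurable_hits.
rewrite -ge0_integral_setU ?setUv//.
- exact: measurableC.
- exact: measurable_exit_time.
- by move=> w _; exact: exit_time_ge0.
- exact/disj_setPCl.
Qed.

Hypothesis F_fin : \int[P]_w F w < +oo.

Lemma exit_time_finite : P [set w | F w = +oo] = 0.
Proof.
have : P.-integrable setT F.
  apply/integrableP; split; first exact: measurable_exit_time.
  by under eq_integral do rewrite gee0_abs ?exit_time_ge0//.
move=> /(integrable_ae measurableT) [N [mN N0 sub]].
apply/eqP; rewrite -measure_le0 -N0; apply: le_measure; rewrite ?inE//.
  rewrite -[X in measurable X]setTI; apply: measurable_eqe => //; exact: measurable_exit_time.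
by move=> w /= Fw; apply: sub => /= /(_ Logic.I); rewrite Fw.
Qed.

(** F is almost surely finite, so that its integral over D only sees the part of
    D where F is finite. *)
Lemma integral_exit_finite (D E : set T) (f : T -> \bar R) :
  measurable E -> E `<=` D -> (forall w, E w -> 0 <= f w) -> measurable_fun E f ->
  (forall w, D w -> ~ E w -> F w = +oo) ->
  (forall w, E w -> f w = F w) -> measurable D ->
  \int[P]_(w in E) f w = \int[P]_(w in D) F w.
Proof.
move=> mE ED f0 mf DE fF mD.
have -> : D = E `|` (D `\` E) by rewrite setDUK.
rewrite ge0_integral_setU//.
- rewrite [X in _ + X](_ : _ = 0) ?adde0.
    by apply: eq_integral => w; rewrite inE => /fF.
  apply: null_set_integral => //.
  - exact: measurableD.
  - exact: measurable_funTS measurable_exit_time.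
  - apply/eqP; rewrite -measure_le0 -exit_time_finite; apply: le_measure; rewrite ?inE//.
    + exact: measurableD.
    + rewrite -[X in measurable X]setTI; apply: measurable_eqe => //; exact: measurable_exit_time.
    + by move=> w [Dw Ew]; exact: DE.
- exact: measurableD.
- exact: measurable_funTS measurable_exit_time.
- by move=> w _; exact: exit_time_ge0.
- by apply/disj_setPS => w [Ew [_ nE]].
Qed.

Lemma mean_hit_below :
  \int[P]_(w in [set w | hit_below a X w < +oo]) hit_below a X w = \int[P]_(w in H) F w.
Proof.
have mH := measurable_hits.
set E := [set w | _].
have EH : E `<=` H.
  by move=> w h; apply: contrapT => nh; move: h; rewrite /E/= (hit_below_never S0 Xjump Xend nh).
have hE w : H w -> hit_below a X w = F w := @hit_below_hits _ _ _ _ _ _ S0 Xjump Xend a w.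
have mF : measurable [set w | F w < +oo].
  rewrite -[X in measurable X]setTI; apply: measurable_lte => //; exact: measurable_exit_time.
have EE : E = H `&` [set w | F w < +oo].
  apply/seteqP; split => [w h|w [Hw h]] /=; last by rewrite /E/= hE.
  by have Hw := EH _ h; split => //=; rewrite -hE.
have mE : measurable E by rewrite EE; exact: measurableI.
apply: integral_exit_finite => //.
- by move=> w /EH Hw; rewrite hE// exit_time_ge0.
- apply: (@eq_measurable_fun _ _ _ _ E F) => [w|]; last first.
    exact: measurable_funTS measurable_exit_time.
  by rewrite inE => /EH /hE.
- move=> w Hw nE; apply/eqP; rewrite -leye_eq leNgt; apply/negP => Fw; apply: nE.
  by rewrite EE.
- by move=> w /EH /hE.
Qed.

Hypothesis absorbing : forall i, (i <= a)%N -> q i = 0%R.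

(** At rate 0 the Laplace transform of the holding time has mean 0. *)
Lemma absorbed_forever n i : (i <= a)%N ->
  P ([set w | Y n w = i] `&` [set w | S n w < +oo]) = 0.
Proof.
move=> ia; have mD : measurable [set w | Y n w = i] := measurable_Y mY n [set i].
have mL : measurable_fun setT (fun w => (laplace (S n w))%:E).
  by apply/measurable_EFinP; exact: measurable_laplace.
have mA : measurable ([set w | Y n w = i] `&` [set w | S n w < +oo]).
  apply: measurableI => //; rewrite -[X in measurable X]setTI.
  exact: measurable_lte.
have /ae_eq_integral_abs : \int[P]_(w in [set w | Y n w = i]) `|(laplace (S n w))%:E| = 0.
  rewrite -(integral_laplace_absorbed q_ge0 J_ge0 mY mS S0 law n (absorbing ia)).
  by apply: eq_integral => w _; rewrite gee0_abs// lee_fin laplace_ge0.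
move=> /(_ mD (measurable_funTS mL)) [N [mN N0 sub]].
apply/eqP; rewrite -measure_le0 -N0; apply: le_measure; rewrite ?inE//.
move=> w [Yw Sw]; apply: sub => /= /(_ Yw).
have {}Sw : S n w < +oo := Sw.
have := S0' n w; case: (S n w) Sw => [s _ _| |//]; last by rewrite ltxx.
by move=> /eqP; apply/negP; rewrite gt_eqF// lte_fin expR_gt0.
Qed.

(** If the states at most a are absorbing, a path that hits them has almost
    surely an infinite lifetime; finite lifetimes come from the other paths, on
    which lifetime and exit time agree. *)
Lemma mean_lifetime :
  \int[P]_(w in [set w | lifetime X w < +oo]) lifetime X w = \int[P]_(w in ~` H) F w.
Proof.
have mH := measurable_hits.
have lE w : lifetime X w = total_time S w by exact: (lifetimeE S0 Xjump Xend).
have mF : measurable [set w | F w < +oo].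
  rewrite -[X in measurable X]setTI; apply: measurable_lte => //; exact: measurable_exit_time.
have mL : measurable_fun setT (lifetime X).
  by rewrite (_ : lifetime X = total_time S); [exact: measurable_total_time|exact/funext].
set D := [set w | _].
have mD : measurable D.
  by rewrite -[X in measurable X]setTI; apply: measurable_lte.
pose E := ~` H `&` [set w | F w < +oo].
have mE : measurable E by apply: measurableI => //; exact: measurableC.
have lF w : ~ H w -> lifetime X w = F w by move=> h; rewrite lE (exit_time_never _ h).
have ED : E `<=` D by move=> w [nH Fw]; rewrite /D/= lF.
rewrite -(@integral_exit_finite (~` H) E (lifetime X))//; first last.
- exact: measurableC.
- by move=> w [nH _]; exact: lF.
- move=> w nH nE; apply/eqP; rewrite -leye_eq leNgt; apply/negP => Fw; exact: nE.
- exact: measurable_funTS.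
- by move=> w [nH _]; rewrite lF// exit_time_ge0.
- by move=> w [].
have l0 w : 0 <= lifetime X w by rewrite lE ltW// total_time_gt0.
have -> : D = E `|` (D `\` E) by rewrite setDUK.
rewrite ge0_integral_setU//; last 3 first.
- exact: measurableD.
- exact: measurable_funTS.
- by apply/disj_setPS => w [Ew [_ nE]].
rewrite [X in _ + X](_ : _ = 0) ?adde0//.
apply: null_set_integral; [exact: measurableD|exact: measurable_funTS|].
(* the null event that a holding time in an absorbing state is finite *)
pose B n i := if (i <= a)%N then [set w | Y n w = i] `&` [set w | S n w < +oo] else set0.
have mB n i : measurable (B n i).
  rewrite /B; case: ifP => // _; apply: measurableI; first exact: (measurable_Y mY n [set i]).
  by rewrite -[X in measurable X]setTI; exact: measurable_lte.
have B0 n i : P (B n i) = 0 by rewrite /B; case: ifP => [/absorbed_forever//|]; rewrite measure0.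
have sub : D `\` E `<=` \bigcup_n \bigcup_i B n i.
  move=> w [Dw nE].
  have [[n Yn]|nH] := pselect (H w); last by case: nE; split => //=; rewrite -lF.
  exists n => //; exists (Y n w) => //; rewrite /B Yn.
  split => //=; apply: le_lt_trans Dw; rewrite lE.
  apply: le_trans (jump_time_total S0 n.+1 w); rewrite jump_timeS leeDr//.
  by apply: sume_ge0.
have mBn n : measurable (\bigcup_i B n i) by apply: bigcupT_measurable.
apply/eqP; rewrite -measure_le0.
apply: (@le_trans _ _ (\sum_(n <oo) P (\bigcup_i B n i))).
  by apply: measure_sigma_subadditive => //; exact: measurableD.
rewrite eseries0// => n _ _; apply/eqP; rewrite -measure_le0.
apply: (@le_trans _ _ (\sum_(i <oo) P (B n i))).
  by apply: measure_sigma_subadditive.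
by rewrite eseries0.
Qed.

End Expectations.

(** * The jump matrix of the model and moments *)

Section Rows.
Context {R : realType}.
Variables (lambda mu : R) (p : nat -> R) (r : int -> R).
Hypothesis hpar : parameters lambda mu p r.
Notation s := (shift_law r).
Notation Q := (generator lambda mu p r).
Notation q := (exit_rate Q).
Notation J := (jump_prob Q).
Notation leb := (@lebesgue_measure R).

(** The rate of the jump from [n + 1] to [n + k].  Starting the target at n makes
    room for the downward jump [k = 0] with natural indices; [k = 1] is no jump. *)
Definition jump_rate (n k : nat) : R := lambda * n.+1%:R * p k + mu * s k.

Lemma row_ge0 n k : 0 <= jump_rate n k.
Proof.
have l0 := ltW (lambda_gt0 hpar); have m0 := mu_ge0 hpar.
by rewrite addr_ge0 ?mulr_ge0 ?(p_ge0 hpar) ?(s_ge0 hpar).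
Qed.

Lemma exit_rate0 : q 0%N = 0.
Proof. by rewrite /exit_rate /generator eqxx oppr0. Qed.

Lemma exit_rateS n : q n.+1 = lambda * n.+1%:R + mu.
Proof. by rewrite /exit_rate /generator /= eqxx opprK. Qed.

Lemma exit_rate_gt0 n : (0 < n)%N -> 0 < q n.
Proof.
case: n => // n _; rewrite exit_rateS ltr_pwDl ?(mu_ge0 hpar)//.
by rewrite mulr_gt0 ?(lambda_gt0 hpar).
Qed.

Lemma exit_rate_ge0 n : 0 <= q n.
Proof. by case: n => [|n]; [rewrite exit_rate0|rewrite ltW// exit_rate_gt0]. Qed.

Lemma jump_prob0 j : J 0%N j = (0%N == j)%:R.
Proof. by rewrite /jump_prob exit_rate0 eqxx. Qed.

Lemma jump_prob_lt n j : (j < n)%N -> J n.+1 j = 0.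
Proof.
move=> jn; rewrite /jump_prob gt_eqF ?exit_rate_gt0// gtn_eqF ?(leqW jn)//.
by rewrite /generator /= ltn_eqF ?(leqW jn)// ltnS jn mul0r.
Qed.

Lemma jump_prob_row n k : J n.+1 (n + k) = jump_rate n k / q n.+1.
Proof.
rewrite /jump_prob gt_eqF ?exit_rate_gt0//; case: ifPn => [/eqP E|E].
  have -> : k = 1%N by apply/eqP; rewrite -(eqn_add2l n) -E addn1.
  by rewrite /jump_rate (p1_eq0 hpar) (s1_eq0 hpar) !mulr0 addr0 mul0r.
congr (_ / _); rewrite /generator /= eq_sym (negbTE E) ltnS ltnNge leq_addr /=.
rewrite subSS addKn /jump_rate; congr (_ + _); first by ring.
rewrite mulrC /shift_law; congr (_ * r _).
by rewrite PoszD -addn1 PoszD opprD addrACA subrr add0r.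
Qed.

Lemma jump_prob_ge0 i j : 0 <= J i j.
Proof.
case: i => [|n]; first by rewrite jump_prob0.
have [jn|nj] := ltnP j n; first by rewrite jump_prob_lt.
by rewrite -(subnKC nj) jump_prob_row divr_ge0 ?row_ge0 ?exit_rate_ge0.
Qed.

Local Open Scope ereal_scope.

Lemma kop_jump n (f : nat -> \bar R) : (forall i, 0 <= f i) ->
  kop J f n.+1 = \sum_(k <oo) (jump_rate n k / q n.+1)%:E * f (n + k)%N.
Proof.
move=> f0; have t0 j : 0 <= (J n.+1 j)%:E * f j.
  by rewrite mule_ge0 ?lee_fin ?jump_prob_ge0.
rewrite /kop (@nneseries_split _ _ 0%N n)// add0n.
rewrite [X in X + _](_ : _ = 0) ?add0e; last first.
  rewrite big_nat_cond big1// => j /andP[/andP[_ jn] _].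
  by rewrite jump_prob_lt// mul0e.
rewrite -[in LHS](add0n n) -nneseries_addn//.
by apply: eq_eseriesr => k _; rewrite [(k + n)%N]addnC jump_prob_row.
Qed.

Lemma kop_jump_scaled n (f : nat -> \bar R) : (forall i, 0 <= f i) ->
  (q n.+1)%:E * kop J f n.+1 = \sum_(k <oo) (jump_rate n k)%:E * f (n + k)%N.
Proof.
move=> f0; have q0 := exit_rate_gt0 (ltn0Sn n).
rewrite kop_jump// -nneseriesZl; last first.
  by move=> k _; rewrite mule_ge0// lee_fin divr_ge0 ?row_ge0// ltW.
apply: eq_eseriesr => k _; rewrite muleA -EFinM; congr (_%:E * _).
by rewrite mulrC divfK// gt_eqF.
Qed.

Lemma kop_jump0 (f : nat -> \bar R) : (forall i, 0 <= f i) -> kop J f 0%N = f 0%N.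
Proof.
move=> f0; rewrite /kop (@nneseriesD1 _ _ 0%N xpredT)//; last first.
  by move=> k _; rewrite mule_ge0 ?lee_fin ?jump_prob_ge0.
rewrite jump_prob0 eqxx mul1e eseries0 ?adde0// => k _ /= k0.
by rewrite jump_prob0 eq_sym (negbTE k0) mul0e.
Qed.

Lemma row_sum n z : (0 <= z <= 1)%R ->
  \sum_(k <oo) (jump_rate n k * z ^+ (n + k))%:E =
  (z ^+ n * (lambda * n.+1%:R * pgf p z + mu * pgf s z))%:E.
Proof.
move=> z01; have /andP[z0 z1] := z01.
have l0 := ltW (lambda_gt0 hpar); have m0 := mu_ge0 hpar.
have zn k : (0 <= z ^+ k)%R by exact: exprn_ge0.
transitivity (\sum_(k <oo) ((z ^+ n * (lambda * n.+1%:R))%:E * (p k * z ^+ k)%:E +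
    (z ^+ n * mu)%:E * (s k * z ^+ k)%:E)).
  by apply: eq_eseriesr => k _; rewrite -!EFinM -EFinD /jump_rate exprD; congr EFin; ring.
rewrite nneseriesD; last 2 first.
- by move=> k _ _; rewrite lee_fin !mulr_ge0// (p_ge0 hpar).
- by move=> k _ _; rewrite lee_fin !mulr_ge0// (s_ge0 hpar).
rewrite !nneseriesZl; last 2 first.
- by move=> k _; rewrite lee_fin !mulr_ge0// (s_ge0 hpar).
- by move=> k _; rewrite lee_fin !mulr_ge0// (p_ge0 hpar).
rewrite (pgf_nneseries (p_ge0 hpar) (p_sum hpar) z01).
rewrite (pgf_nneseries (s_ge0 hpar) (s_sum hpar) z01).
by rewrite -!EFinM -EFinD; congr EFin; ring.
Qed.

Lemma row_total n : \sum_(k <oo) (jump_rate n k)%:E = (lambda * n.+1%:R + mu)%:E.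
Proof.
have := @row_sum n 1%R _; rewrite ler01 lexx expr1n mul1r.
rewrite (pgf1 (p_sum hpar)) (pgf1 (s_sum hpar)) !mulr1 => <- //.
by apply: eq_eseriesr => k _; rewrite expr1n mulr1.
Qed.

Lemma kop_jump_cst1 i : kop J (cst 1) i = 1.
Proof.
case: i => [|n]; first by rewrite kop_jump0.
have q0 := exit_rate_gt0 (ltn0Sn n).
have E : (q n.+1)%:E * kop J (cst 1) n.+1 = (q n.+1)%:E * 1.
  rewrite kop_jump_scaled// mule1 exit_rateS -row_total.
  by apply: eq_eseriesr => k _; rewrite mule1.
have := congr1 (fun y => (q n.+1)^-1%:E * y) E.
by rewrite /= !muleA -EFinM mulVf ?gt_eqF// !mul1e.
Qed.

Lemma kop_kill a f i : kop (kill Q a) f i = if (a < i)%N then kop J f i else 0.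
Proof.
rewrite /kop /kill; case: ifP => // _.
by rewrite eseries0// => j _ _; rewrite mul0e.
Qed.

Lemma kill_substochastic a i : kop (kill Q a) (cst 1) i <= 1.
Proof. by rewrite kop_kill; case: ifP => // _; rewrite kop_jump_cst1. Qed.

(** Jumps go down by at most one, so from above a the only state at most a that
    can be reached is a itself: the killed mass sees f only through [f a]. *)
Lemma kop_kill_split a (f : nat -> \bar R) i : (forall i, 0 <= f i) -> (a < i)%N ->
  f a \is a fin_num ->
  kop J f i = kop (kill Q a) (fun j => if (a < j)%N then f j else 0) i +
    f a * kop (kill Q a) (fun j => (j <= a)%N%:R%:E) i.
Proof.
move=> f0 ai fa.
have g0 j : 0 <= (j <= a)%N%:R%:E :> \bar R by rewrite lee_fin ler0n.
rewrite !kop_kill ai -(fineK fa) -(kopZ jump_prob_ge0)// -(kopD jump_prob_ge0)//.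
- apply: eq_eseriesr => j _; case: (ltngtP j a) => [ja|aj|->].
  + case: i ai => // n; rewrite ltnS => an.
    by rewrite jump_prob_lt ?mul0e// (leq_trans ja).
  + by rewrite mule0 adde0.
  + by rewrite mule1 add0e fineK.
- by move=> j; case: ifP.
- by move=> j; rewrite mule_ge0// lee_fin fine_ge0.
Qed.

Lemma row_integral n (l u : R) (e : nat -> R -> R) (G : R -> R) :
  (forall k v, (l < v < u)%R -> (0 <= e k v)%R) ->
  (forall k, measurable_fun `]l, u[ (e k)) ->
  (forall v, (l < v < u)%R -> \sum_(k <oo) (jump_rate n k * e (n + k)%N v)%:E = (G v)%:E) ->
  \sum_(k <oo) (jump_rate n k)%:E * \int[leb]_(v in `]l, u[) (e (n + k)%N v)%:E =
  \int[leb]_(v in `]l, u[) (G v)%:E.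
Proof.
move=> e0 me Ge.
transitivity (\sum_(k <oo) \int[leb]_(v in `]l, u[) (jump_rate n k * e (n + k)%N v)%:E).
  apply: eq_eseriesr => k _; rewrite -ge0_integralZl//=.
  - by apply/measurable_EFinP; exact: me.
  - by move=> v; rewrite in_itv/= => vlu; rewrite lee_fin e0.
  - by rewrite lee_fin row_ge0.
rewrite -integral_nneseries//=.
- by apply: eq_integral => v; rewrite inE/= in_itv/= => vlu; exact: Ge.
- by move=> k; apply/measurable_EFinP; apply: measurable_funM => //; exact: me.
- by move=> k v; rewrite in_itv/= => vlu; rewrite lee_fin mulr_ge0 ?row_ge0 ?e0.
Qed.

Section Moments.
Variables (l u : R) (rho : R -> R).
Hypotheses (l0 : (0 <= l)%R) (u1 : (u <= 1)%R)
  (rho_ge0 : forall v, (l < v < u)%R -> (0 <= rho v)%R)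
  (rho_cont : forall v, (l < v < u)%R -> {for v, continuous rho})
  (rho_int : leb.-integrable `]l, u[ (EFin \o rho)).

Definition moment j : \bar R := \int[leb]_(v in `]l, u[) (v ^+ j * rho v)%:E.

Let itv01 v : (l < v < u)%R -> (0 < v < 1)%R.
Proof. by move: l0 u1 => ? ? /andP[? ?]; apply/andP; split; lra. Qed.

Let term_ge0 j v : (l < v < u)%R -> (0 <= v ^+ j * rho v)%R.
Proof.
move=> vlu; have /andP[/ltW v0 _] := itv01 vlu.
by apply: mulr_ge0; [exact: exprn_ge0|exact: rho_ge0].
Qed.

Let term_le j v : (l < v < u)%R -> (v ^+ j * rho v <= rho v)%R.
Proof.
move=> vlu; have /andP[/ltW v0 /ltW v1] := itv01 vlu.
by apply: ler_piMl; [exact: rho_ge0|exact: exprn_ile1].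
Qed.

Lemma moment_integrable j : leb.-integrable `]l, u[ (EFin \o (fun v => v ^+ j * rho v)%R).
Proof.
apply: (@le_oo_integrable _ _ rho) => // [v vlu|v vlu].
  by apply: cvgM; [exact: exprn_continuous|exact: rho_cont].
by rewrite ger0_norm ?term_ge0 ?term_le.
Qed.

Lemma moment_ge0 j : 0 <= moment j.
Proof.
by apply: integral_ge0 => v; rewrite /= in_itv/= => vlu; rewrite lee_fin term_ge0.
Qed.

Lemma moment_fin j : moment j \is a fin_num.
Proof. exact: integrable_fin_num (moment_integrable j). Qed.

Lemma moment_cvg0 : fine (moment j) @[j --> \oo] --> (0%R : R).
Proof.
have mD : measurable (`]l, u[%classic : set (measurableTypeR R)) by exact: measurable_itv.
pose f_ j := EFin \o (fun v => v ^+ j * rho v)%R.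
have [|||||_ _] := @dominated_convergence _ _ _ leb `]l, u[%classic mD f_ (cst 0) (EFin \o rho).
- by move=> j; exact: measurable_int (moment_integrable j).
- exact: measurable_cst.
- apply: aeW => v /=; rewrite in_itv/= => /itv01/andP[v0 v1].
  apply: cvg_EFin; first exact: nearW.
  rewrite -[X in _ --> X](mul0r (rho v)); apply: cvgMr_tmp.
  by apply: cvg_expr; rewrite ger0_norm// ltW.
- exact: rho_int.
- apply: aeW => v j /=; rewrite in_itv/= => vlu.
  by rewrite lee_fin ger0_norm ?term_ge0 ?term_le.
by rewrite integral0 => /fine_cvgP[_].
Qed.

(** Integrating the identity that defines [flux] against rho and exchanging sum
    and integral turns an integral of the flux into an equation for the moments. *)
Lemma moment_row n (theta : R) :
  \int[leb]_(v in `]l, u[) (flux lambda mu p r n v * rho v)%:E = theta%:E ->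
  (q n.+1)%:E * moment n.+1 = theta%:E + \sum_(k <oo) (jump_rate n k)%:E * moment (n + k).
Proof.
move=> E.
pose G v := (v ^+ n * (lambda * n.+1%:R * pgf p v + mu * pgf s v) * rho v)%R.
have xi : leb.-integrable `]l, u[ (EFin \o (fun v => flux lambda mu p r n v * rho v)%R).
  apply: (@le_oo_integrable _ _ (fun v => (lambda * n.+1%:R + mu) * rho v)%R).
  - move=> v vlu; apply: cvgM; last exact: rho_cont.
    exact: (flux_continuous hpar (itv01 vlu)).
  - move=> v vlu; rewrite normrM; apply: ler_pM => //.
      exact: (flux_bound hpar _ (itv01 vlu)).
    by rewrite ger0_norm ?rho_ge0.
  - exact: integrable_scale.
have qi : leb.-integrable `]l, u[ (EFin \o (fun v => q n.+1 * (v ^+ n.+1 * rho v))%R).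
  exact/integrable_scale/moment_integrable.
have GE v : G v = (q n.+1 * (v ^+ n.+1 * rho v) - flux lambda mu p r n v * rho v)%R.
  by rewrite /G exit_rateS /flux exprS; ring.
rewrite (@row_integral n l u (fun k v => v ^+ k * rho v)%R G); first last.
- move=> v vlu; have /andP[v0 v1] := itv01 vlu.
  have v01 : (0 <= v <= 1)%R by rewrite !ltW.
  transitivity (\sum_(k <oo) (rho v)%:E * (jump_rate n k * v ^+ (n + k))%:E).
    by apply: eq_eseriesr => k _; rewrite -EFinM; congr EFin; ring.
  rewrite nneseriesZl ?row_sum//.
    by rewrite -EFinM; congr EFin; rewrite /G; ring.
  by move=> k _; rewrite lee_fin mulr_ge0 ?row_ge0 ?exprn_ge0// ltW.
- move=> k; have := measurable_int _ (moment_integrable k).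
  by move=> /measurable_EFinP.
- by move=> k v; exact: term_ge0.
have GI : \int[leb]_(v in `]l, u[) (G v)%:E = (q n.+1)%:E * moment n.+1 - theta%:E.
  under eq_integral do rewrite GE EFinB.
  rewrite integralB//= E -EFinN; congr (_ + _).
  rewrite /moment -integralZl//=; exact: moment_integrable.
by rewrite GI addeC subeK.
Qed.

End Moments.
End Rows.

(** * Lyapunov functions exclude explosion *)

Section NonExplosion.
Context {R : realType}.
Variables (lambda mu : R) (p : nat -> R) (r : int -> R).
Hypothesis hpar : parameters lambda mu p r.
Notation s := (shift_law r).
Notation Q := (generator lambda mu p r).
Notation q := (exit_rate Q).
Notation J := (jump_prob Q).
Notation A := (discounted Q).
Local Open Scope ereal_scope.

Let A_ge0 i j : (0 <= A i j)%R.
Proof. exact: discounted_ge0 (exit_rate_ge0 hpar) (jump_prob_ge0 hpar) i j. Qed.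

Lemma kop_discounted f i : (forall j, 0 <= f j) ->
  kop A f i = (q i / (q i + 1))%:E * kop J f i.
Proof.
move=> f0; rewrite /kop -nneseriesZl; last first.
  by move=> j _; rewrite mule_ge0 ?lee_fin ?(jump_prob_ge0 hpar).
by apply: eq_eseriesr => j _; rewrite muleA -EFinM /discounted mulrC.
Qed.

Definition kappa i : \bar R := ((q i + 1)^-1)%:E.
(** The probability that the chain, killed at rate 1, is ever killed: [kappa] is
    the probability that the killing comes before the next jump.  So [1 - death]
    is the Laplace transform at 1 of the explosion time. *)
Definition death i : \bar R := \sum_(k <oo) iter k (kop A) kappa i.

Let q1 i : (0 < q i + 1)%R.
Proof. by rewrite ltr_wpDl ?(exit_rate_ge0 hpar). Qed.

Let kappa0 i : 0 <= kappa i. Proof. by rewrite lee_fin invr_ge0 ltW. Qed.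

Let death0 i : 0 <= death i.
Proof. by apply: nneseries_ge0 => k _ _; exact: iter_kop_ge0. Qed.

Lemma kappa_one i : cst 1 i = kappa i + kop A (cst 1) i.
Proof.
rewrite kop_discounted// (kop_jump_cst1 hpar) mule1 -EFinD; congr EFin.
by field; exact: lt0r_neq0 (q1 i).
Qed.

Lemma death_le1 i : death i <= 1.
Proof. by apply: (green_sum_le A_ge0 (u := cst 1)) => // j; exact: kappa_one. Qed.

Lemma death_fixpoint i : death i = kappa i + kop A death i.
Proof.
rewrite (_ : kop A death i = \sum_(k <oo) kop A (iter k (kop A) kappa) i); last first.
  by rewrite -(kop_series A_ge0)// => m j; exact: iter_kop_ge0.
have t0 k : 0 <= iter k (kop A) kappa i by exact: iter_kop_ge0.
rewrite /death nneseries_recl//; congr (_ + _).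
rewrite -(@nneseries_addn _ (fun k => iter k (kop A) kappa i) 1)//.
by apply: eq_eseriesr => k _; rewrite addn1.
Qed.

Let e i : R := (1 - fine (death i))%R.

Let death_fin i : death i \is a fin_num.
Proof. by rewrite ge0_fin_numE// (le_lt_trans (death_le1 i))// ltry. Qed.

Let e_ge0 i : (0 <= e i)%R.
Proof. by rewrite subr_ge0 -lee_fin fineK// death_le1. Qed.

Let e_le1 i : (e i <= 1)%R.
Proof. by rewrite lerBlDr lerDl fine_ge0. Qed.

Let e0 : e 0%N = 0%R.
Proof.
apply/eqP; rewrite eq_le e_ge0 andbT subr_le0 -lee_fin fineK// death_fixpoint.
rewrite /kappa exit_rate0 add0r invr1 leeDl//.
exact: (kop_ge0 A_ge0 death0).
Qed.

Let e_row n : ((q n.+1 + 1) * e n.+1)%:E =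
  \sum_(k <oo) (jump_rate lambda mu p r n k)%:E * (e (n + k))%:E.
Proof.
have qS := exit_rate_gt0 hpar (ltn0Sn n).
have row0 k := row_ge0 hpar n k.
have Ed : ((q n.+1 + 1) * fine (death n.+1))%:E =
    1 + \sum_(k <oo) (jump_rate lambda mu p r n k)%:E * death (n + k).
  rewrite EFinM fineK// {1}death_fixpoint kop_discounted// -(kop_jump_scaled hpar)//.
  have J0 : 0 <= kop J death n.+1 by exact: (kop_ge0 (jump_prob_ge0 hpar)).
  rewrite ge0_muleDr//; last by rewrite mule_ge0// lee_fin divr_ge0// ltW.
  rewrite /kappa -EFinM mulfV ?(lt0r_neq0 (q1 _))//; congr (_ + _).
  by rewrite muleA -EFinM; congr (_%:E * _); field; exact: lt0r_neq0 (q1 _).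
have Es : \sum_(k <oo) (jump_rate lambda mu p r n k)%:E * (e (n + k))%:E +
    \sum_(k <oo) (jump_rate lambda mu p r n k)%:E * death (n + k) = (q n.+1)%:E.
  rewrite exit_rateS -(row_total hpar) -nneseriesD; last 2 first.
  - by move=> k _ _; rewrite -EFinM lee_fin mulr_ge0.
  - by move=> k _ _; rewrite mule_ge0// lee_fin.
  apply: eq_eseriesr => k _; rewrite -(fineK (death_fin (n + k))) -!EFinM -EFinD.
  by congr EFin; rewrite /e; ring.
set a := \sum_(k <oo) (jump_rate lambda mu p r n k)%:E * (e (n + k))%:E in Es *.
set b := \sum_(k <oo) (jump_rate lambda mu p r n k)%:E * death (n + k) in Ed Es.
have bfin : b \is a fin_num.
  rewrite ge0_fin_numE; last by apply: nneseries_ge0 => k _ _; rewrite mule_ge0// lee_fin.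
  rewrite (le_lt_trans _ (ltry (q n.+1)))// -Es leeDr//.
  by apply: nneseries_ge0 => k _ _; rewrite -EFinM lee_fin mulr_ge0.
have -> : a = (q n.+1)%:E - b by rewrite -Es addeK.
rewrite -(fineK bfin) -EFinB; congr EFin; rewrite /e.
have : ((q n.+1 + 1) * fine (death n.+1))%R = (1 + fine b)%R.
  by apply: EFin_inj; rewrite Ed EFinD fineK.
by move=> E; rewrite mulrBr E; ring.
Qed.

Section Lyapunov.
Variables (f : nat -> R) (C : R).
Hypotheses (f_ge0 : forall n, (0 <= f n)%R) (f0 : f 0%N = 0%R) (C_ge0 : (0 <= C)%R)
  (f_unbounded : forall B : R, exists N, forall n, (N <= n)%N -> (B <= f n)%R)
  (f_row : forall n, \sum_(k <oo) (p k)%:E * (f (n + k))%:E <= (f n.+1 + C / n.+1%:R)%:E).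

Lemma finite_argmax (g : nat -> R) N :
  exists2 m, (m <= N)%N & forall j, (j <= N)%N -> (g j <= g m)%R.
Proof.
elim: N => [|N [m mN h]]; first by exists 0%N => // j; rewrite leqn0 => /eqP ->.
have [gm|gm] := leP (g N.+1) (g m).
  exists m; first exact: leqW.
  by move=> j; rewrite leq_eqVlt => /orP[/eqP ->//|]; rewrite ltnS; exact: h.
exists N.+1 => // j; rewrite leq_eqVlt => /orP[/eqP ->//|]; rewrite ltnS => /h jm.
exact: le_trans jm (ltW gm).
Qed.

(** Maximum principle.  At a maximum m > 0 of [e - eps * f], the branching part
    can raise e only by [eps * C / m], so that it cancels against the rate
    [lambda * m] up to [eps * lambda * C]; there remains
    [(mu + 1) * e m <= mu * b] up to a multiple of eps. *)
Lemma survival_contract (b : R) : (0 <= b)%R -> (forall i, e i <= b)%R ->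
  forall i, (e i <= mu / (mu + 1) * b)%R.
Proof.
move=> b0 eb i.
have l0 := lambda_gt0 hpar; have m0 := mu_ge0 hpar.
set th := (mu / (mu + 1) * b)%R.
have th0 : (0 <= th)%R by rewrite mulr_ge0// divr_ge0// addr_ge0.
suff H (eps : R) : (0 < eps)%R -> (e i <= th + eps * (lambda * C + f i))%R.
  apply/ler_addgt0Pr => eps eps0.
  have K0 : (0 < lambda * C + f i + 1)%R.
    by rewrite ltr_wpDl// addr_ge0// mulr_ge0// ltW.
  apply: le_trans (H (eps / (lambda * C + f i + 1))%R _) _; first by rewrite divr_gt0.
  rewrite lerD2l mulrAC ler_pdivrMr// ler_wpM2l ?(ltW eps0)//.
  by rewrite lerDl.
move=> eps0.
(* e <= 1 <= eps * f beyond N, so the maximum over [0, N] is global *)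
have [N fN] := f_unbounded eps^-1.
have [m mN gm] := finite_argmax (fun j => e j - eps * f j)%R N.
have gmax j : (e j - eps * f j <= e m - eps * f m)%R.
  have [jN|Nj] := leqP j N; first exact: gm.
  apply: le_trans (gm 0%N (leq0n _)); rewrite e0 f0 mulr0 subr0 subr_le0.
  rewrite (le_trans (e_le1 _))// -(mulfV (lt0r_neq0 eps0)) ler_wpM2l ?(ltW eps0)//.
  by apply: fN; exact: ltnW.
have M0 : (0 <= e m - eps * f m)%R.
  by have := gmax 0%N; rewrite e0 f0 mulr0 subr0.
suff em : (e m <= th + eps * (lambda * C))%R.
  have := gmax i; have : (0 <= eps * f m)%R by rewrite mulr_ge0// ltW.
  by rewrite mulrDr; lra.
case: m gmax M0 {mN gm} => [|n] gmax M0.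
  rewrite e0 addr_ge0// mulr_ge0 ?(ltW eps0)// mulr_ge0// ltW//.
set M := (e n.+1 - eps * f n.+1)%R in gmax M0.
have p0 k : (0 <= p k)%R by exact: (p_ge0 hpar).
have s0 k : (0 <= s k)%R by exact: (s_ge0 hpar).
have B1 : \sum_(k <oo) (p k)%:E * (e (n + k))%:E <= (e n.+1 + eps * C / n.+1%:R)%:E.
  apply: (@le_trans _ _ (\sum_(k <oo) (M%:E * (p k)%:E + eps%:E * ((p k)%:E * (f (n + k))%:E)))).
    apply: lee_nneseries => [k _ _|k _].
      by rewrite -EFinM lee_fin mulr_ge0.
    rewrite -!EFinM -EFinD lee_fin.
    by have := ler_wpM2l (p0 k) (gmax (n + k)%N); lra.
  rewrite nneseriesD; last 2 first.
  - by move=> k _ _; rewrite -EFinM lee_fin mulr_ge0.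
  - by move=> k _ _; rewrite -!EFinM lee_fin !mulr_ge0// ltW.
  rewrite !nneseriesZl; last 2 first.
  - by move=> k _; rewrite -EFinM lee_fin mulr_ge0.
  - by move=> k _; rewrite lee_fin.
  rewrite (nonneg_series_lim p0 (p_sum hpar)) mule1.
  have -> : (e n.+1 + eps * C / n.+1%:R)%:E = M%:E + eps%:E * (f n.+1 + C / n.+1%:R)%:E.
    by rewrite -EFinM -EFinD /M; congr EFin; ring.
  by apply: leeD => //; apply: lee_wpmul2l; [rewrite lee_fin ltW|exact: f_row].
have B2 : \sum_(k <oo) (s k)%:E * (e (n + k))%:E <= b%:E.
  apply: (@le_trans _ _ (\sum_(k <oo) b%:E * (s k)%:E)).
    apply: lee_nneseries => [k _ _|k _]; first by rewrite -EFinM lee_fin mulr_ge0.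
    by rewrite muleC; apply: lee_wpmul2r; rewrite lee_fin.
  rewrite nneseriesZl; last by move=> k _; rewrite lee_fin.
  by rewrite (nonneg_series_lim s0 (s_sum hpar)) mule1.
have n0 : (0 < n.+1%:R :> R)%R by [].
have ln0 : (0 <= lambda * n.+1%:R)%R by rewrite mulr_ge0// ltW.
have B3 : ((q n.+1 + 1) * e n.+1 <= lambda * n.+1%:R * (e n.+1 + eps * C / n.+1%:R) + mu * b)%R.
  rewrite -lee_fin e_row EFinD !EFinM.
  rewrite [leLHS](_ : _ = (lambda * n.+1%:R)%:E * \sum_(k <oo) (p k)%:E * (e (n + k))%:E +
     mu%:E * \sum_(k <oo) (s k)%:E * (e (n + k))%:E); last first.
    rewrite -!nneseriesZl; last 2 first.
    - by move=> k _; rewrite -EFinM lee_fin mulr_ge0.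
    - by move=> k _; rewrite -EFinM lee_fin mulr_ge0.
    rewrite -nneseriesD; last 2 first.
    - by move=> k _ _; rewrite -!EFinM lee_fin !mulr_ge0// ltW.
    - by move=> k _ _; rewrite -!EFinM lee_fin !mulr_ge0.
    apply: eq_eseriesr => k _; rewrite -!EFinM -EFinD /jump_rate; congr EFin; ring.
  apply: leeD; first by rewrite -EFinM; apply: lee_wpmul2l; rewrite ?lee_fin.
  by apply: lee_wpmul2l; rewrite ?lee_fin.
have m1 : (0 < mu + 1)%R by rewrite ltr_wpDl.
have E1 : (lambda * n.+1%:R * (e n.+1 + eps * C / n.+1%:R) =
    lambda * n.+1%:R * e n.+1 + lambda * eps * C)%R by field; rewrite gt_eqF.
have B4 : ((mu + 1) * e n.+1 <= mu * b + lambda * eps * C)%R.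
  by move: B3; rewrite E1 exit_rateS; lra.
have -> : th = (mu * b / (mu + 1))%R by rewrite /th mulrAC.
have X0 : (0 <= lambda * eps * C)%R by rewrite !mulr_ge0// ltW.
have : (e n.+1 <= (mu * b + lambda * eps * C) / (mu + 1))%R by rewrite ler_pdivlMr// mulrC.
move=> /le_trans; apply; rewrite mulrDl lerD2l ler_pdivrMr//.
have -> : (eps * (lambda * C) = lambda * eps * C)%R by ring.
by rewrite ler_peMr// lerDr.
Qed.

Lemma survival_zero i : e i = 0%R.
Proof.
have m0 := mu_ge0 hpar.
have c0 : (0 <= mu / (mu + 1))%R by rewrite divr_ge0// addr_ge0.
have c1 : (mu / (mu + 1) < 1)%R by rewrite ltr_pdivrMr ?ltr_wpDl// mul1r ltrDl.
have H k : forall i, (e i <= (mu / (mu + 1)) ^+ k)%R.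
  elim: k => [|k IH] j; first by rewrite expr0.
  by rewrite exprS; apply: survival_contract => //; exact: exprn_ge0.
apply/eqP; rewrite eq_le e_ge0 andbT.
have cv : ((mu / (mu + 1)) ^+ k)%R @[k --> \oo] --> (0%R : R).
  by apply: cvg_expr; rewrite ger0_norm.
by apply: (cvgr_to_ge cv); apply: nearW => k.
Qed.

Lemma lyapunov_never_explodes x :
  iter N (kop A) (cst 1) x @[N --> \oo] --> 0.
Proof.
have d1 : death x = 1.
  by rewrite -(fineK (death_fin x)); congr EFin; have := survival_zero x; rewrite /e; lra.
have cS : \sum_(0 <= k < m) iter k (kop A) kappa x @[m --> \oo] --> (1 : \bar R).
  by rewrite -d1; apply: is_cvg_nneseries => n _ _; exact: iter_kop_ge0.
have E m : iter m (kop A) (cst 1) x = 1 - \sum_(0 <= k < m) iter k (kop A) kappa x.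
  have h : 1 = _ := @green_partial _ _ A_ge0 (cst 1) kappa (fun=> lee01) kappa0 kappa_one m x.
  rewrite [X in X - _]h [X in X - _]addeC addeK//.
  rewrite ge0_fin_numE; last by apply: sume_ge0 => k _; exact: iter_kop_ge0.
  apply: (@le_lt_trans _ _ 1); last exact: ltry.
  by rewrite -d1; apply: nneseries_lim_ge => k _ _; exact: iter_kop_ge0.
have cB : 1 - \sum_(0 <= k < m) iter k (kop A) kappa x @[m --> \oo] --> (1 - 1 : \bar R).
  by apply: cvgeB => //; exact: cvg_cst.
rewrite subee// in cB; apply: cvg_trans cB; apply: near_eq_cvg.
by apply: nearW => m; rewrite E.
Qed.

End Lyapunov.
End NonExplosion.

(** * What explosion says on the branching law *)

Section Criterion.
Context {R : realType}.
Variables (lambda mu : R) (p : nat -> R) (r : int -> R) (vphi : R).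
Hypotheses (hpar : parameters lambda mu p r) (hvphi : branching_root p vphi).
Notation leb := (@lebesgue_measure R).
Notation A := (discounted (generator lambda mu p r)).

Let pge0 := p_ge0 hpar.
Let psum := p_sum hpar.
Let p1 := p1_eq0 hpar.

Lemma branching_root_gt0 : 0 < vphi.
Proof. by case: hvphi => -[/andP[]]. Qed.

Lemma branching_root_fix : pgf p vphi = vphi.
Proof. by case: hvphi => -[]. Qed.

(** Since [v <= pgf p v] for v < 1, the sum of the [p k (1 - v^k) / (1 - v)] is at
    most 1; let v tend to 1. *)
Lemma mean_le1 : vphi = 1 -> forall N, \sum_(k < N) p k * k%:R <= 1.
Proof.
move=> v1 N; have hv := hvphi; rewrite v1 in hv.
have H v : 0 < v < 1 -> \sum_(k < N) p k * (\sum_(i < k) v ^+ i) <= 1.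
  move=> v01; have /andP[v0 vl1] := v01; have v01' : 0 <= v <= 1 by rewrite !ltW.
  have vp := pgf_ge_of_least_root1 pge0 psum (p0_gt0 hpar) hv v01.
  have w0 k : 0 <= p k * (1 - v ^+ k).
    by rewrite mulr_ge0// subr_ge0 exprn_ile1// ltW.
  have S : series (fun k => p k * (1 - v ^+ k)) @ \oo --> 1 - pgf p v.
    have cB : (series p n - pseries p v n) @[n --> \oo] --> 1 - pgf p v.
      by apply: cvgB => //; exact: (pgf_cvg pge0 psum v01').
    apply: cvg_trans cB; apply: near_eq_cvg; apply: nearW => n /=; rewrite /pseries /series /=.
    by rewrite -sumrB; apply: eq_bigr => k _; rewrite mulrBr mulr1.
  have : \sum_(k < N) p k * (1 - v ^+ k) <= 1 - pgf p v.
    rewrite -lee_fin -(nonneg_series_lim w0 S) -sumEFin.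
    rewrite -(big_mkord xpredT (fun k => (p k * (1 - v ^+ k))%:E)).
    by apply: nneseries_lim_ge => k _ _; rewrite lee_fin.
  have -> : \sum_(k < N) p k * (1 - v ^+ k) =
      (1 - v) * \sum_(k < N) p k * \sum_(i < k) v ^+ i.
    rewrite mulr_sumr; apply: eq_bigr => k _.
    by rewrite -[1 in LHS](expr1n _ k) subrXX mulrCA; congr (_ * (_ * _));
      apply: eq_bigr => i _; rewrite expr1n mul1r.
  move=> h; have h2 : (1 - v) * \sum_(k < N) p k * \sum_(i < k) v ^+ i <= (1 - v) * 1.
    by rewrite mulr1 (le_trans h)// lerB.
  by rewrite ler_pM2l ?subr_gt0 in h2.
have cF : (\sum_(k < N) p k * \sum_(i < k) v ^+ i) @[v --> (1 : R)^'-] -->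
    \sum_(k < N) p k * \sum_(i < k) 1 ^+ i.
  apply: cvg_at_left_filter; apply: cvg_big; [exact: add_continuous|move=> k _; apply: cvgMl_tmp].
  by apply: cvg_big; [exact: add_continuous|move=> i _; exact: exprn_continuous].
have := cvgr_to_le cF.
rewrite (_ : \sum_(k < N) p k * \sum_(i < k) 1 ^+ i = \sum_(k < N) p k * k%:R).
  apply; near=> v; apply: H; apply/andP; split.
  - by near: v; exact: nbhs_left_gt.
  - by near: v; exact: nbhs_left_lt.
apply: eq_bigr => k _; congr (_ * _); under eq_bigr do rewrite expr1n.
by rewrite sumr_const card_ord.
Unshelve. all: by end_near. Qed.

(** The mean number of offspring is at most 1, so the identity is a Lyapunov
    function with [C = 0]. *)
Lemma root1_never_explodes : vphi = 1 -> forall x,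
  (iter N (kop A) (cst 1) x @[N --> \oo] --> 0)%E.
Proof.
move=> v1 x; apply: (@lyapunov_never_explodes _ _ _ _ _ hpar (fun n => n%:R) 0) => //.
- move=> B; exists (Num.truncn B).+1 => n Bn.
  by apply: ltW; apply: lt_le_trans (truncnS_gt B) _; rewrite ler_nat.
move=> n; rewrite mul0r addr0.
have mean : (\sum_(k <oo) (p k * k%:R)%:E <= 1)%E.
  apply: lime_le; first by apply: is_cvg_nneseries => k _ _; rewrite lee_fin mulr_ge0.
  by apply: nearW => N; rewrite sumEFin lee_fin big_mkord; exact: mean_le1.
apply: (@le_trans _ _ (\sum_(k <oo) ((n%:R)%:E * (p k)%:E + (p k * k%:R)%:E))%E).
  apply: lee_nneseries => [k _ _|k _]; first by rewrite -EFinM lee_fin mulr_ge0.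
  by rewrite -!EFinM -EFinD lee_fin natrD mulrDr [p k * n%:R]mulrC.
rewrite nneseriesD; last 2 first.
- by move=> k _ _; rewrite -EFinM lee_fin mulr_ge0.
- by move=> k _ _; rewrite lee_fin mulr_ge0.
rewrite nneseriesZl; last by move=> k _; rewrite lee_fin.
by rewrite (nonneg_series_lim pge0 psum) mule1 -natr1 EFinD leeD2l.
Qed.

Section Divergent.
Hypothesis v1 : vphi < 1.
Let vphi01 : 0 <= vphi < 1. Proof. by rewrite v1 ltW// branching_root_gt0. Qed.
Let pvphi := branching_root_fix.
Variable c : R.
Hypotheses (vc : vphi < c) (c1 : c < 1).

Let dl := (c - pgf p c) / (1 - c).
Let dl0 : 0 < dl.
Proof.
rewrite divr_gt0 ?subr_gt0//; apply: (pgf_lt_above pge0 psum p1 vphi01 pvphi).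
by rewrite vc.
Qed.

Let speed v : c < v < 1 -> dl * (1 - v) <= v - pgf p v.
Proof.
move=> /andP[cv vl1]; apply: (pgf_chord_one pge0 psum vphi01 vc c1).
by rewrite !ltW.
Qed.

Let itv v : c < v < 1 -> 0 < v < 1.
Proof.
by move=> /andP[cv ->]; rewrite andbT (lt_trans _ cv)// (lt_trans branching_root_gt0).
Qed.

Let speed0 v : c < v < 1 -> 0 < v - pgf p v.
Proof.
move=> cv; apply: lt_le_trans (speed cv); rewrite mulr_gt0// subr_gt0.
by case/andP: cv.
Qed.

Let g n v : R := (1 - v ^+ n) / (v - pgf p v).

Let g_cont n v : c < v < 1 -> {for v, continuous (g n)}.
Proof.
move=> cv; apply: cvgM.
  by apply: cvgB; [exact: cvg_cst|exact: exprn_continuous].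
apply: cvgV; first by rewrite gt_eqF ?speed0.
by apply: cvgB; [exact: cvg_id|exact: (pgf_continuous pge0 psum (itv cv))].
Qed.

Let g_ge0 n v : c < v < 1 -> 0 <= g n v.
Proof.
move=> cv; have /andP[/ltW v0 /ltW vl] := itv cv.
apply: divr_ge0; last by rewrite ltW ?speed0.
by rewrite subr_ge0 exprn_ile1.
Qed.

Let g_int n : leb.-integrable `]c, 1[ (EFin \o g n).
Proof.
apply: (@continuous_oo_bounded_integrable _ _ _ _ (n%:R / dl)); first exact: g_cont.
move=> v cv; rewrite ger0_norm ?g_ge0//.
have /andP[v0 vl] := itv cv; have v0' := ltW v0; have vl' := ltW vl.
rewrite ler_pdivrMr ?speed0// mulrAC ler_pdivlMr//.
have b1 : 1 - v ^+ n <= n%:R * (1 - v).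
  rewrite -[1 in leLHS](expr1n _ n) subrXX mulrC ler_wpM2r ?subr_ge0//.
  apply: (@le_trans _ _ (\sum_(i < n) 1)); last by rewrite sumr_const card_ord.
  by apply: ler_sum => i _; rewrite expr1n mul1r exprn_ile1.
apply: (@le_trans _ _ (n%:R * (1 - v) * dl)); first by rewrite ler_wpM2r// ltW.
by rewrite -mulrA ler_wpM2l// mulrC speed.
Qed.

Let fE n : \bar R := (\int[leb]_(v in `]c, 1%R[) (g n v)%:E)%E.
Let f n : R := fine (fE n).

Let f_fin n : fE n \is a fin_num. Proof. exact: integrable_fin_num (g_int n). Qed.

Let f_ge0 n : 0 <= f n.
Proof.
apply: fine_ge0; apply: integral_ge0 => v; rewrite /= in_itv/= => cv.
by rewrite lee_fin g_ge0.
Qed.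

Let f_row n : (\sum_(k <oo) (p k)%:E * (f (n + k))%:E <= (f n.+1 + 1 / n.+1%:R)%:E)%E.
Proof.
have mp (E : R -> R) : (forall v, c < v < 1 -> {for v, continuous E}) ->
    measurable_fun `]c, 1[ (EFin \o E).
  by move=> cE; apply/measurable_EFinP; exact: continuous_oo_measurable.
have cX v : c < v < 1 -> {for v, continuous (fun w : R => w ^+ n)}.
  by move=> _; exact: exprn_continuous.
have -> : (\sum_(k <oo) (p k)%:E * (f (n + k))%:E =
    \int[leb]_(v in `]c, 1%R[) (g n.+1 v + v ^+ n)%:E)%E.
  transitivity (\sum_(k <oo) \int[leb]_(v in `]c, 1%R[) (p k * g (n + k) v)%:E)%E.
    apply: eq_eseriesr => k _; rewrite /f fineK// -ge0_integralZl//=.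
    - exact: measurable_int (g_int (n + k)).
    - by move=> v; rewrite in_itv/= => cv; rewrite lee_fin g_ge0.
    - by rewrite lee_fin.
  rewrite -integral_nneseries//=; last 2 first.
  - move=> k; apply: mp => // v cv; apply: cvgM; [exact: cvg_cst|exact: g_cont].
  - by move=> k v; rewrite in_itv/= => cv; rewrite lee_fin mulr_ge0 ?g_ge0.
  apply: eq_integral => v; rewrite inE/= in_itv/= => cv.
  have /andP[v0 vl] := itv cv; have v01 : 0 <= v <= 1 by rewrite !ltW.
  have sp := speed0 cv.
  have S : series (fun k => p k * g (n + k) v) @ \oo --> g n.+1 v + v ^+ n.
    have -> : g n.+1 v + v ^+ n = (1 - v ^+ n * pgf p v) / (v - pgf p v).
      by rewrite /g exprS; field; rewrite gt_eqF.
    have cB : ((series p m - v ^+ n * pseries p v m) / (v - pgf p v)) @[m --> \oo] -->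
        (1 - v ^+ n * pgf p v) / (v - pgf p v).
      apply: cvgMr_tmp; apply: cvgB => //; apply: cvgMl_tmp.
      exact: (pgf_cvg pge0 psum v01).
    apply: cvg_trans cB; apply: near_eq_cvg; apply: nearW => m /=.
    rewrite /pseries /series /= mulr_sumr -sumrB mulr_suml.
    by apply: eq_bigr => k _; rewrite /g exprD; ring.
  by apply: nonneg_series_lim S => k; rewrite mulr_ge0 ?g_ge0.
have -> : (\int[leb]_(v in `]c, 1%R[) (g n.+1 v + v ^+ n)%:E =
    fE n.+1 + \int[leb]_(v in `]c, 1%R[) (v ^+ n)%:E)%E.
  rewrite -ge0_integralD//=.
  - by move=> v; rewrite in_itv/= => cv; rewrite lee_fin g_ge0.
  - exact: measurable_int (g_int n.+1).
  - by move=> v; rewrite in_itv/= => /itv/andP[/ltW v0 _]; rewrite lee_fin exprn_ge0.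
  - exact: mp.
have X1 : (\int[leb]_(v in `]c, 1%R[) (v ^+ n)%:E <= (1 / n.+1%:R)%:E)%E.
  have c0 : 0 < c by exact: lt_trans branching_root_gt0 vc.
  have dF (x : R) : c < x < 1 -> is_derive x 1 (fun v : R => n.+1%:R^-1 * v ^+ n.+1) (x ^+ n).
    move=> _; have := is_deriveZ (n.+1%:R^-1 : R) (is_derive_exprn n x).
    by rewrite /GRing.scale/= mulKf.
  rewrite (@FTC_oo_ge0 _ (fun v => v ^+ n) (fun v => n.+1%:R^-1 * v ^+ n.+1) c 1
      (n.+1%:R^-1 * c ^+ n.+1) (n.+1%:R^-1 * 1 ^+ n.+1) c1 dF)//.
  - by rewrite lee_fin expr1n mulr1 div1r lerBlDr lerDl mulr_ge0// exprn_ge0// ltW.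
  - by apply: cvg_at_right_filter; apply: cvgMl_tmp; exact: exprn_continuous.
  - by apply: cvg_at_left_filter; apply: cvgMl_tmp; exact: exprn_continuous.
  - by move=> x /itv/andP[/ltW x0 _]; exact: exprn_ge0.
by rewrite EFinD /f fineK//; exact: leeD2l.
Qed.

Hypothesis divergent : (\int[leb]_(v in `]c, 1%R[) ((v - pgf p v)^-1)%:E = +oo)%E.

Let f_unbounded (B : R) : exists N, forall n, (N <= n)%N -> B <= f n.
Proof.
have cv : (fE n @[n --> \oo] --> +oo)%E.
  rewrite -divergent.
  rewrite (_ : (\int[leb]_(v in `]c, 1%R[) ((v - pgf p v)^-1)%:E)%E =
      (\int[leb]_(v in `]c, 1%R[) limn (fun n => (g n v)%:E))%E); last first.
    apply: eq_integral => v; rewrite inE/= in_itv/= => cv; apply/esym/cvg_lim => //.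
    apply: cvg_EFin; first exact: nearW.
    have /andP[v0 vl] := itv cv.
    rewrite -[X in _ --> X]mul1r; apply: cvgMr_tmp.
    rewrite -[X in _ --> X]subr0; apply: cvgB; first exact: cvg_cst.
    by apply: cvg_expr; rewrite ger0_norm// ltW.
  apply: cvg_monotone_convergence => //.
  - by move=> n; exact: measurable_int (g_int n).
  - move=> v /=; rewrite in_itv/= => cv m n mn; rewrite lee_fin.
    have /andP[/ltW v0 /ltW vl] := itv cv.
    rewrite /g; apply: ler_wpM2r; first by rewrite invr_ge0 ltW ?speed0.
    by rewrite lerB//; exact: ler_wiXn2l.
have /cvgeyPge/(_ B) [N _ h] := cv.
by exists N => n Nn; rewrite -lee_fin /f fineK//; exact: h.
Qed.

(** The Lyapunov function [f n] is the integral of [(1 - v^n) / (v - pgf p v)] over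
    ]c, 1[.  Summing against p replaces [1 - v^(n+1)] by
    [1 - v^n * pgf p v = (1 - v^(n+1)) + v^n (v - pgf p v)], which adds the integral of
    [v^n], at most [1 / (n + 1)]; and f tends to the divergent integral. *)
Lemma divergent_never_explodes x :
  (iter N (kop A) (cst 1) x @[N --> \oo] --> 0)%E.
Proof.
apply: (@lyapunov_never_explodes _ _ _ _ _ hpar f 1) => //.
rewrite /f /fE (_ : integral _ _ _ = 0)%E//.
apply: integral0_eq => v _; by rewrite /g expr0 subrr mul0r.
Qed.

End Divergent.

Lemma explosion_criterion x :
  ~ (iter N (kop A) (cst 1) x @[N --> \oo] --> 0)%E ->
  vphi < 1 /\ forall c, vphi < c < 1 ->
    leb.-integrable `]c, 1[ (EFin \o (fun v => (v - pgf p v)^-1)).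
Proof.
move=> nx.
have v1 : vphi < 1.
  rewrite lt_neqAle; case: hvphi => -[/andP[_ ->] _] _; rewrite andbT.
  by apply/eqP => v1; apply: nx; exact: root1_never_explodes.
split => // c /andP[vc c1].
have v01 : 0 <= vphi < 1 by rewrite v1 ltW// branching_root_gt0.
have sp v : c < v < 1 -> 0 < v - pgf p v.
  move=> /andP[cv vl]; rewrite subr_gt0.
  apply: (pgf_lt_above pge0 psum p1 v01 branching_root_fix).
  by rewrite vl andbT (lt_trans vc).
apply/integrableP; split.
  apply/measurable_EFinP; apply: continuous_oo_measurable => v cv.
  apply: cvgV; first by rewrite gt_eqF ?sp.
  apply: cvgB; [exact: cvg_id|apply: (pgf_continuous pge0 psum)].
  by case/andP: cv => cv ->; rewrite andbT (lt_trans _ cv)// (lt_trans branching_root_gt0).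
rewrite (_ : integral _ _ _ = \int[leb]_(v in `]c, 1%R[) ((v - pgf p v)^-1)%:E)%E.
  rewrite ltey; apply/eqP => dv; apply: nx.
  exact: (divergent_never_explodes v1 vc c1 dv).
apply: eq_integral => v; rewrite inE/= in_itv/= => cv.
by rewrite gtr0_norm// invr_gt0 sp.
Qed.

End Criterion.

(** * Kernels for the chain without migration *)

Section Bounded.
Context {R : realType}.
Local Open Scope ereal_scope.

(** Beyond some N the function is below e; the finitely many other values are
    compared with the mean holding times, which are positive above a. *)
Lemma dominated_of_cvg0 (Q : nat -> nat -> R) (a : nat) (u : nat -> \bar R) :
  (forall i, (a < i)%N -> (0 < exit_rate Q i)%R) ->
  (forall i, u i \is a fin_num) -> (forall i, (i <= a)%N -> u i = 0) ->
  fine (u i) @[i --> \oo] --> (0%R : R) -> dominated (hold Q a) u.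
Proof.
move=> q_gt0 ufin ua u_cvg0 e e0.
have /cvgrPdist_le/(_ _ e0) [N _ uN] := u_cvg0.
pose C := (\sum_(i < N) `|fine (u i) * exit_rate Q i|)%R.
have C0 : (0 <= C)%R by apply: sumr_ge0.
exists C => // i; have [ia|ai] := leqP i a.
  by rewrite ua// /hold ltnNge ia mule0 adde0 lee_fin ltW.
rewrite /hold ai -[u i]fineK// -EFinM -EFinD lee_fin.
have [Ni|iN] := leqP N i.
  have := uN i Ni; rewrite sub0r normrN => h.
  rewrite (le_trans (ler_norm _))// (le_trans h)// lerDl.
  by rewrite mulr_ge0// invr_ge0 ltW// q_gt0.
apply: (@le_trans _ _ (C / exit_rate Q i)%R); last by rewrite lerDr ltW.
rewrite ler_pdivlMr ?q_gt0// (le_trans (ler_norm _))//.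
by rewrite /C (bigD1 (Ordinal iN))//= lerDl sumr_ge0.
Qed.

End Bounded.

Section BranchingKernel.
Context {R : realType}.
Variables (lambda mu : R) (p : nat -> R) (r : int -> R) (vphi l u : R).
Hypotheses (hpar : parameters lambda mu p r) (mu_eq0 : mu = 0)
  (vphi01 : 0 <= vphi < 1) (pvphi : pgf p vphi = vphi)
  (l0 : 0 <= l) (u1 : u <= 1) (lu : l < u)
  (side : forall v, l < v < u -> v != vphi).
Notation Q := (generator lambda mu p r).
Notation q := (exit_rate Q).
Notation leb := (@lebesgue_measure R).
Let pge0 := p_ge0 hpar.
Let psum := p_sum hpar.
Let p1 := p1_eq0 hpar.

(** The kernel whose integrals over ]0, vphi[ and ]vphi, 1[ are the mean times
    carried by absorption and by explosion.  It is nonnegative on both sides of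
    vphi, where numerator and denominator change sign together. *)
Definition occupation (n : nat) (v : R) := (v ^+ n - vphi ^+ n) / (lambda * (v - pgf p v)).
Notation theta := occupation.

Let itv01 v : l < v < u -> 0 < v < 1.
Proof. by move=> /andP[lv vu]; rewrite (le_lt_trans l0)//= (lt_le_trans vu). Qed.

Let speed_sg v : l < v < u -> 0 < (v - vphi) * (v - pgf p v).
Proof.
move=> vlu; have /andP[v0 v1] := itv01 vlu; have := side vlu.
rewrite neq_lt => /orP[h|h].
- rewrite -mulrNN mulr_gt0// oppr_gt0 subr_lt0//.
  by apply: (pgf_gt_below pge0 psum p1 vphi01 pvphi); rewrite ltW.
- rewrite mulr_gt0 ?subr_gt0//.
  by apply: (pgf_lt_above pge0 psum p1 vphi01 pvphi); rewrite h.
Qed.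

Let speed_neq0 v : l < v < u -> lambda * (v - pgf p v) != 0.
Proof.
move=> vlu; rewrite mulf_neq0 ?(gt_eqF (lambda_gt0 hpar))//.
by have := speed_sg vlu; case: eqP => // ->; rewrite mulr0 ltxx.
Qed.

(** The dependence on n is in a geometric sum between 0 and [1 / (1 - vphi)], so
    positivity, integrability and domination reduce to the case [n = 1]. *)
Lemma occupationE n v :
  theta n v = (\sum_(i < n) v ^+ (n.-1 - i) * vphi ^+ i) * theta 1 v.
Proof. by rewrite /theta subrXX !expr1; ring. Qed.

Let geom_ge0 n v : l < v < u -> 0 <= \sum_(i < n) v ^+ (n.-1 - i) * vphi ^+ i.
Proof.
move=> /itv01/andP[/ltW v0 _]; have /andP[f0 _] := vphi01.
by apply: sumr_ge0 => i _; rewrite mulr_ge0 ?exprn_ge0.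
Qed.

Lemma occupation_ge0 n v : l < v < u -> 0 <= theta n v.
Proof.
move=> vlu; rewrite occupationE mulr_ge0 ?geom_ge0// /theta !expr1.
have h := speed_sg vlu; have b : v - pgf p v != 0.
  by have := speed_neq0 vlu; rewrite mulf_eq0 negb_or => /andP[].
have -> : (v - vphi) / (lambda * (v - pgf p v)) =
    (v - vphi) * (v - pgf p v) / (lambda * (v - pgf p v) ^+ 2).
  by field; rewrite b gt_eqF ?(lambda_gt0 hpar).
by rewrite divr_ge0// ltW// mulr_gt0 ?(lambda_gt0 hpar)// exprn_even_gt0.
Qed.

Lemma occupation_le n v : l < v < u -> theta n v <= (1 - vphi)^-1 * theta 1 v.
Proof.
move=> vlu; rewrite occupationE; apply: ler_wpM2r; first exact: occupation_ge0.
have /andP[f0 f1] := vphi01; have /andP[/ltW v0 /ltW v1] := itv01 vlu.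
rewrite -[leRHS]mul1r ler_pdivlMr ?subr_gt0// mulrC.
apply: (@le_trans _ _ ((1 - vphi) * \sum_(i < n) 1 ^+ (n.-1 - i) * vphi ^+ i)).
  apply: ler_wpM2l; first by rewrite subr_ge0 ltW.
  apply: ler_sum => i _; apply: ler_wpM2r; first exact: exprn_ge0.
  by rewrite expr1n exprn_ile1.
by rewrite -subrXX expr1n lerBlDr lerDl exprn_ge0.
Qed.

Lemma occupation_continuous n v : l < v < u -> {for v, continuous (theta n)}.
Proof.
move=> vlu; have v01 := itv01 vlu; apply: cvgM.
  by apply: cvgB; [exact: exprn_continuous|exact: cvg_cst].
apply: cvgV; first exact: speed_neq0.
apply: cvgM; first exact: cvg_cst.
by apply: cvgB; [exact: cvg_id|exact: (pgf_continuous pge0 psum v01)].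
Qed.

Hypothesis integrable1 : leb.-integrable `]l, u[ (EFin \o theta 1).
Local Open Scope ereal_scope.

Definition occupation_mass n := \int[leb]_(v in `]l, u[) (theta n v)%:E.
Notation mass := occupation_mass.

Lemma occupation_integrable n : leb.-integrable `]l, u[ (EFin \o theta n).
Proof.
apply: (@le_oo_integrable _ _ (fun v => (1 - vphi)^-1 * theta 1 v)%R).
- exact: occupation_continuous.
- by move=> v vlu; rewrite ger0_norm ?occupation_ge0 ?occupation_le.
- exact/integrable_scale/integrable1.
Qed.

Lemma occupation_mass0 : mass 0%N = 0.
Proof. by apply: integral0_eq => v _; rewrite /theta !expr0 subrr mul0r. Qed.

Lemma occupation_mass_ge0 n : 0 <= mass n.
Proof.
by apply: integral_ge0 => v; rewrite /= in_itv/= => vlu; rewrite lee_fin occupation_ge0.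
Qed.

Lemma occupation_mass_fin n : mass n \is a fin_num.
Proof. exact: integrable_fin_num (occupation_integrable n). Qed.

Lemma occupation_mass_cvg0 : fine (mass n) @[n --> \oo] --> (0%R : R).
Proof.
have mD : measurable (`]l, u[%classic : set (measurableTypeR R)) by exact: measurable_itv.
pose f_ n := EFin \o theta n.
(* v^n and vphi^n both tend to 0 as n grows *)
have [|||||_ _] := @dominated_convergence _ _ _ leb `]l, u[%classic mD f_ (cst 0)
    (EFin \o (fun v => (1 - vphi)^-1 * theta 1 v)%R).
- by move=> n; exact: measurable_int (occupation_integrable n).
- exact: measurable_cst.
- apply: aeW => v /=; rewrite in_itv/= => /itv01/andP[v0 v1].
  apply: cvg_EFin; first exact: nearW.
  rewrite -[X in _ --> X](mul0r (lambda * (v - pgf p v))^-1%R); apply: cvgMr_tmp.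
  rewrite -[X in _ --> X]subr0; have /andP[f0 f1] := vphi01.
  by apply: cvgB; apply: cvg_expr; rewrite ger0_norm// ltW.
- exact/integrable_scale/integrable1.
- apply: aeW => v n /=; rewrite in_itv/= => vlu.
  by rewrite lee_fin ger0_norm ?occupation_ge0 ?occupation_le.
by rewrite integral0 => /fine_cvgP[_].
Qed.

(** The numerators [v^n - vphi^n] sum to [v^n * pgf p v - vphi^(n+1)], which differs
    from [v^(n+1) - vphi^(n+1)] by [v^n (v - pgf p v)]: the denominator cancels. *)
Lemma occupation_row n v : (l < v < u)%R ->
  \sum_(k <oo) (jump_rate lambda mu p r n k * theta (n + k) v)%:E =
  (q n.+1 * theta n.+1 v - n.+1%:R * v ^+ n)%:E.
Proof.
move=> vlu; have /andP[v0 v1] := itv01 vlu; have sp := speed_neq0 vlu.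
have v01 : (0 <= v <= 1)%R by rewrite !ltW.
have f01 : (0 <= vphi <= 1)%R by have /andP[-> /ltW] := vphi01.
apply: nonneg_series_lim.
  by move=> k; rewrite mulr_ge0 ?occupation_ge0// row_ge0.
set c := (lambda * n.+1%:R / (lambda * (v - pgf p v)))%R.
have -> : (q n.+1 * theta n.+1 v - n.+1%:R * v ^+ n =
    c * (v ^+ n * pgf p v - vphi ^+ n * pgf p vphi))%R.
  move: sp; rewrite mulf_eq0 negb_or => /andP[ln0 sp].
  by rewrite exit_rateS /theta /c pvphi mu_eq0 !exprS; field; rewrite sp ln0.
have cB : (c * (v ^+ n * pseries p v m - vphi ^+ n * pseries p vphi m))%R @[m --> \oo] -->
    (c * (v ^+ n * pgf p v - vphi ^+ n * pgf p vphi))%R.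
  apply: cvgMl_tmp; apply: cvgB; apply: cvgMl_tmp; exact: (pgf_cvg pge0 psum).
apply: cvg_trans cB; apply: near_eq_cvg; apply: nearW => m /=.
rewrite /pseries /series /= !mulr_sumr -sumrB mulr_sumr.
by apply: eq_bigr => k _; rewrite /jump_rate /theta /c mu_eq0 !exprD; ring.
Qed.

Lemma occupation_mass_row n : (q n.+1)%:E * mass n.+1 =
  (u ^+ n.+1 - l ^+ n.+1)%:E + \sum_(k <oo) (jump_rate lambda mu p r n k)%:E * mass (n + k)%N.
Proof.
pose G v := (q n.+1 * theta n.+1 v - n.+1%:R * v ^+ n)%R.
have G0 v : (l < v < u)%R -> (0 <= G v)%R.
  move=> vlu; rewrite -lee_fin -(occupation_row n vlu); apply: nneseries_ge0 => k _ _.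
  by rewrite lee_fin mulr_ge0 ?occupation_ge0// row_ge0.
have cX v : (l < v < u)%R -> {for v, continuous (fun w : R => n.+1%:R * w ^+ n)%R}.
  by move=> _; apply: cvgM; [exact: cvg_cst|exact: exprn_continuous].
have X0 v : (l < v < u)%R -> (0 <= n.+1%:R * v ^+ n)%R.
  by move=> /itv01/andP[/ltW v0 _]; rewrite mulr_ge0// exprn_ge0.
rewrite (row_integral hpar (e := theta) (G := G)); first last.
- by move=> v; exact: occupation_row.
- by move=> k; apply: continuous_oo_measurable => v; exact: occupation_continuous.
- by move=> k v; exact: occupation_ge0.
have <- : \int[leb]_(v in `]l, u[) (n.+1%:R * v ^+ n)%:E = (u ^+ n.+1 - l ^+ n.+1)%:E.
  apply: (@FTC_oo_ge0 _ _ (fun v => v ^+ n.+1)%R) => //.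
  - by move=> v _; exact: is_derive_exprn.
  - by apply: cvg_at_right_filter; exact: exprn_continuous.
  - by apply: cvg_at_left_filter; exact: exprn_continuous.
rewrite -ge0_integralD//=; first last.
- apply/measurable_EFinP; apply: continuous_oo_measurable => v vlu; apply: cvgB; last exact: cX.
  by apply: cvgM; [exact: cvg_cst|exact: occupation_continuous].
- by apply/measurable_EFinP; exact: continuous_oo_measurable.
rewrite /mass -ge0_integralZl//=; first last.
- by rewrite lee_fin exit_rate_ge0.
- by move=> v; rewrite in_itv/= => vlu; rewrite lee_fin occupation_ge0.
- by apply/measurable_EFinP; apply: continuous_oo_measurable => v; exact: occupation_continuous.
by apply: eq_integral => v _; rewrite -EFinM -EFinD /G addrC subrK.
Qed.

End BranchingKernel.

(** * Potential theory of the chain killed at its entrance below a level *)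

Section KilledChain.
Context {R : realType}.
Variables (lambda mu : R) (p : nat -> R) (r : int -> R).
Hypothesis hpar : parameters lambda mu p r.
Notation Q := (generator lambda mu p r).
Notation q := (exit_rate Q).
Notation J := (jump_prob Q).
Notation jump_rate := (jump_rate lambda mu p r).
Variable a : nat.
Notation K := (kop (kill Q a)).
Local Open Scope ereal_scope.

(** The probability of jumping from a state above a to a state at most a. *)
Definition entrance (i : nat) : \bar R := K (fun j => (j <= a)%N%:R%:E) i.

Let K_ge0 : forall i j, (0 <= kill Q a i j)%R.
Proof. exact: (kill_ge0 (jump_prob_ge0 hpar)). Qed.

Let hold_ge0 : forall i, 0 <= hold Q a i := hold_ge0 (exit_rate_ge0 hpar) a.

Lemma entrance_ge0 i : 0 <= entrance i.
Proof. by apply: kop_ge0 => // j; rewrite lee_fin. Qed.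

Definition truncated (f : nat -> \bar R) i := if (a < i)%N then f i else 0.

Lemma unit_source x : \sum_(k <oo) iter k K (fun i => 1%:E * hold Q a i) x =
  \sum_(k <oo) iter k K (hold Q a) x.
Proof.
by apply: eq_eseriesr => k _; apply: eq_iter_kop => i; rewrite mul1e.
Qed.

Lemma zero_source x : \sum_(k <oo) iter k K (fun i => 0%:E * hold Q a i) x = 0.
Proof. by apply: eseries0 => k _ _; rewrite iter_kopZ// mul0e. Qed.

Section Harmonic.
Variables (f : nat -> \bar R) (t : nat -> R).
Hypotheses (f_ge0 : forall i, 0 <= f i) (f_fin : forall i, f i \is a fin_num)
  (t_ge0 : forall i, (0 <= t i)%R)
  (f_row : forall n, (q n.+1)%:E * f n.+1 =
     (t n.+1)%:E + \sum_(k <oo) (jump_rate n k)%:E * f (n + k)%N).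
Notation source := (fun i => (t i)%:E * hold Q a i).

Let source_ge0 i : 0 <= source i. Proof. by rewrite mule_ge0// lee_fin. Qed.

Let fa_ge0 i : 0 <= f a * entrance i.
Proof. by rewrite mule_ge0// entrance_ge0. Qed.

Lemma truncated_ge0 i : 0 <= truncated f i.
Proof. by rewrite /truncated; case: ifP. Qed.

(** In the equation [f = t / q + J f], [kop_kill_split] splits the operator J at
    the level a. *)
Lemma truncated_step i :
  truncated f i = (source i + f a * entrance i) + K (truncated f) i.
Proof.
rewrite /truncated /hold; case: ifPn => [ai|ai]; last first.
  by rewrite /entrance !(kop_kill _) (negbTE ai) !mule0 !adde0.
rewrite -addeA [X in _ + X]addeC -(kop_kill_split hpar f_ge0 ai (f_fin a)).
case: i ai => // n _; have q0 := exit_rate_gt0 hpar (ltn0Sn n).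
have := congr1 (fun y => (q n.+1)^-1%:E * y) (f_row n).
rewrite -(kop_jump_scaled hpar)// ge0_muleDr ?lee_fin//; last first.
  by rewrite mule_ge0 ?lee_fin ?(ltW q0)// kop_ge0//; exact: jump_prob_ge0.
by rewrite /= !muleA -EFinM mulVf ?gt_eqF// !mul1e [X in X + _]muleC.
Qed.

Let step_ge0 i : 0 <= source i + f a * entrance i. Proof. exact: adde_ge0. Qed.

Lemma killed_source_finite x : \sum_(k <oo) iter k K source x < +oo.
Proof.
apply: (@le_lt_trans _ _ (truncated f x)).
  apply: le_trans (green_sum_le K_ge0 truncated_ge0 step_ge0 truncated_step x).
  apply: lee_nneseries => [k _ _|k _]; first exact: iter_kop_ge0.
  by apply: iter_kop_le => // i; rewrite leeDl.
by rewrite /truncated; case: ifP => // _; rewrite ltey_eq f_fin.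
Qed.

Hypotheses (f_cvg0 : fine (f i) @[i --> \oo] --> (0%R : R)).

(** Since f tends to 0, its truncation is dominated by the mean holding times
    and is therefore a Green sum. *)
Lemma killed_decomposition x : \sum_(k <oo) iter k K (hold Q a) x < +oo ->
  truncated f x = \sum_(k <oo) iter k K source x + f a * \sum_(k <oo) iter k K entrance x.
Proof.
move=> hold_sum.
have dom : dominated (hold Q a) (truncated f).
  apply: dominated_of_cvg0.
  - by move=> i ai; apply: (exit_rate_gt0 hpar); exact: leq_ltn_trans ai.
  - by move=> i; rewrite /truncated; case: ifP.
  - by move=> i; rewrite /truncated ltnNge => ->.
  - apply: cvg_trans f_cvg0; apply: near_eq_cvg; exists a.+1 => // i /= ai.
    by rewrite /truncated ai.
rewrite -(green K_ge0 (kill_substochastic hpar a) hold_ge0 hold_sum truncated_ge0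
  step_ge0 truncated_step dom).
rewrite -(fineK (f_fin a)) -nneseriesZl; last first.
  by move=> k _; apply: iter_kop_ge0 => //; exact: entrance_ge0.
rewrite -nneseriesD; last 2 first.
- by move=> k _ _; exact: iter_kop_ge0.
- move=> k _ _; rewrite mule_ge0 ?lee_fin ?fine_ge0//.
  by apply: iter_kop_ge0 => //; exact: entrance_ge0.
apply: eq_eseriesr => k _; rewrite iter_kopD//; last first.
  by move=> i; rewrite fineK.
by rewrite iter_kopZ// => i; exact: entrance_ge0.
Qed.

End Harmonic.
End KilledChain.

(** * The Green function with migration *)

Section Migration.
Context {R : realType}.
Variables (lambda mu : R) (p : nat -> R) (r : int -> R) (phi vphi : R).
Notation s := (shift_law r).
Notation Q := (generator lambda mu p r).
Notation leb := (@lebesgue_measure R).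
Hypotheses (hpar : parameters lambda mu p r) (mu0 : 0 < mu)
  (phi01 : 0 <= phi < 1) (sphi : pgf s phi = phi)
  (vphi01 : 0 <= vphi < 1) (pvphi : pgf p vphi = vphi) (phi_vphi : phi < vphi).
Hypothesis integrable_speed : forall c, vphi < c < 1 ->
  leb.-integrable `]c, 1[ (EFin \o (fun v => (v - pgf p v)^-1)).
Notation rhoU := (upper_density lambda mu p r).
Notation rhoL := (lower_integrand lambda mu p r phi).
Notation h := (moment vphi 1 rhoU).
Notation g := (moment 0 vphi (rhoL 0%N)).

Let vphi_ge0 : 0 <= vphi. Proof. by case/andP: vphi01. Qed.
Let vphi_le1 : vphi <= 1. Proof. by case/andP: vphi01 => _ /ltW. Qed.

Let U_ge0 v (v1 : vphi < v < 1) : 0 <= rhoU v := upper_density_ge0 hpar vphi01 pvphi v1.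
Let U_cont v (v1 : vphi < v < 1) : {for v, continuous rhoU}.
Proof.
exact: (upper_density_continuous hpar mu0 phi01 sphi vphi01 pvphi phi_vphi integrable_speed).
Qed.
Let U_int := upper_density_integrable hpar mu0 phi01 sphi vphi01 pvphi phi_vphi integrable_speed.

Let L_ge0 v (v1 : 0 < v < vphi) : 0 <= rhoL 0%N v.
Proof. by rewrite ltW// (lower_density_gt0 _ hpar vphi01 pvphi). Qed.
Let L_cont v (v1 : 0 < v < vphi) : {for v, continuous (rhoL 0%N)}.
Proof. exact: (lower_density_continuous hpar mu0 phi01 sphi vphi01 pvphi phi_vphi). Qed.
Let L_int := lower_density_integrable hpar mu0 phi01 sphi vphi01 pvphi phi_vphi.

Let h_ge0 := moment_ge0 vphi_ge0 (lexx 1) U_ge0.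
Let h_fin := moment_fin vphi_ge0 (lexx 1) U_ge0 U_cont U_int.
Let g_ge0 := moment_ge0 (lexx 0) vphi_le1 L_ge0.
Let g_fin := moment_fin (lexx 0) vphi_le1 L_ge0 L_cont L_int.

Lemma lower_momentE n : g n = (\int[leb]_(z in `]0%R, vphi[) (rhoL n z)%:E)%E.
Proof. by apply: eq_integral => z _; rewrite [in RHS]lower_integrandE. Qed.

Lemma lower_ointegrable n : ointegrable (rhoL n) 0 vphi.
Proof.
rewrite /ointegrable (min_idPl vphi_ge0) (max_idPr vphi_ge0).
rewrite (_ : rhoL n = (fun z => z ^+ n * rhoL 0%N z)); last first.
  by apply/funext => z; exact: lower_integrandE.
exact: (moment_integrable (lexx 0) vphi_le1 L_ge0 L_cont L_int).
Qed.

Lemma lower_ointE n : oint (rhoL n) 0 vphi = fine (g n).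
Proof. by rewrite /oint vphi_ge0 lower_momentE. Qed.

Local Open Scope ereal_scope.
Variables (a x : nat).
Hypothesis ax : (a <= x)%N.
Notation K := (kop (kill Q a)).

Let h_row n := moment_row hpar vphi_ge0 (lexx 1%R) U_ge0 U_cont U_int
  (upper_flux hpar mu0 phi01 sphi vphi01 pvphi phi_vphi integrable_speed n).

Let g_row n := moment_row hpar (lexx 0%R) vphi_le1 L_ge0 L_cont L_int
  (lower_flux hpar mu0 phi01 sphi vphi01 pvphi phi_vphi n).2.

Let iter_ge0 k f : (forall i, 0 <= f i) -> 0 <= iter k K f x.
Proof. by move=> f0; apply: iter_kop_ge0 => //; exact: (kill_ge0 (jump_prob_ge0 hpar)). Qed.

Lemma migration_green_finite : \sum_(k <oo) iter k K (hold Q a) x < +oo.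
Proof.
rewrite -unit_source.
exact: (@killed_source_finite _ _ _ _ _ hpar a h (cst 1%R) h_ge0 h_fin
  (fun _ => ler01) h_row x).
Qed.

Let c := (oint (rhoL x) 0 vphi / oint (rhoL a) 0 vphi)%R.

(** Both moment families decompose with the same Green sum of [entrance], which
    is eliminated; for [x = a] the truncations vanish and so does that sum. *)
Lemma migration_green :
  \sum_(k <oo) iter k K (hold Q a) x + h a * c%:E = h x.
Proof.
have hfin := migration_green_finite.
have := killed_decomposition hpar h_ge0 h_fin (t := cst 1%R) (fun _ => ler01) h_row
  (moment_cvg0 vphi_ge0 (lexx 1%R) U_ge0 U_cont U_int) hfin.
rewrite unit_source.
have := killed_decomposition hpar g_ge0 g_fin (t := cst 0%R) (fun _ => lexx _) g_row
  (moment_cvg0 (lexx 0%R) vphi_le1 L_ge0 L_cont L_int) hfin.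
rewrite (zero_source hpar) add0e.
set B := \sum_(_ <oo) _; set G := \sum_(_ <oo) _.
have G0 : 0 <= G.
  apply: nneseries_ge0 => k _ _; apply: iter_ge0.
  exact: (hold_ge0 (exit_rate_ge0 hpar)).
have B0 : 0 <= B.
  by apply: nneseries_ge0 => k _ _; apply: iter_ge0; exact: (entrance_ge0 hpar).
have ga0 : 0 < g a.
  by rewrite lower_momentE; exact: (lower_integral_gt0 hpar mu0 phi01 sphi vphi01 pvphi phi_vphi).
have fga0 : (0 < fine (g a))%R by rewrite fine_gt0// ga0 ltey_eq g_fin.
rewrite /c !lower_ointE /truncated.
move: ax; rewrite leq_eqVlt => /orP[/eqP <-|->].
  rewrite ltnn => _ /esym/eqP; rewrite padde_eq0//; last by rewrite mule_ge0.
  by move=> /andP[/eqP -> _]; rewrite divff ?gt_eqF// add0e mule1.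
move=> gE ->.
have Bfin : B \is a fin_num.
  rewrite ge0_fin_numE// ltey; apply/eqP => Boo.
  by have := g_fin x; rewrite gE Boo gt0_muley.
rewrite gE -(fineK Bfin) -(fineK (g_fin a)) -EFinM /=.
by rewrite [(fine (g a) * _)%R]mulrC mulfK// gt_eqF.
Qed.

Lemma migration_integral :
  \sum_(k <oo) iter k K (hold Q a) x =
  \int[leb]_(v in `]vphi, 1%R[) ((v ^+ x - v ^+ a * c) * rhoU v)%:E.
Proof.
have mi j := moment_integrable vphi_ge0 (lexx 1%R) U_ge0 U_cont U_int j.
under eq_integral => v _.
  rewrite (_ : (_ * _)%:E = (v ^+ x * rhoU v)%:E - (c * (v ^+ a * rhoU v))%:E); last first.
    by rewrite -EFinB; congr EFin; ring.
  over.
rewrite integralB//=; first last.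
- exact: integrable_scale (mi a).
- exact: mi.
rewrite [X in _ - X](_ : _ = h a * c%:E); last first.
  by rewrite muleC /moment -integralZl//=; exact: mi.
by rewrite -[X in X - _]migration_green addeK// fin_numM.
Qed.

End Migration.

(** * The Green function without migration *)

Section Branching.
Context {R : realType}.
Variables (lambda mu : R) (p : nat -> R) (r : int -> R) (vphi : R).
Notation Q := (generator lambda mu p r).
Notation q := (exit_rate Q).
Notation leb := (@lebesgue_measure R).
Hypotheses (hpar : parameters lambda mu p r) (mu_eq0 : mu = 0)
  (vphi_gt0 : 0 < vphi) (vphi_lt1 : vphi < 1) (pvphi : pgf p vphi = vphi).
Hypothesis integrable_speed : forall c, vphi < c < 1 ->
  leb.-integrable `]c, 1[ (EFin \o (fun v => (v - pgf p v)^-1)).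
Notation theta := (occupation lambda p vphi).
Let pge0 := p_ge0 hpar.
Let psum := p_sum hpar.
Let p1 := p1_eq0 hpar.

Let vphi01 : 0 <= vphi < 1. Proof. by rewrite ltW. Qed.
Let vphi_ge0 := ltW vphi_gt0.
Let vphi_le1 := ltW vphi_lt1.

Let sideL v : 0 < v < vphi -> v != vphi. Proof. by move=> /andP[_ /lt_eqF ->]. Qed.
Let sideU v : vphi < v < 1 -> v != vphi. Proof. by move=> /andP[/gt_eqF ->]. Qed.

Let c := (vphi + 1) / 2.
Let vc : vphi < c. Proof. by have h := vphi_lt1; rewrite /c; lra. Qed.
Let c1 : c < 1. Proof. by have h := vphi_lt1; rewrite /c; lra. Qed.
Let dl := (c - pgf p c) / (c - vphi).
Let dl_gt0 : 0 < dl.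
Proof.
rewrite divr_gt0 ?subr_gt0//.
by apply: (pgf_lt_above pge0 psum p1 vphi01 pvphi); rewrite vc.
Qed.

Let thetaL_ge0 n (v : R) (vv : 0 < v < vphi) : 0 <= theta n v :=
  occupation_ge0 hpar vphi01 pvphi (lexx 0) vphi_le1 sideL n vv.
Let thetaU_ge0 n v (vv : vphi < v < 1) : 0 <= theta n v :=
  occupation_ge0 hpar vphi01 pvphi vphi_ge0 (lexx 1) sideU n vv.
Let thetaL_cont n (v : R) (vv : 0 < v < vphi) : {for v, continuous (theta n)} :=
  occupation_continuous hpar vphi01 pvphi (lexx 0) vphi_le1 sideL vv.
Let thetaU_cont n v (vv : vphi < v < 1) : {for v, continuous (theta n)} :=
  occupation_continuous hpar vphi01 pvphi vphi_ge0 (lexx 1) sideU vv.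

Lemma occupation1_lower : leb.-integrable `]0, vphi[ (EFin \o theta 1).
Proof.
have l0 := lambda_gt0 hpar.
apply: (@continuous_oo_bounded_integrable _ _ _ _ (lambda * dl)^-1) => //.
  by move=> v; exact: thetaL_cont.
move=> v vv; have /andP[v0 vl] := vv; rewrite ger0_norm ?thetaL_ge0//.
have b := pgf_chord_below pge0 psum vphi01 pvphi vc c1 (z := v).
have {}b : dl * (vphi - v) <= pgf p v - v by apply: b; rewrite !ltW.
have d0 : 0 < vphi - v by rewrite subr_gt0.
have s0 : 0 < pgf p v - v by apply: lt_le_trans b; exact: mulr_gt0 dl_gt0 d0.
rewrite /theta !expr1 -[v - vphi]opprB -[v - pgf p v]opprB mulrN invrN mulrNN.
rewrite ler_pdivrMr ?(mulr_gt0 l0 s0)// mulrC ler_pdivlMr ?(mulr_gt0 l0 dl_gt0)//.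
by rewrite mulrCA ler_wpM2l ?(ltW l0)// mulrC.
Qed.

(** Near vphi the chord bound makes the kernel bounded; near 1 it is at most the
    inverse of [lambda * (v - pgf p v)]. *)
Lemma occupation1_upper : leb.-integrable `]vphi, 1[ (EFin \o theta 1).
Proof.
have l0 := lambda_gt0 hpar.
apply: (@integrable_oo_glue _ _ vphi c 1) => //.
- apply: (@continuous_oo_bounded_integrable _ _ _ _ (lambda * dl)^-1).
    by move=> v /andP[v0 v1]; apply: thetaU_cont; rewrite v0 (lt_trans v1).
  move=> v /andP[v0 v1]; have vv : vphi < v < 1 by rewrite v0 (lt_trans v1).
  rewrite ger0_norm ?thetaU_ge0//.
  have b : dl * (v - vphi) <= v - pgf p v.
    by apply: (pgf_chord_above pge0 psum vphi01 pvphi vc c1); rewrite !ltW.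
  have d0 : 0 < v - vphi by rewrite subr_gt0.
  have s0 : 0 < v - pgf p v by apply: lt_le_trans b; exact: mulr_gt0 dl_gt0 d0.
  rewrite /theta !expr1 ler_pdivrMr ?(mulr_gt0 l0 s0)// mulrC ler_pdivlMr ?(mulr_gt0 l0 dl_gt0)//.
  by rewrite mulrCA ler_wpM2l ?(ltW l0)// mulrC.
- apply: (@le_oo_integrable _ _ (fun v => lambda^-1 * (v - pgf p v)^-1)).
  + by move=> v /andP[v0 v1]; apply: thetaU_cont; rewrite v1 (lt_trans vc).
  + move=> v /andP[v0 v1]; have vv : vphi < v < 1 by rewrite v1 (lt_trans vc).
    rewrite ger0_norm ?thetaU_ge0// /theta !expr1 invfM; apply: ler_piMl.
      rewrite mulr_ge0 ?invr_ge0 ?(ltW l0)// subr_ge0 ltW//.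
      exact: (pgf_lt_above pge0 psum p1 vphi01 pvphi vv).
    by have v0' := vphi_gt0; lra.
  + by apply: integrable_scale; apply: integrable_speed; rewrite vc.
Qed.

Local Open Scope ereal_scope.
Notation massL := (occupation_mass lambda p vphi 0 vphi).
Notation massU := (occupation_mass lambda p vphi vphi 1).
Notation K := (kop (kill Q 0)).

Let L_ge0 := occupation_mass_ge0 hpar vphi01 pvphi (lexx 0%R) vphi_le1 sideL.
Let U_ge0 := occupation_mass_ge0 hpar vphi01 pvphi vphi_ge0 (lexx 1%R) sideU.
Let L_fin := occupation_mass_fin hpar vphi01 pvphi (lexx 0%R) vphi_le1 sideL occupation1_lower.
Let U_fin := occupation_mass_fin hpar vphi01 pvphi vphi_ge0 (lexx 1%R) sideU occupation1_upper.
Let L_cvg := occupation_mass_cvg0 hpar vphi01 pvphi (lexx 0%R) vphi_le1 sideL occupation1_lower.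
Let U_cvg := occupation_mass_cvg0 hpar vphi01 pvphi vphi_ge0 (lexx 1%R) sideU occupation1_upper.
Let L_row := occupation_mass_row hpar mu_eq0 vphi01 pvphi (lexx 0%R) vphi_le1 vphi_gt0 sideL.
Let U_row := occupation_mass_row hpar mu_eq0 vphi01 pvphi vphi_ge0 (lexx 1%R) vphi_lt1 sideU.

Let total i := massL i + massU i.
Let total_ge0 i : 0 <= total i. Proof. exact: adde_ge0. Qed.
Let total_fin i : total i \is a fin_num. Proof. by rewrite fin_numD L_fin U_fin. Qed.

Let total_row n : (q n.+1)%:E * total n.+1 =
  (cst 1%R n.+1)%:E + \sum_(k <oo) (jump_rate lambda mu p r n k)%:E * total (n + k)%N.
Proof.
rewrite ge0_muleDr// L_row U_row expr0n /= subr0 expr1n.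
under [in RHS]eq_eseriesr do rewrite ge0_muleDr//.
rewrite nneseriesD; last 2 first.
- by move=> k _ _; rewrite mule_ge0// lee_fin row_ge0.
- by move=> k _ _; rewrite mule_ge0// lee_fin row_ge0.
by rewrite addeACA -EFinD [(vphi ^+ _ + _)%R]addrC subrK.
Qed.

Let total_cvg : fine (total i) @[i --> \oo] --> (0%R : R).
Proof.
rewrite -[X in _ --> X]addr0.
have cD : (fine (massL i) + fine (massU i))%R @[i --> \oo] --> (0%R + 0%R : R)%R.
  by apply: cvgD; [exact: L_cvg|exact: U_cvg].
apply: cvg_trans cD; apply: near_eq_cvg; apply: nearW => i /=.
by rewrite /total (fineD (L_fin i) (U_fin i)).
Qed.

Lemma branching_green_finite x : \sum_(k <oo) iter k K (hold Q 0) x < +oo.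
Proof.
rewrite -unit_source.
exact: (@killed_source_finite _ _ _ _ _ hpar 0 total (cst 1%R) total_ge0 total_fin
  (fun _ => ler01) total_row x).
Qed.

Let truncated0 (f : nat -> \bar R) x : f 0%N = 0 -> truncated 0 f x = f x.
Proof. by rewrite /truncated; case: x => [|n] /=. Qed.

Lemma branching_green x :
  \sum_(k <oo) iter k K (hold Q 0) x = massL x + massU x.
Proof.
have := killed_decomposition hpar total_ge0 total_fin (t := cst 1%R) (fun _ => ler01)
  total_row total_cvg (branching_green_finite x).
by rewrite unit_source truncated0 /total !occupation_mass0 adde0// mul0e adde0.
Qed.

(** Because [pgf p vphi = vphi], the function [vphi^n] is harmonic and its
    truncation is the Green sum of [entrance]. *)
Lemma branching_hit_prob i : (0 < i)%N ->
  \sum_(m <oo) iter m.+1 K (fun j => (j <= 0)%N%:R%:E) i = (vphi ^+ i)%:E.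
Proof.
move=> i0; pose f j : \bar R := (vphi ^+ j)%:E.
have f0 j : 0 <= f j by rewrite lee_fin exprn_ge0.
have frow n : (q n.+1)%:E * f n.+1 =
    (cst 0%R n.+1)%:E + \sum_(k <oo) (jump_rate lambda mu p r n k)%:E * f (n + k)%N.
  have f01 : (0 <= vphi <= 1)%R by rewrite vphi_ge0.
  rewrite add0e (eq_eseriesr (g := fun k => (jump_rate lambda mu p r n k * vphi ^+ (n + k))%:E)).
    rewrite (row_sum hpar n f01) pvphi exit_rateS mu_eq0 -EFinM; congr EFin.
    by rewrite exprS; ring.
  by move=> k _; rewrite EFinM.
have fcv : fine (f j) @[j --> \oo] --> (0%R : R).
  by apply: cvg_expr; rewrite ger0_norm.
have := killed_decomposition hpar f0 (fun _ => isT) (t := cst 0%R) (fun _ => lexx _)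
  frow fcv (branching_green_finite i).
rewrite /truncated i0 /f expr0 mul1e => ->.
rewrite (zero_source hpar) add0e.
by apply: eq_eseriesr => k _; rewrite iterSr.
Qed.

(** The source [vphi^i / q] of the lower kernel is the mean holding time weighted
    by the probability of hitting 0 afterwards. *)
Lemma branching_green_hit x :
  \sum_(k <oo) iter k K (fun i => hold Q 0 i *
    \sum_(m <oo) iter m.+1 K (fun j => (j <= 0)%N%:R%:E) i) x = massL x.
Proof.
have := killed_decomposition hpar L_ge0 L_fin (t := fun i => (vphi ^+ i - 0 ^+ i)%R) _
  L_row L_cvg (branching_green_finite x).
rewrite truncated0 ?occupation_mass0// mul0e adde0 => -> //; last first.
  by move=> i; rewrite subr_ge0 lerXn2r// nnegrE.
apply: eq_eseriesr => k _; apply: eq_iter_kop => i; rewrite /hold.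
case: i => [|i] /=; first by rewrite mul0e mule0.
by rewrite branching_hit_prob// expr0n subr0 muleC.
Qed.

End Branching.

(** * The mean values *)

Section OccupationIntegrals.
Context {R : realType}.
Variables (lambda : R) (p : nat -> R) (vphi : R).
Hypotheses (vphi_gt0 : 0 < vphi) (vphi_lt1 : vphi < 1).
Notation theta := (occupation lambda p vphi).
Notation leb := (@lebesgue_measure R).
Local Open Scope ereal_scope.

Lemma occupation_mass_split x :
  (forall v, (0 < v < vphi)%R -> (0 <= theta x v)%R) ->
  (forall v, (vphi < v < 1)%R -> (0 <= theta x v)%R) ->
  measurable_fun `]0%R, vphi[ (theta x) -> measurable_fun `]vphi, 1%R[ (theta x) ->
  \int[leb]_(v in `]0%R, 1%R[) (theta x v)%:E =
  occupation_mass lambda p vphi 0 vphi x + occupation_mass lambda p vphi vphi 1 x.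
Proof.
move=> L0 U0 /measurable_EFinP mL /measurable_EFinP mU.
have mL' : measurable_fun `]0%R, vphi] (EFin \o theta x).
  exact/emeasurable_fun_itv_bndo_bndcP.
have -> : `]0%R, 1%R[%classic = `]0%R, vphi]%classic `|` `]vphi, 1%R[%classic.
  by rewrite -itv_bndbnd_setU// ?bnd_simp ltW.
rewrite ge0_integral_setU//=.
- by rewrite -(integral_itv_bndo_bndc (f := EFin \o theta x)).
- by apply/measurable_funU; [exact: measurable_itv|exact: measurable_itv|split].
- move=> v [|]; rewrite /= in_itv/= => /andP[v0 v1]; rewrite lee_fin.
    move: v1; rewrite le_eqVlt => /orP[/eqP ->|v1].
      by rewrite /occupation subrr mul0r.
    by rewrite L0// v0.
  by rewrite U0// v0.
- apply/disj_setPS => y [/=]; rewrite 2!in_itv/= => /andP[_ yx] /andP[].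
  by rewrite ltNge yx.
Qed.

Lemma occupation_mass_below x : occupation_mass lambda p vphi 0 vphi x =
  \int[leb]_(v in `]0%R, vphi[) ((vphi ^+ x - v ^+ x) / (lambda * (pgf p v - v)))%:E.
Proof.
apply: eq_integral => v _; congr EFin.
by rewrite /occupation -[(v ^+ x - _)%R]opprB -[(v - pgf p v)%R]opprB mulrN invrN mulrNN.
Qed.

End OccupationIntegrals.

Theorem corollary5p3 (R : realType) (lambda mu : R) (p : nat -> R)
    (r : int -> R) (d : measure_display) (T : measurableType d)
    (P : nat -> probability T R) (X : R -> T -> option nat)
    (vphi phi : R) (x a : nat)
    (hpar : parameters lambda mu p r)
    (hX : forall y : nat,
       minimal_chain (generator lambda mu p r) (P y) y X)
    (hvphi : branching_root p vphi)
    (hphi : migration_root mu r phi)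
    (hE : exists y : nat, (0 < y)%N /\
       (0 < P y [set w | (lifetime X w < +oo)%E])%E) :
  (0 < mu -> phi < vphi -> (a <= x)%N ->
    [/\ (forall z, 0 < z < vphi ->
           ointegrable (lower_drift lambda mu p r) phi z),
        (forall v, vphi < v < 1 ->
           ointegrable (upper_drift lambda mu p r) v 1),
        ointegrable (lower_integrand lambda mu p r phi x) 0 vphi
        /\ ointegrable (lower_integrand lambda mu p r phi a) 0 vphi,
        (\int[P x]_w Order.min (lifetime X w) (hit_below a X w)
         = \int[lebesgue_measure]_(v in `]vphi, 1%R[)
             ((v ^+ x - v ^+ a
                 * (oint (lower_integrand lambda mu p r phi x) 0 vphi
                    / oint (lower_integrand lambda mu p r phi a) 0 vphi))
              * upper_density lambda mu p r v)%:E)%E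
      & (\int[P x]_w Order.min (lifetime X w) (hit_below a X w) < +oo)%E])
  /\
  (mu = 0 ->
    [/\ (\int[P x]_w Order.min (lifetime X w) (hit_below 0 X w)
         = \int[lebesgue_measure]_(v in `]0%R, 1%R[)
             ((v ^+ x - vphi ^+ x) / (lambda * (v - pgf p v)))%:E)%E
        /\ (\int[P x]_w Order.min (lifetime X w) (hit_below 0 X w) < +oo)%E,
        (\int[P x]_(w in [set w | (lifetime X w < +oo)%E]) lifetime X w
         = \int[lebesgue_measure]_(v in `]vphi, 1%R[)
             ((v ^+ x - vphi ^+ x) / (lambda * (v - pgf p v)))%:E)%E
        /\ (\int[P x]_(w in [set w | (lifetime X w < +oo)%E]) lifetime X w
            < +oo)%E
      & (\int[P x]_(w in [set w | (hit_below 0 X w < +oo)%E]) hit_below 0 X w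
         = \int[lebesgue_measure]_(v in `]0%R, vphi[)
             ((vphi ^+ x - v ^+ x) / (lambda * (pgf p v - v)))%:E)%E
        /\ (\int[P x]_(w in [set w | (hit_below 0 X w < +oo)%E])
              hit_below 0 X w < +oo)%E]).
Proof.
have q0 := exit_rate_ge0 hpar; have J0 := jump_prob_ge0 hpar.
have [vphi_lt1 integrable_speed] : vphi < 1 /\ forall c, vphi < c < 1 ->
    lebesgue_measure.-integrable `]c, 1[ (EFin \o (fun v => (v - pgf p v)^-1)).
  have [y [_ Ey]] := hE; have [Y [S [mY mS law Xjump Xend]]] := hX y.
  apply: (explosion_criterion hpar hvphi (x := y)) => nx; move: Ey.
  rewrite (never_explodes q0 J0 mY (fun n => (mS n).1) (fun n => (mS n).2) law Xjump Xend)//.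
  by rewrite ltxx.
have vphi_gt0 := branching_root_gt0 hvphi; have pvphi := branching_root_fix hvphi.
have vphi01 : 0 <= vphi < 1 by rewrite ltW.
have [Y [S [mY mS' law Xjump Xend]]] := hX x.
have mS n := (mS' n).1; have S0 n := (mS' n).2.
have qa b i : (b < i)%N -> 0 < exit_rate (generator lambda mu p r) i.
  by move=> bi; apply: (exit_rate_gt0 hpar); exact: leq_ltn_trans bi.
have exitE b : (\int[P x]_w Order.min (lifetime X w) (hit_below b X w) =
    \int[P x]_w exit_time Y S b w)%E.
  by apply: eq_integral => w _; rewrite (min_exit_time S0 Xjump Xend).
have meanE b := mean_exit_time q0 J0 mY mS S0 law (qa b).
split=> [mu0 phi_vphi ax|mu_eq0].
  have [phi01 sphi] := migration_root_fixpoint hpar mu0 hphi (lt_trans phi_vphi vphi_lt1).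
  have lo := lower_ointegrable hpar mu0 phi01 sphi vphi01 pvphi phi_vphi.
  split.
  - by move=> z; exact: (lower_drift_ointegrable hpar mu0 phi01 sphi vphi01 pvphi phi_vphi).
  - move=> v; exact: (upper_drift_ointegrable hpar mu0 phi01 sphi vphi01 pvphi phi_vphi
      integrable_speed).
  - by split; exact: lo.
  - by rewrite exitE meanE (migration_integral hpar mu0 phi01 sphi vphi01 pvphi phi_vphi
      integrable_speed ax).
  - rewrite exitE meanE.
    exact: (migration_green_finite hpar mu0 phi01 sphi vphi01 pvphi phi_vphi integrable_speed).
have totalE := branching_green hpar mu_eq0 vphi_gt0 vphi_lt1 pvphi integrable_speed x.
have totalfin := branching_green_finite hpar mu_eq0 vphi_gt0 vphi_lt1 pvphi integrable_speed x.
have F_fin : (\int[P x]_w exit_time Y S 0 w < +oo)%E by rewrite meanE.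
have sideL v : 0 < v < vphi -> v != vphi by move=> /andP[_ /lt_eqF ->].
have sideU v : vphi < v < 1 -> v != vphi by move=> /andP[/gt_eqF ->].
have hitE : (\int[P x]_(w in hits Y 0) exit_time Y S 0 w =
    occupation_mass lambda p vphi 0 vphi x)%E.
  rewrite (mean_exit_time_hits q0 J0 mY mS S0 law (qa 0%N)).
  exact: (branching_green_hit hpar mu_eq0 vphi_gt0 vphi_lt1 pvphi integrable_speed x).
have L0 := occupation_mass_ge0 hpar vphi01 pvphi (lexx 0) (ltW vphi_lt1) sideL x.
have U0 := occupation_mass_ge0 hpar vphi01 pvphi (ltW vphi_gt0) (lexx 1) sideU x.
have Lfin : occupation_mass lambda p vphi 0 vphi x \is a fin_num.
  rewrite ge0_fin_numE//; apply: le_lt_trans totalfin.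
  by rewrite totalE leeDl.
have missE : (\int[P x]_(w in ~` hits Y 0) exit_time Y S 0 w =
    occupation_mass lambda p vphi vphi 1 x)%E.
  have := mean_exit_time_split (P x) mY mS S0 0; rewrite meanE totalE hitE.
  move=> /(congr1 (fun y => y - occupation_mass lambda p vphi 0 vphi x)%E).
  by rewrite ![(occupation_mass _ _ _ 0 _ _ + _)%E]addeC !addeK.
split.
- rewrite exitE meanE; split=> //; rewrite totalE -occupation_mass_split//.
  + by move=> v; apply: (occupation_ge0 hpar vphi01 pvphi (lexx 0) (ltW vphi_lt1) sideL).
  + by move=> v; apply: (occupation_ge0 hpar vphi01 pvphi (ltW vphi_gt0) (lexx 1) sideU).
  + apply: continuous_oo_measurable => v.
    exact: (occupation_continuous hpar vphi01 pvphi (lexx 0) (ltW vphi_lt1) sideL).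
  + apply: continuous_oo_measurable => v.
    exact: (occupation_continuous hpar vphi01 pvphi (ltW vphi_gt0) (lexx 1) sideU).
- rewrite (mean_lifetime q0 J0 mY mS S0 law Xjump Xend F_fin); last first.
    by move=> i; rewrite leqn0 => /eqP ->; exact: exit_rate0.
  rewrite missE; split=> //; apply: le_lt_trans totalfin.
  by rewrite totalE leeDr.
- rewrite (mean_hit_below mY mS S0 Xjump Xend F_fin) hitE -occupation_mass_below.
  by split=> //; rewrite ltey_eq Lfin.
Qed.
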